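(* Fix an integer $n\ge 2$, and let $\omega\in\mathcal D(\sigma,C_\omega,n)$ and $x\in\mathbb T^n$. (i) Let $p\in(1,2]$, $1\le q\le\infty$ and $f\in B^s_{p,q}(\mathbb T^n)$, where either $q=1$ and $s\ge\max\{\sigma,n/p\}$, or $q>1$ and $s>\max\{\sigma,n/p\}$. Then for every $T>0$ $$\left|\frac1T\int_0^T f(x+\omega t)\,dt-\int_{\mathbb T^n}f(y)\,dy\right|\le\frac{C(s,\sigma,p,q)}{C_\omega}\,\|f\|_{B^s_{p,q}(\mathbb T^n)}\,\frac1T .$$ (ii) Let $s>0$, $1\le q\le\infty$ and $f\in B^s_{\infty,q}(\mathbb T^n)$. Then $$\left|\frac1T\int_0^T f(x+\omega t)\,dt-\int_{\mathbb T^n}f(y)\,dy\right|\le\frac{C(\sigma,s,q)}{C_\omega}\,\|f\|_{B^s_{\infty,q}(\mathbb T^n)}\begin{cases}T^{-1}, & s>\sigma,\\ T^{-1}(\log T)^{1-1/q}, & s=\sigma,\\ T^{-s/\sigma}, & s<\sigma,\end{cases}$$ for every $T>0$ if $s\ne\sigma$, and for every $T\ge2$ if $s=\sigma$. (iii) Let $k\in\{0,1,2,\dots\}$, $0<\alpha\le1$ and $f\in C^{k,\alpha}(\mathbb T^n)$. Then $$\left|\frac1T\int_0^T f(x+\omega t)\,dt-\int_{\mathbb T^n}f(y)\,dy\right|\le\frac{C(\sigma,k+\alpha)}{C_\omega}\,\|f\|_{C^{k,\alpha}(\mathbb T^n)}\begin{cases}T^{-1}, & k+\alpha>\sigma,\\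 T^{-1}\log T, & k+\alpha=\sigma,\\ T^{-\frac{k+\alpha}{\sigma}}, & k+\alpha<\sigma,\end{cases}$$ for every $T>0$ if $k+\alpha\neq\sigma$, and for every $T\ge 2$ if $k+\alpha=\sigma$. Here $C(s,\sigma,p,q)$, $C(\sigma,s,q)$ and $C(\sigma,k+\alpha)$ are finite positive constants depending on the indicated parameters (the dimension $n$ being fixed).
   Context: $\mathbb T^n=\mathbb R^n/\mathbb Z^n$; functions on $\mathbb T^n$ are identified with $\mathbb Z^n$-periodic functions on $\mathbb R^n$, and $|\cdot|$ is the Euclidean norm. Diophantine class: for $\sigma>0$, $C_\omega>0$, $\mathcal D(\sigma,C_\omega,n)$ is the set of $\omega\in\mathbb R^n$ with $|k\cdot\omega|\ge C_\omega|k|^{-\sigma}$ for all $k\in\mathbb Z^n\setminus\{0\}$. Besov spaces: let $\chi\in C_c^\infty(\mathbb R)$ be nonincreasing in $|s|$ with $\chi=1$ on $[-\frac34,\frac34]$ and $\operatorname{supp}\chi=[-\frac43,\frac43]$. For $s\ge0$ put $\varphi_{-1}(s)=\chi(s)$, $\varphi_0(s)=\chi(s/2)-\chi(s)$, $\varphi_j(s)=\varphi_0(2^{-j}s)$ for $j\ge1$, and write $\varphi_j(\xi)=\varphi_j(|\xi|)$ for $\xi\in\mathbb R^n$. With $\widehat f(\xi)=\int_{\mathbb T^n}f(x)e^{-2\pi i\xi\cdot x}dx$, set $\Delta_jf(x)=\sum_{\xi\in\mathbb Z^n}\varphi_j(\xi)\widehat f(\xi)e^{2\pi i\xi\cdot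 x}$, $j\ge-1$. For $s\in\mathbb R$, $1\le p,q\le\infty$, $B^s_{p,q}(\mathbb T^n)$ is the space of distributions $f$ with finite norm $\|f\|_{B^s_{p,q}}=\big(\sum_{j\ge-1}(2^{js}\|\Delta_jf\|_{L^p(\mathbb T^n)})^q\big)^{1/q}$ (for $q=\infty$: $\sup_{j\ge-1}2^{js}\|\Delta_jf\|_{L^p}$). Hölder spaces: $C^{k,\alpha}(\mathbb T^n)$, $0<\alpha\le1$, is the space of $C^k$ functions with norm $\|f\|_{C^{k,\alpha}}=\sum_{|\beta|\le k}\|D^\beta f\|_{L^\infty}+\sum_{|\beta|=k}[D^\beta f]_{C^{0,\alpha}}$, where $[g]_{C^{0,\alpha}}=\sup_x\sup_{h\ne0}|g(x+h)-g(x)|/|h|^\alpha$.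
   Formalization: In (ii) for s<σ, or s=σ with q>1, and in (iii) for k+α≤σ, the constant may also depend on an upper bound for C_ω: rescaling ω shows that a constant independent of C_ω, as printed, is impossible there. *)

(* Defs.v *)
From HB Require Import structures.
From mathcomp Require Import all_boot all_order all_algebra.
From mathcomp Require Import all_classical all_reals all_analysis.
From mathcomp Require Import complex.

Set Implicit Arguments.
Unset Strict Implicit.
Unset Printing Implicit Defensive.

Import Order.TTheory GRing.Theory Num.Theory.
Import numFieldNormedType.Exports.
Import ComplexField.

Local Open Scope classical_set_scope.
Local Open Scope ring_scope.
Local Open Scope complex_scope.

(* Functions on the torus are functions 'rV[R]_n -> R[i] satisfying
   [Zn_periodic].  MathComp-Analysis has no topology, derivative or integral for
   functions with values in R[i] seen as a real vector space, so these notions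
   are taken componentwise on the real and imaginary parts.  The modulus is
   [Normc.normc], with values in R. *)

Section Torus.
Context {R : realType} {n : nat}.
Implicit Types (x y h omega : 'rV[R]_n) (k xi : 'rV[int]_n).
Implicit Types f g phi : 'rV[R]_n -> R[i].

Definition dot x y : R := \sum_(i < n) x ord0 i * y ord0 i.

Definition enorm x : R := Num.sqrt (dot x x).

Definition vec_of_int k : 'rV[R]_n := map_mx intr k.

Definition Zn_periodic f : Prop := forall x k, f (x + vec_of_int k) = f x.

Definition diophantine (sigma Comega : R) omega : Prop :=
  forall k, k != 0 ->
    Comega * enorm (vec_of_int k) `^ (- sigma) <= `|dot (vec_of_int k) omega|.

Definition fourier_mode xi x : R[i] :=
  let t := 2 * pi * dot (vec_of_int xi) x in cos t +i* sin t.

Definition ccontinuous f : Prop :=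
  continuous (fun x => complex.Re (f x)) /\ continuous (fun x => complex.Im (f x)).

Definition cderivable (i : 'I_n) f : Prop := forall x,
  derivable (fun y => complex.Re (f y)) x (delta_mx ord0 i) /\
  derivable (fun y => complex.Im (f y)) x (delta_mx ord0 i).

Definition cpartial (i : 'I_n) f x : R[i] :=
  'D_(delta_mx ord0 i) (fun y => complex.Re (f y)) x +i*
  'D_(delta_mx ord0 i) (fun y => complex.Im (f y)) x.

Definition cpartials (l : seq 'I_n) f : 'rV[R]_n -> R[i] := foldr cpartial f l.

Definition Ck (m : nat) f : Prop :=
  (forall l, (size l <= m)%N -> ccontinuous (cpartials l f)) /\
  (forall l i, (size l < m)%N -> cderivable i (cpartials l f)).

Definition degree {m : nat} (b : {ffun 'I_n -> 'I_m}) : nat :=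
  (\sum_(i < n) b i)%N.

Definition multi_derive {m : nat} (b : {ffun 'I_n -> 'I_m}) f :=
  cpartials (flatten [seq nseq (b i) i | i <- enum 'I_n]) f.

Definition sup_norm g : \bar R :=
  ereal_sup [set (Normc.normc (g x))%:E | x in [set: 'rV[R]_n]].

Definition holder_seminorm (alpha : R) g : \bar R :=
  ereal_sup [set (Normc.normc (g (x + h) - g x) / enorm h `^ alpha)%:E
            | x in [set: 'rV[R]_n] & h in [set h : 'rV[R]_n | h != 0]].

Definition Ck_norm (m : nat) f : \bar R :=
  (\sum_(b : {ffun 'I_n -> 'I_m.+1} | (degree b <= m)%N)
     sup_norm (multi_derive b f))%E.

Definition holder_norm (m : nat) (alpha : R) f : \bar R :=
  (Ck_norm m f +
   \sum_(b : {ffun 'I_n -> 'I_m.+1} | degree b == m)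
     holder_seminorm alpha (multi_derive b f))%E.

Definition in_holder (m : nat) (alpha : R) f : Prop :=
  [/\ Zn_periodic f, Ck m f & (holder_norm m alpha f < +oo)%E].

End Torus.

(* The integral over the torus is the iterated Lebesgue integral over [0,1]^n.
   It is applied below to continuous functions only, for which it is the
   integral with respect to n-dimensional Lebesgue measure, by Fubini. *)
Fixpoint torus_Rintegral {R : realType} (n : nat) : ('rV[R]_n -> R) -> R :=
  match n with
  | 0 => fun g => g 0
  | m.+1 => fun g =>
      (\int[lebesgue_measure]_(t in `[0, 1])
         torus_Rintegral (fun y : 'rV[R]_m => g (row_mx (t%:M : 'rV[R]_1) y)))%R
  end.

Section Besov.
Context {R : realType} {n : nat}.
Implicit Types (x omega : 'rV[R]_n) (xi : 'rV[int]_n).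
Implicit Types f g phi psi : 'rV[R]_n -> R[i].
Implicit Types (chi : R -> R) (p q : \bar R) (s T : R).

Definition torus_integral f : R[i] :=
  torus_Rintegral (fun x => complex.Re (f x)) +i*
  torus_Rintegral (fun x => complex.Im (f x)).

(* For p = +oo the essential supremum is a supremum: the norm is only applied
   to trigonometric polynomials. *)
Definition torus_Lp_norm p g : \bar R :=
  match p with
  | r%:E => ((torus_Rintegral (fun x => Normc.normc (g x) `^ r)) `^ r^-1)%:E
  | _ => sup_norm g
  end.

Definition test_function phi : Prop := Zn_periodic phi /\ forall m, Ck m phi.

(* The values of a distribution outside the test functions are irrelevant. *)
Definition torus_distribution (u : ('rV[R]_n -> R[i]) -> R[i]) : Prop :=
  (forall (a : R[i]) phi psi, test_function phi -> test_function psi ->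
     u (fun x => a * phi x + psi x) = a * u phi + u psi) /\
  (exists (N : nat) (K : R), forall phi, test_function phi ->
     ((Normc.normc (u phi))%:E <= K%:E * Ck_norm N phi)%E).

Definition continuous_representative (u : ('rV[R]_n -> R[i]) -> R[i]) f : Prop :=
  [/\ Zn_periodic f, ccontinuous f &
      forall phi, test_function phi ->
        u phi = torus_integral (fun x => f x * phi x)].

Definition fourier_coef (u : ('rV[R]_n -> R[i]) -> R[i]) xi : R[i] :=
  u (fourier_mode (- xi)).

Definition besov_cutoff chi : Prop :=
  [/\ forall (m : nat) (t : R), derivable (derive1n m chi) t 1,
      forall t1 t2 : R, `|t1| <= `|t2| -> chi t2 <= chi t1,
      forall t : R, `|t| <= 3 / 4 -> chi t = 1 &
      closure [set t | chi t != 0] = [set t | - (4 / 3) <= t <= 4 / 3]].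

(* Dyadic blocks are indexed by m = j + 1 >= 0 instead of j >= -1. *)
Definition dyadic_cutoff chi (m : nat) (t : R) : R :=
  match m with
  | 0 => chi t
  | j.+1 => let t' := t / 2 ^+ j in chi (t' / 2) - chi t'
  end.

(* The sum over Z^n has finitely many nonzero terms when [besov_cutoff chi]. *)
Definition dyadic_block chi (m : nat) (u : ('rV[R]_n -> R[i]) -> R[i]) x : R[i] :=
  \sum_(xi \in [set: 'rV[int]_n])
     (dyadic_cutoff chi m (enorm (vec_of_int xi)))%:C *
     fourier_coef u xi * fourier_mode xi x.

Definition besov_term chi s p (u : ('rV[R]_n -> R[i]) -> R[i]) (m : nat) : \bar R :=
  ((2 `^ ((m%:R - 1) * s))%:E * torus_Lp_norm p (dyadic_block chi m u))%E.

Definition besov_norm chi s p q (u : ('rV[R]_n -> R[i]) -> R[i]) : \bar R :=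
  match q with
  | r%:E => ((\sum_(0 <= m <oo) besov_term chi s p u m `^ r) `^ r^-1)%E
  | _ => ereal_sup (range (besov_term chi s p u))
  end.

Definition in_besov chi s p q (u : ('rV[R]_n -> R[i]) -> R[i]) : Prop :=
  torus_distribution u /\ (besov_norm chi s p q u < +oo)%E.

Definition time_average f x omega T : R[i] :=
  let g t := f (x + t *: omega) in
  (T^-1)%:C *
  ((\int[lebesgue_measure]_(t in `[0%R, T]) complex.Re (g t))%R +i*
   (\int[lebesgue_measure]_(t in `[0%R, T]) complex.Im (g t))%R).

Definition ergodic_error f x omega T : R :=
  Normc.normc (time_average f x omega T - torus_integral f).

End Besov.

(* e is the exponent of the logarithm at the critical regularity s = sigma.

   Replacing (omega, Comega, T) by (l omega, l Comega, T / l) changes neither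
   the ergodic average nor the Diophantine condition, but multiplies
   rate sigma s e T / Comega by l^(s/sigma - 1) when s < sigma.  Letting l tend
   to infinity shows that a bound C / Comega * rate sigma s e T cannot hold
   with C independent of Comega over all Comega > 0, and there is a similar
   obstruction when s = sigma.  For s <= sigma the constant is therefore
   uniform over Comega <= M, for each M. *)
Definition rate {R : realType} (sigma s e T : R) : R :=
  if sigma < s then T^-1
  else if s == sigma then T^-1 * ln T `^ e
  else T `^ (- (s / sigma)).

Definition admissible_time {R : realType} (sigma s T : R) : Prop :=
  if s == sigma then 2 <= T else 0 < T.

Definition conjugate_inv {R : realType} (q : \bar R) : R :=
  match q with
  | r%:E => 1 - r^-1
  | _ => 1
  end.

(* Main.v *)
Require Import Defs.
From HB Require Import structures.
From mathcomp Require Import all_boot all_order all_algebra.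
From mathcomp Require Import all_classical all_reals all_analysis.
From mathcomp Require Import complex.
From mathcomp Require Import zify ring lra.

(** The ergodic error is linear in the function and vanishes on constants.  Along the
    orbit the mode [e_k] is an exponential of frequency [k . omega], so its error is
    at most [1 / (T |k . omega|)] ([nm_deviation_mode]).  Everything rests on a bound
    for functions [g] whose spectrum lies in the cube of size [N]
    ([deviation_zcube]):

      error of [g] <= C / (Cw T) * N^sigma * |g|_p     (1 < p <= 2).

    It follows from two facts.  The Diophantine condition applied to differences of
    frequencies shows that the numbers [k . omega] are separated by a multiple
    [d] of [Cw N^-sigma]; in particular at most [2^(l+2)] of them are smaller than
    [2^(l+1) d] in absolute value.  On the other hand the Fourier coefficients of [g]
    over any [L] frequencies add up to at most [L^(1/p) |g|_p] ([sum_fcoef_le], a form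
    of the Hausdorff-Young inequality).  Grouping the frequencies according to the
    size of [k . omega] gives a geometric series of ratio [2^(1/p - 1)], which
    converges since [p > 1] ([divisor_sum_le]).

    A function in a Besov space is the sum of its dyadic blocks, and the block of
    index [m] has spectrum in a cube of size [2^(m+1)].  For [p <= 2] the bound above
    is summed over all blocks: the result is finite when [s >= sigma], up to the role
    of [q] at the endpoint, while [s >= n/p] makes the series of blocks converge
    uniformly by Bernstein's inequality.  For [p = oo] it is used with the exponent
    [2] for the blocks with [2^(m sigma)] up to about [T], the rest of the series being bounded
    by its sup norm; the three regimes of the rate are those of the geometric sums of
    ratio [2^(sigma - s)] ([deviation_rate]).

    The continuous function represented by a distribution is the sum of its blocks.
    That this sum is a representative, and the only one, follows from the density of
    trigonometric polynomials in the test functions and from the uniqueness of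
    Fourier coefficients; both are obtained from a positive kernel
    ([kern_seq_cvg], [trig_dense], [continuous_representativeP]).

    For a Hoelder function the blocks are replaced by differences of smoothings at
    the scales [2^m].  The same kernel is used, one coordinate at a time: with [A] the
    average in a coordinate, [1 - (1 - A)^(k+1)] has an error of order
    [M^-(k + alpha)], because each factor [1 - A] turns one iterated difference of the
    function into a power of the scale ([diffs_iter_resid]).  This needs a kernel with
    second moment of order [M^-2], hence a tent instead of the constant sequence that
    defines the Fejer kernel. *)

Section ErgodicAverages.
Set Implicit Arguments.
Unset Strict Implicit.
Import Order.TTheory GRing.Theory Num.Theory.
Import numFieldNormedType.Exports.
Import ComplexField.
Local Open Scope classical_set_scope.
Local Open Scope ring_scope.
Local Open Scope complex_scope.
Local Notation nm := Normc.normc.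
Local Notation e := fourier_mode.
Local Notation cI := torus_integral.
Local Notation Re := complex.Re.
Local Notation Im := complex.Im.

(** * The torus integral of continuous functions *)

Section TorusIntegral.
Context {R : realType}.

Definition in_cube n (x : 'rV[R]_n) := forall i, 0 <= x ord0 i <= 1.

(** Uniform continuity on the cube only: iterated integrals see nothing else, and
    this notion passes to slices. *)
Definition ucube n (F : 'rV[R]_n -> R) := forall eps, 0 < eps ->
  exists2 d, 0 < d & forall x y, in_cube x -> in_cube y ->
    (forall i, `|x ord0 i - y ord0 i| <= d) -> `|F x - F y| <= eps.

Lemma rV_normP n (x : 'rV[R]_n) d : 0 <= d ->
  (forall i, `|x ord0 i| <= d) <-> `|x| <= d.
Proof.
move=> d0; rewrite [`|x|]mx_normrE; split=> [H|/bigmax_leP[_ H] i].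
  by apply/bigmax_leP; split => // -[i j] _ /=; rewrite ord1.
exact: (H (ord0, i)).
Qed.

Lemma coord_le_norm n (x : 'rV[R]_n) i : `|x ord0 i| <= `|x|.
Proof. by move: i; apply/rV_normP. Qed.

Lemma subrVE n (x y : 'rV[R]_n) i : (x - y) ord0 i = x ord0 i - y ord0 i.
Proof. by rewrite !mxE. Qed.

Lemma compact_cube n : compact (@in_cube n).
Proof.
have -> : @in_cube n = [set v | forall i, `[0 : R, 1]%classic (v ord0 i)].
  by apply/seteqP; split=> x H i; have := H i; rewrite /= in_itv.
apply: (@rV_compact _ n (fun=> `[0 : R, 1]%classic)) => _.
exact: segment_compact.
Qed.

(** Heine's theorem on the cube, in the asymmetric form that passes to all of
    the space for periodic functions: only one of the points is in the cube. *)
Lemma continuous_uniform n (F : 'rV[R]_n -> R) : continuous F ->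
  forall eps, 0 < eps -> exists2 d, 0 < d & forall x y, in_cube x ->
    `|x - y| <= d -> `|F x - F y| <= eps.
Proof.
move=> cF eps e0.
pose P (d : R) (x : 'rV[R]_n) := forall y, `|x - y| <= d -> `|F x - F y| <= eps.
have : \forall d \near (0 : R)^'+, @in_cube n `<=` P d.
  have /compact_near_coveringP := @compact_cube n.
  apply => x _.
  have e20 : 0 < eps / 2 by rewrite divr_gt0.
  have /cvgrPdist_le /(_ _ e20) := cF x.
  move=> /nbhs_normP[r /= r0 Hr].
  near=> x' d => y xy.
  have x'r : `|x - x'| < r / 2.
    by near: x'; apply: cvgr_dist_lt; rewrite ?divr_gt0//; exact: cvg_id.
  have dr : d < r / 2 by near: d; apply: nbhs_right_lt; rewrite divr_gt0.
  have h1 : `|F x - F x'| <= eps / 2.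
    by apply: Hr => /=; rewrite (lt_trans x'r)// ltr_pdivrMr// ltr_pMr// ltrDr.
  have h2 : `|F x - F y| <= eps / 2.
    apply: Hr => /=; rewrite -(subrKA x') [r]splitr.
    by rewrite (le_lt_trans (ler_normD _ _))// ltrD// (le_lt_trans xy).
  rewrite -(subrKA (F x)) [eps]splitr (le_trans (ler_normD _ _))// lerD//.
  by rewrite distrC.
move=> near0.
have : \forall d \near (0 : R)^'+, 0 < d /\ @in_cube n `<=` P d.
  by apply: filterS2 near0 (nbhs_right_gt 0) => d ? ?; split.
by move=> /filter_ex[d [d0 Hd]]; exists d => // x y /Hd; exact.
Unshelve. all: by end_near. Qed.

Lemma continuous_ucube n (F : 'rV[R]_n -> R) : continuous F -> ucube F.
Proof.
move=> /continuous_uniform cF eps /cF[d d0 H]; exists d => // x y xc _ xy.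
by apply: H => //; apply/(rV_normP _ (ltW d0)) => i; rewrite !mxE.
Qed.

Definition u01 (g : R -> R) := forall eps, 0 < eps ->
  exists2 d, 0 < d & forall s t, 0 <= s <= 1 -> 0 <= t <= 1 ->
    `|s - t| <= d -> `|g s - g t| <= eps.

Local Notation mu := (@lebesgue_measure R).
Local Notation I1 g := (\int[mu]_(t in `[0%R, 1%R]) g t)%R.

Lemma u01_within g : u01 g -> {within `[0, 1], continuous g}.
Proof.
move=> ug; apply/subspace_continuousP => x /= x01.
apply/cvgrPdist_le => eps /ug[d d0 H].
near=> y; apply: H.
- by move: x01; rewrite in_itv.
- have : `[0, 1]%classic y by near: y; exact: withinT.
  by rewrite /= in_itv.
- near: y; apply: cvgr_dist_le => //; exact: cvg_within.
Unshelve. all: by end_near. Qed.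

Lemma u01_integrable g : u01 g -> mu.-integrable `[0, 1] (EFin \o g).
Proof.
move=> /u01_within; apply: continuous_compact_integrable.
exact: segment_compact.
Qed.

Lemma I1_lin a g h : u01 g -> u01 h ->
  I1 (fun t => a * g t + h t) = a * I1 g + I1 h.
Proof.
move=> ug uh; have ig := u01_integrable ug; have ih := u01_integrable uh.
rewrite -RintegralZl// -RintegralD//.
by under [X in _.-integrable _ X]eq_fun do rewrite /= EFinM; exact: integrableZl.
Qed.

Lemma I1_le g h : u01 g -> u01 h -> (forall t, 0 <= t <= 1 -> g t <= h t) ->
  I1 g <= I1 h.
Proof.
move=> ug uh gh; apply: le_Rintegral => //; try exact: u01_integrable.
Qed.

Lemma I1_cst c : I1 (fun=> c) = c.
Proof.
rewrite Rintegral_cst//= lebesgue_measure_itv/= lte_fin ltr01.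
by rewrite -EFinD/= subr0 mulr1.
Qed.

Definition slice m (F : 'rV[R]_m.+1 -> R) t : 'rV[R]_m -> R :=
  fun y => F (row_mx (t%:M : 'rV[R]_1) y).

Local Notation cons t y := (row_mx (t%:M : 'rV_1) y).

Lemma consP m (P : R -> Prop) (t : R) (y : 'rV[R]_m) :
  P t -> (forall i, P (y ord0 i)) ->
  forall i : 'I_m.+1, P ((cons t y : 'rV[R]_m.+1) ord0 i).
Proof.
move=> Pt Py i; rewrite mxE; case: splitP => j _ //.
  by rewrite (ord1 j) mxE mulr1n.
Qed.

Lemma cons_sub m t t' (y y' : 'rV[R]_m) :
  cons t y - cons t' y' = cons (t - t') (y - y') :> 'rV[R]_(1 + m).
Proof. by rewrite opp_row_mx add_row_mx raddfB. Qed.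

Lemma in_cube_cons m t (y : 'rV[R]_m) : 0 <= t <= 1 -> in_cube y ->
  in_cube (cons t y : 'rV[R]_m.+1).
Proof. by move=> t01 yc; apply: (consP (P := fun s => 0 <= s <= 1)). Qed.

Lemma cons_dist m t t' (y y' : 'rV[R]_m) d :
  `|t - t'| <= d -> (forall i, `|y ord0 i - y' ord0 i| <= d) ->
  forall i, `|(cons t y : 'rV[R]_m.+1) ord0 i - (cons t' y' : 'rV[R]_m.+1) ord0 i| <= d.
Proof.
move=> td yd i; rewrite -subrVE cons_sub.
by apply: (consP (P := fun s => `|s| <= d)) => // j; rewrite subrVE.
Qed.

Lemma ucube_slice m (F : 'rV[R]_m.+1 -> R) t : 0 <= t <= 1 ->
  ucube F -> ucube (slice F t).
Proof.
move=> t01 uF eps /uF[d d0 H]; exists d => // y y' yc y'c yd.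
apply: H; [exact: in_cube_cons..|].
by apply: cons_dist => //; rewrite subrr normr0 ltW.
Qed.

Lemma ucube_cst n c : @ucube n (fun=> c).
Proof. by move=> e e0; exists 1 => // *; rewrite subrr normr0 ltW. Qed.

Lemma ucube_lin n a (F G : 'rV[R]_n -> R) : ucube F -> ucube G ->
  ucube (fun t => a * F t + G t).
Proof.
move=> ug uh eps e0; have e20 : 0 < eps / 2 by rewrite divr_gt0.
have a0 : 0 < 1 + `|a| by rewrite ltr_wpDr.
have /ug[d1 d10 H1] : 0 < eps / 2 / (1 + `|a|) by rewrite divr_gt0.
have [d2 d20 H2] := uh _ e20.
exists (Num.min d1 d2); first by rewrite lt_min d10.
move=> s t s01 t01 st.
rewrite opprD addrACA -mulrBr [eps]splitr (le_trans (ler_normD _ _))// lerD//.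
  rewrite normrM (@le_trans _ _ ((1 + `|a|) * (eps / 2 / (1 + `|a|))))//.
    rewrite ler_pM// ?lerDr// H1// => i.
    by rewrite (le_trans (st i))// ge_min lexx.
  by rewrite mulrCA divff ?mulr1// gt_eqF.
by rewrite H2// => i; rewrite (le_trans (st i))// ge_min lexx orbT.
Qed.

(** The three laws are bundled because the induction on the dimension needs all of
    them at once: together they make the integral over a slice continuous. *)
Definition ucube_laws n :=
  [/\ forall c : R, torus_Rintegral (fun _ : 'rV[R]_n => c) = c,
      forall (a : R) F G, @ucube n F -> ucube G ->
        torus_Rintegral (fun x => a * F x + G x) =
        a * torus_Rintegral F + torus_Rintegral G &
      forall F G, @ucube n F -> ucube G -> (forall x, in_cube x -> F x <= G x) ->
        torus_Rintegral F <= torus_Rintegral G].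

Lemma laws_dist n : ucube_laws n -> forall (F G : 'rV[R]_n -> R) (eps : R),
  ucube F -> ucube G -> (forall x, in_cube x -> `|F x - G x| <= eps) ->
  `|torus_Rintegral F - torus_Rintegral G| <= eps.
Proof.
move=> [Ic Il Ile] F G eps uF uG FG.
have key (F' G' : 'rV[R]_n -> R) : ucube F' -> ucube G' ->
    (forall x, in_cube x -> `|F' x - G' x| <= eps) ->
    torus_Rintegral F' <= eps + torus_Rintegral G'.
  move=> uF' uG' H.
  have -> : eps + torus_Rintegral G' = torus_Rintegral (fun y => 1 * G' y + eps).
    by rewrite (Il 1 G' (fun=> eps)) ?Ic ?mul1r 1?addrC//; exact: ucube_cst.
  apply: Ile => //; first by apply: ucube_lin => //; exact: ucube_cst.
  by move=> y yc; rewrite mul1r -lerBlDl (le_trans (ler_norm _))// H.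
rewrite ler_distlC lerBlDl key//= addrC key// => x xc.
by rewrite distrC FG.
Qed.

Lemma u01_slice m : ucube_laws m -> forall F : 'rV[R]_m.+1 -> R, ucube F ->
  u01 (fun t => torus_Rintegral (slice F t)).
Proof.
move=> laws F uF eps /[dup] e0 /uF[d d0 H]; exists d => // s t s01 t01 st.
apply: laws_dist => // [||x xc]; [exact: ucube_slice..|].
apply: H; [exact: in_cube_cons..|].
by apply: cons_dist => // i; rewrite subrr normr0 ltW.
Qed.

Lemma torus_Rintegral_laws n : ucube_laws n.
Proof.
elim: n => [|m IH]; split=> //=.
- by move=> F G _ _; apply => -[].
- by move=> c; have [Ic _ _] := IH; under eq_Rintegral do rewrite Ic; rewrite I1_cst.
- move=> a F G uF uG; have [_ Il _] := IH.
  rewrite -I1_lin; [|exact: u01_slice..].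
  apply: eq_Rintegral => t; rewrite inE/= in_itv/= => t01.
  by rewrite Il//; exact: ucube_slice.
- move=> F G uF uG FG; have [_ _ Ile] := IH.
  apply: I1_le; [exact: u01_slice..|] => t t01.
  by apply: Ile => [||y yc]; [exact: ucube_slice..|apply/FG/in_cube_cons].
Qed.

Lemma u01_cst c : u01 (fun=> c).
Proof. by move=> e e0; exists 1 => // *; rewrite subrr normr0 ltW. Qed.

Lemma u01_integrable_sub g a b : u01 g -> 0 <= a -> b <= 1 ->
  mu.-integrable `[a, b] (EFin \o g).
Proof.
move=> ug a0 b1; apply: integrableS (u01_integrable ug) => //.
by apply: subset_itv; rewrite bnd_simp.
Qed.

Lemma integral_left_endpoint g a h eps : u01 g -> 0 <= a -> 0 <= h ->
  a + h <= 1 -> (forall t, a <= t <= a + h -> `|g t - g a| <= eps) ->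
  `|\int[mu]_(t in `[a, a + h]) g t - h * g a| <= h * eps.
Proof.
move=> ug a0 h0 ah1 H.
have ig := u01_integrable_sub ug a0 ah1.
have icst c : mu.-integrable `[a, a + h] (EFin \o (fun=> c)).
  by apply: (@u01_integrable_sub (fun=> c)) => //; exact: u01_cst.
have Icst c : \int[mu]_(t in `[a, a + h]) c = h * c.
  rewrite Rintegral_cst//= lebesgue_measure_itv/= lte_fin ltrDl.
  case: ltrgtP h0 => // [h0 _|<- _]; last by rewrite mulr0 mul0r.
  by rewrite -EFinD/= addrAC subrr add0r mulrC.
rewrite -Icst -RintegralB//.
have iB : mu.-integrable `[a, a + h] (EFin \o (fun t => g t - g a)).
  exact: (integrableB _ ig (icst (g a))).
apply: le_trans (le_normr_Rintegral _ iB) _ => //.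
rewrite -Icst; apply: le_Rintegral => //.
  have := integrable_abse iB.
  by apply: eq_integrable.
Qed.

Lemma I1_riemann_sum M g eps : u01 g ->
  (forall s t, 0 <= s <= 1 -> 0 <= t <= 1 -> `|s - t| <= M.+1%:R^-1 ->
     `|g s - g t| <= eps) ->
  `|I1 g - M.+1%:R^-1 * \sum_(j < M.+1) g (j%:R / M.+1%:R)| <= eps.
Proof.
move=> ug H; set h := (M.+1%:R^-1 : R).
have h0 : 0 < h by rewrite invr_gt0.
have hM : M.+1%:R * h = 1 by rewrite mulfV.
suff key k : (k <= M.+1)%N ->
    `|\int[mu]_(t in `[0, k%:R * h]) g t - h * \sum_(j < k) g (j%:R * h)| <=
    k%:R * h * eps.
  by have := key _ (leqnn _); rewrite hM mul1r.
elim: k => [_|k IH kM].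
  by rewrite !mul0r set_itv1 Rintegral_set1 big_ord0 mulr0 subr0 normr0.
have kh0 : 0 <= k%:R * h by rewrite mulr_ge0// ltW.
have kh : k.+1%:R * h = k%:R * h + h by rewrite -natr1 mulrDl mul1r.
have kh1 : k.+1%:R * h <= 1 by rewrite -[leRHS]hM ler_pM2r// ler_nat.
rewrite kh in kh1 *.
have -> : \int[mu]_(t in `[0, k%:R * h + h]) g t =
    \int[mu]_(t in `[0, k%:R * h]) g t +
    \int[mu]_(t in `[k%:R * h, k%:R * h + h]) g t.
  rewrite -[X in _ = _ + X]Rintegral_itv_obnd_cbnd; last first.
    apply: integrableS (u01_integrable_sub ug kh0 kh1) => //.
    by apply: subset_itv; rewrite bnd_simp.
  rewrite -(@Rintegral_itvB _ g (BLeft 0) (BRight (k%:R * h + h)) (k%:R * h)).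
  - by rewrite [RHS]addrC subrK.
  - exact: u01_integrable_sub.
  - by rewrite bnd_simp.
  - by rewrite bnd_simp lerDl ltW.
rewrite big_ord_recr/= mulrDr opprD addrACA (le_trans (ler_normD _ _))//.
rewrite mulrDl lerD// ?IH 1?ltnW//.
apply: integral_left_endpoint => //; first exact: ltW.
move=> t /andP[kt tk]; apply: H.
- by rewrite (le_trans kh0)// (le_trans tk).
- by rewrite kh0 (le_trans _ kh1)// lerDl ltW.
- by rewrite ger0_norm ?subr_ge0// lerBlDl.
Qed.

Definition grid_point n M (b : 'rV['I_M.+1]_n) : 'rV[R]_n :=
  map_mx (fun j : 'I_M.+1 => j%:R / M.+1%:R) b.

(** Grid means reduce translation invariance and Fubini's theorem for the iterated
    integral to finite sums. *)
Definition grid_mean n M (F : 'rV[R]_n -> R) : R :=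
  M.+1%:R^-1 ^+ n * \sum_(b : 'rV['I_M.+1]_n) F (grid_point b).

Lemma grid_meanS m M (F : 'rV[R]_m.+1 -> R) :
  grid_mean M F =
  M.+1%:R^-1 * \sum_(j < M.+1) grid_mean M (slice F (j%:R / M.+1%:R)).
Proof.
rewrite /grid_mean -mulr_sumr mulrA -exprS; congr (_ * _).
rewrite pair_big/=.
rewrite (reindex (fun p : 'I_M.+1 * 'rV['I_M.+1]_m =>
  row_mx (const_mx p.1 : 'rV_1) p.2 : 'rV_(1 + m))) /=.
  apply: eq_bigr => -[j b] _ /=; rewrite /slice /grid_point.
  congr (F _); apply/rowP => i; rewrite !mxE; case: splitP => k _.
    by rewrite (ord1 k) !mxE mulr1n.
  by rewrite !mxE.
exists (fun b : 'rV_(1 + m) => (lsubmx b ord0 ord0, rsubmx b)) => /=.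
  by move=> [j b] _; rewrite row_mxKl row_mxKr mxE.
move=> b _; rewrite -[RHS]hsubmxK; congr row_mx.
by apply/rowP => i; rewrite (ord1 i) mxE.
Qed.

Lemma grid_mean_approx n M (F : 'rV[R]_n -> R) eps : ucube F ->
  (forall x y, in_cube x -> in_cube y ->
    (forall i, `|x ord0 i - y ord0 i| <= M.+1%:R^-1) -> `|F x - F y| <= eps) ->
  `|torus_Rintegral F - grid_mean M F| <= eps *+ n.
Proof.
elim: n F => [F _ _|m IH F uF H].
  rewrite /grid_mean expr0 mul1r.
  rewrite (eq_bigr (fun=> F 0)); last by move=> b _; congr F; apply/rowP => -[].
  by rewrite sumr_const card_mx muln0 expn0 subrr normr0.
have h0 : 0 <= M.+1%:R^-1 :> R by rewrite invr_ge0.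
rewrite grid_meanS [eps *+ _]mulrS; have laws := torus_Rintegral_laws m.
apply: le_trans (ler_distD (M.+1%:R^-1 * \sum_(j < M.+1)
   torus_Rintegral (slice F (j%:R / M.+1%:R))) _ _) _.
apply: lerD.
  apply: (@I1_riemann_sum M (fun t => torus_Rintegral (slice F t))).
    exact: u01_slice.
  move=> s t s01 t01 st.
  apply: laws_dist => // [||x xc]; [exact: ucube_slice..|].
  apply: H; [exact: in_cube_cons..|].
  by apply: cons_dist => // i; rewrite subrr normr0.
rewrite -mulrBr -sumrB normrM ger0_norm// ler_pdivrMl//.
have -> : M.+1%:R * (eps *+ m) = \sum_(j < M.+1) eps *+ m.
  by rewrite sumr_const card_ord mulr_natl.
apply: le_trans (ler_norm_sum _ _ _) _; apply: ler_sum => j _.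
have j01 : 0 <= (j%:R / M.+1%:R : R) <= 1.
  by rewrite divr_ge0//= ler_pdivrMr// mul1r ler_nat ltnW.
apply: IH; first exact: ucube_slice.
move=> x y xc yc xy; apply: H; [exact: in_cube_cons..|].
by apply: cons_dist => //; rewrite subrr normr0.
Qed.

End TorusIntegral.

Section TorusMean.
Context {R : realType}.
Local Notation I := torus_Rintegral.

Lemma near_dist_le n (x : 'rV[R]_n) d : 0 < d ->
  \forall y \near x, `|x - y| <= d.
Proof. by move=> d0; have /cvgrPdist_le := @cvg_id _ (nbhs x); exact. Qed.

Section Continuity.
Context {T : topologicalType}.
Implicit Types f g : T -> R.

Lemma cont_cst (c : R) : continuous (fun _ : T => c).
Proof. exact: cst_continuous. Qed.

Lemma contD f g : continuous f -> continuous g ->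
  continuous (fun x => f x + g x).
Proof. by move=> cf cg x; exact: (continuousD (cf x) (cg x)). Qed.

Lemma contM f g : continuous f -> continuous g ->
  continuous (fun x => f x * g x).
Proof. by move=> cf cg x; exact: (continuousM (cf x) (cg x)). Qed.

Lemma contB f g : continuous f -> continuous g ->
  continuous (fun x => f x - g x).
Proof. by move=> cf cg x; exact: (continuousB (cf x) (cg x)). Qed.

Lemma cont_comp (U V : topologicalType) (f : U -> T) (g : T -> V) :
  continuous f -> continuous g -> continuous (fun x => g (f x)).
Proof. by move=> cf cg x; exact: (continuous_comp (cf x) (cg _)). Qed.

Lemma cont_lin (a : R) f g : continuous f -> continuous g ->
  continuous (fun x => a * f x + g x).
Proof. by move=> cf cg; apply: contD => //; apply: contM => //; exact: cont_cst. Qed.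

End Continuity.

Section Continuous.
Context {n : nat}.
Implicit Types (F G : 'rV[R]_n -> R) (x y h : 'rV[R]_n).

Lemma tI_cst (c : R) : I (fun _ : 'rV[R]_n => c) = c.
Proof. by have [-> _ _] := @torus_Rintegral_laws R n. Qed.

Lemma tI_lin (a : R) F G : continuous F -> continuous G ->
  I (fun x => a * F x + G x) = a * I F + I G.
Proof.
by have [_ H _] := @torus_Rintegral_laws R n => cF cG; apply: H;
  exact: continuous_ucube.
Qed.

Lemma tI_le F G : continuous F -> continuous G ->
  (forall x, in_cube x -> F x <= G x) -> I F <= I G.
Proof.
by have [_ _ H] := @torus_Rintegral_laws R n => cF cG; apply: H;
  exact: continuous_ucube.
Qed.

Lemma tI_dist F G eps : continuous F -> continuous G ->
  (forall x, in_cube x -> `|F x - G x| <= eps) -> `|I F - I G| <= eps.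
Proof.
by move=> cF cG; apply: laws_dist => //;
  [exact: torus_Rintegral_laws|exact: continuous_ucube..].
Qed.

Lemma continuous_shift F h : continuous F -> continuous (fun x => F (x + h)).
Proof.
move=> cF; apply: cont_comp cF => x.
exact: (continuousD (@cvg_id _ _) (@cst_continuous _ _ _ _)).
Qed.

Lemma tIZ (a : R) F : continuous F -> I (fun x => a * F x) = a * I F.
Proof.
move=> cF; have := tI_lin a cF (@cont_cst _ 0).
by under eq_fun do rewrite addr0; rewrite tI_cst addr0.
Qed.

Lemma tI_sum (J : Type) (r : seq J) (c : J -> R) (F : J -> 'rV[R]_n -> R) :
  (forall j, continuous (F j)) ->
  continuous (fun x => \sum_(j <- r) c j * F j x) /\
  I (fun x => \sum_(j <- r) c j * F j x) = \sum_(j <- r) c j * I (F j).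
Proof.
move=> cF; elim: r => [|j r [cr IHr]].
  split; first by under eq_fun do rewrite big_nil; exact: cont_cst.
  by under eq_fun do rewrite big_nil; rewrite tI_cst big_nil.
have E x : \sum_(i <- j :: r) c i * F i x = c j * F j x + \sum_(i <- r) c i * F i x.
  by rewrite big_cons.
split; first by under eq_fun do rewrite E; exact: cont_lin.
by under eq_fun do rewrite E; rewrite tI_lin// IHr big_cons.
Qed.

Lemma inv_succ_small (d : R) : 0 < d ->
  exists M0, forall M, (M0 <= M)%N -> M.+1%:R^-1 <= d.
Proof.
move=> d0; exists (Num.trunc d^-1) => M MM.
rewrite invf_ple ?posrE//.
by apply/ltW/(lt_le_trans (truncnS_gt _)); rewrite ler_nat.
Qed.

Lemma grid_mean_cvg F eps : continuous F -> 0 < eps ->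
  exists M0, forall M, (M0 <= M)%N -> `|I F - grid_mean M F| <= eps.
Proof.
move=> cF e0.
have e1 : 0 < eps / n.+1%:R by rewrite divr_gt0.
have [d d0 H] := continuous_ucube cF e1.
have [M0 HM] := inv_succ_small d0.
exists M0 => M /HM Md.
apply: (@le_trans _ _ ((eps / n.+1%:R) *+ n)).
  apply: grid_mean_approx; first exact: continuous_ucube.
  by move=> x y xc yc xy; apply: H => // i; exact: le_trans (xy i) Md.
rewrite -[leLHS]mulr_natr -mulrA ler_piMr ?ltW//.
by rewrite mulrC ltr_pdivrMr// mul1r ltr_nat.
Qed.

Definition zper (T : Type) (f : 'rV[R]_n -> T) :=
  forall x k, f (x + vec_of_int k) = f x.

Lemma zper_cube x : exists k, in_cube (x + @vec_of_int R n k).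
Proof.
exists (\row_i - Num.floor (x ord0 i)) => i.
rewrite !mxE rmorphN/= subr_ge0 floor_le/= lerBlDr.
by rewrite addrC ltW// -intrD1 floorD1_gt.
Qed.

Lemma zper_uniform F : continuous F -> zper F ->
  forall eps, 0 < eps -> exists2 d, 0 < d &
    forall x y, `|x - y| <= d -> `|F x - F y| <= eps.
Proof.
move=> cF pF eps /(continuous_uniform cF)[d d0 H]; exists d => // x y xy.
have [k xk] := zper_cube x.
rewrite -(pF x k) -(pF y k); apply: H => //.
by rewrite opprD addrACA subrr addr0.
Qed.

Lemma zper_bounded F : continuous F -> zper F ->
  exists2 B, 0 < B & forall x, `|F x| <= B.
Proof.
move=> cF pF; have cFc : {within @in_cube R n, continuous F}.
  exact: continuous_subspaceT.
have /compact_bounded[B [_ HB]] := continuous_compact cFc (@compact_cube R n).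
exists (`|B| + 1); first by rewrite ltr_wpDl.
move=> x; have [k xk] := zper_cube x; rewrite -(pF x k).
by apply: HB; [rewrite (le_lt_trans (ler_norm B))// ltrDl|exists (x + vec_of_int k)].
Qed.

Lemma grid_mean_shift M F (m : 'rV[int]_n) : zper F ->
  grid_mean M (fun x => F (x + M.+1%:R^-1 *: vec_of_int m)) = grid_mean M F.
Proof.
move=> pF; rewrite /grid_mean; congr (_ * _).
pose r : 'rV['I_M.+1]_n := \row_i inZp `|(m ord0 i %% M.+1)%Z|%N.
rewrite [RHS](reindex_inj (addIr r))/=; apply: eq_bigr => b _.
pose k : 'rV[int]_n := \row_i ((m ord0 i %/ M.+1)%Z +
   ((b ord0 i + `|(m ord0 i %% M.+1)%Z|) %/ M.+1)%N%:Z).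
rewrite -(pF (grid_point (b + r)) k); congr F; apply/rowP => i.
rewrite !mxE/= modnDmr; set B := nat_of_ord _; move: (m _ i) => mi.
have N0 : M.+1%:R != 0 :> R by rewrite pnatr_eq0.
set r0 := `|(mi %% M.+1)%Z|%N.
have E1 : mi%:~R = (mi %/ M.+1)%Z%:~R * M.+1%:R + r0%:R :> R.
  rewrite {1}(divz_eq mi M.+1) intrD intrM; congr (_ + _).
  by rewrite -[X in X%:~R](@gez0_abs (mi %% M.+1)%Z) ?modz_ge0.
have E2 : B%:R + r0%:R = ((B + r0) %/ M.+1)%:R * M.+1%:R + ((B + r0) %% M.+1)%:R :> R.
  by rewrite -natrD {1}(divn_eq (B + r0) M.+1) natrD natrM.
rewrite intrD -pmulrn E1.
have -> : B%:R = ((B + r0) %/ M.+1)%:R * M.+1%:R + ((B + r0) %% M.+1)%:R - r0%:R :> R.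
  by rewrite -E2 addrK.
by field.
Qed.

(** Translation invariance is exact on the grid for grid vectors; the general
    case follows since every vector is close to one of a fine grid. *)
Lemma tI_shift F h : continuous F -> zper F -> I (fun x => F (x + h)) = I F.
Proof.
move=> cF pF; apply/eqP; rewrite -subr_eq0 -normr_le0; apply/ler_addgt0Pr => eps e0.
rewrite add0r; have e3 : 0 < eps / 3 by rewrite divr_gt0.
have cFh := continuous_shift (h := h) cF.
have [M1 H1] := grid_mean_cvg cF e3.
have [M2 H2] := grid_mean_cvg cFh e3.
have [d d0 H] := zper_uniform cF pF e3.
have [M3 H3] := inv_succ_small d0.
pose M := maxn M1 (maxn M2 M3).
have {}H1 := H1 M (leq_maxl _ _).
have {}H2 := H2 M (leq_trans (leq_maxl _ _) (leq_maxr _ _)).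
have {}H3 := H3 M (leq_trans (leq_maxr _ _) (leq_maxr _ _)).
pose m : 'rV[int]_n := \row_i Num.floor (h ord0 i * M.+1%:R).
rewrite -[eps](mulfVK (_ : 3 != 0))// mulr_natr 2!mulrS mulr1n.
apply: le_trans (ler_distD (grid_mean M (fun x => F (x + h))) _ _) (lerD H2 _).
apply: le_trans (ler_distD (grid_mean M F) _ _) (lerD _ _); last by rewrite distrC.
rewrite -(grid_mean_shift M m pF) /grid_mean -mulrBr -sumrB normrM.
rewrite ger0_norm ?exprn_ge0// exprVn ler_pdivrMl ?exprn_gt0//.
apply: le_trans (ler_norm_sum _ _ _) _.
have -> : M.+1%:R ^+ n * (eps / 3) = \sum_(b : 'rV['I_M.+1]_n) (eps / 3).
  by rewrite sumr_const card_mx card_ord mul1n -natrX mulr_natl.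
apply: ler_sum => b _; apply: H; rewrite opprD addrACA subrr add0r.
apply: le_trans H3; apply/rV_normP => // i; rewrite !mxE.
set a := h _ i; set k := Num.Def.floor _.
have hk : 0 <= a * M.+1%:R - k%:~R <= 1.
  by rewrite subr_ge0 floor_le/= lerBlDr addrC ltW// -intrD1 floorD1_gt.
have -> : a - M.+1%:R^-1 * k%:~R = (a * M.+1%:R - k%:~R) / M.+1%:R by field.
case/andP: hk => k0 k1.
by rewrite normrM !ger0_norm// ler_pdivrMr// mulVf.
Qed.

End Continuous.

Lemma cont_unif m (F : 'rV[R]_m -> R) :
  (forall eps, 0 < eps -> exists2 d, 0 < d & forall x x',
    `|x - x'| <= d -> `|F x - F x'| <= eps) -> continuous F.
Proof.
move=> H x; apply/(@cvgrPdist_le _ _ _ (nbhs x) _) => eps /H[d d0 Hd].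
exact: filterS (Hd x) (near_dist_le x d0).
Qed.

(** Both iterated integrals are limits of a grid mean in the inner variable,
    and a finite sum can be exchanged with an integral. *)
Lemma tI_swap n n' (G : 'rV[R]_n -> 'rV[R]_n' -> R) :
  (forall eps, 0 < eps -> exists2 d, 0 < d & forall x x' y,
     `|x - x'| <= d -> `|G x y - G x' y| <= eps) ->
  (forall eps, 0 < eps -> exists2 d, 0 < d & forall x y y',
     `|y - y'| <= d -> `|G x y - G x y'| <= eps) ->
  I (fun x => I (fun y => G x y)) = I (fun y => I (fun x => G x y)).
Proof.
move=> Hx Hy.
have cGx y : continuous (fun x => G x y).
  by apply: cont_unif => eps /Hx[d d0 H]; exists d => // x x'; exact: H.
have cGy x : continuous (fun y => G x y).
  by apply: cont_unif => eps /Hy[d d0 H]; exists d => // y y'; exact: H.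
have cI1 : continuous (fun x => I (fun y => G x y)).
  apply: cont_unif => eps /Hx[d d0 H]; exists d => // x x' xx'.
  by apply: tI_dist => // y _; exact: H.
have cI2 : continuous (fun y => I (fun x => G x y)).
  apply: cont_unif => eps /Hy[d d0 H]; exists d => // y y' yy'.
  by apply: tI_dist => // x _; exact: H.
apply/eqP; rewrite -subr_eq0 -normr_le0; apply/ler_addgt0Pr => eps e0.
rewrite add0r; have e2 : 0 < eps / 2 by rewrite divr_gt0.
have [M1 H1] := grid_mean_cvg cI2 e2.
have e2n : 0 < eps / 2 / n'.+1%:R by rewrite divr_gt0.
have [d d0 H] := Hy _ e2n.
have [M2 H2] := inv_succ_small d0.
pose M := maxn M1 M2.
have {}H1 := H1 M (leq_maxl _ _); have {}H2 := H2 M (leq_maxr _ _).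
rewrite [eps]splitr.
apply: le_trans (ler_distD (grid_mean M (fun y => I (fun x => G x y))) _ _) _.
apply: lerD; last by rewrite distrC.
pose c : R := M.+1%:R^-1 ^+ n'.
have [cS IS] := @tI_sum n _ (index_enum 'rV['I_M.+1]_n') (fun=> c)
  (fun b x => G x (grid_point b)) (fun b => cGx (grid_point b)).
rewrite /grid_mean mulr_sumr -IS; apply: tI_dist => // x _.
rewrite -mulr_sumr.
apply: (@le_trans _ _ ((eps / 2 / n'.+1%:R) *+ n')).
  apply: (@grid_mean_approx _ _ M (G x)); first exact: continuous_ucube.
  move=> y y' _ _ yy'; apply: H; apply: le_trans H2.
  by apply/rV_normP => // i; rewrite subrVE.
rewrite -[leLHS]mulr_natr -[leLHS]mulrA ler_piMr ?ltW//.
by rewrite mulrC ltr_pdivrMr// mul1r ltr_nat.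
Qed.

End TorusMean.

Section ComplexMean.
Context {R : realType}.
Local Notation I := torus_Rintegral.
Implicit Types (z w : R[i]).

Lemma nmE z : `|z| = (nm z)%:C.
Proof. by case: z. Qed.

Lemma nm_ge0 z : 0 <= nm z.
Proof. by case: z => a b; exact: sqrtr_ge0. Qed.

Lemma nm0 : nm (0 : R[i]) = 0. Proof. exact: Normc.normc0. Qed.

Lemma nmB z w : nm (z - w) = nm (w - z).
Proof. by rewrite -opprB normcN. Qed.

Lemma nm_real (a : R) : nm a%:C = `|a|.
Proof. by rewrite /= expr0n addr0 sqrtr_sqr. Qed.

Lemma nm_conj z : nm (conjc z) = nm z.
Proof. by case: z => a b /=; rewrite sqrrN. Qed.

Lemma nm_Re z : `|Re z| <= nm z.
Proof. by case: z => a b /=; rewrite -sqrtr_sqr ler_sqrt ?addr_ge0 ?sqr_ge0// lerDl sqr_ge0. Qed.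

Lemma nm_Im z : `|Im z| <= nm z.
Proof. by case: z => a b /=; rewrite -sqrtr_sqr ler_sqrt ?addr_ge0 ?sqr_ge0// lerDr sqr_ge0. Qed.

Lemma nm_le z : nm z <= `|Re z| + `|Im z|.
Proof.
case: z => a b; rewrite (_ : a +i* b = a%:C + b%:C * 'i%C); last by simpc.
rewrite (le_trans (le_normcD _ _))// Normc.normcM !nm_real /=.
by rewrite expr0n expr1n add0r sqrtr1 mulr1 !mulr0 !mul0r !mulr1 ?subr0 ?addr0 ?add0r.
Qed.

Lemma nm_sum (J : Type) (r : seq J) (P : pred J) (f : J -> R[i]) :
  nm (\sum_(j <- r | P j) f j) <= \sum_(j <- r | P j) nm (f j).
Proof.
elim/big_ind2 : _ => [|x a y b xa yb|//]; first by rewrite nm0.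
by rewrite (le_trans (le_normcD _ _))// lerD.
Qed.

Lemma nm_distD z w v : nm (z - w) <= nm (z - v) + nm (v - w).
Proof. by rewrite -[z - w](subrKA v) le_normcD. Qed.

Lemma cReB z w : Re (z - w) = Re z - Re w. Proof. by case: z; case: w. Qed.
Lemma cImB z w : Im (z - w) = Im z - Im w. Proof. by case: z; case: w. Qed.
Lemma cReD z w : Re (z + w) = Re z + Re w. Proof. by case: z; case: w. Qed.
Lemma cImD z w : Im (z + w) = Im z + Im w. Proof. by case: z; case: w. Qed.
Lemma cReM z w : Re (z * w) = Re z * Re w - Im z * Im w.
Proof. by case: z; case: w. Qed.
Lemma cImM z w : Im (z * w) = Re z * Im w + Im z * Re w.
Proof. by case: z; case: w. Qed.

Section Fixed.
Context {n : nat}.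
Implicit Types (f g : 'rV[R]_n -> R[i]) (x y h : 'rV[R]_n).

Lemma cc_cst (c : R[i]) : ccontinuous (fun _ : 'rV[R]_n => c).
Proof. by split; exact: cont_cst. Qed.

Lemma ccD f g : ccontinuous f -> ccontinuous g -> ccontinuous (fun x => f x + g x).
Proof.
move=> [f1 f2] [g1 g2]; split.
  by under eq_fun do rewrite cReD; exact: contD.
by under eq_fun do rewrite cImD; exact: contD.
Qed.

Lemma ccM f g : ccontinuous f -> ccontinuous g -> ccontinuous (fun x => f x * g x).
Proof.
move=> [f1 f2] [g1 g2]; split.
  by under eq_fun do rewrite cReM; apply: contB; exact: contM.
by under eq_fun do rewrite cImM; apply: contD; exact: contM.
Qed.

Lemma cc_lin a f g : ccontinuous f -> ccontinuous g ->
  ccontinuous (fun x => a * f x + g x).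
Proof. by move=> cf cg; apply: ccD => //; apply: ccM => //; exact: cc_cst. Qed.

Lemma ccB f g : ccontinuous f -> ccontinuous g -> ccontinuous (fun x => f x - g x).
Proof.
move=> cf cg; under eq_fun do rewrite addrC -mulN1r.
exact: cc_lin.
Qed.

Lemma cc_real (F : 'rV[R]_n -> R) : continuous F -> ccontinuous (fun x => (F x)%:C).
Proof. by move=> cF; split => //; exact: cont_cst. Qed.

Lemma cc_shift f h : ccontinuous f -> ccontinuous (fun x => f (x + h)).
Proof.
by move=> [f1 f2]; split; [exact: (@continuous_shift _ _ (fun x => Re (f x)))|
  exact: (@continuous_shift _ _ (fun x => Im (f x)))].
Qed.

Lemma cc_nm f : ccontinuous f -> continuous (fun x => nm (f x)).
Proof.
move=> [f1 f2].
have -> : (fun x => nm (f x)) = (fun x =>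
    Num.sqrt (Re (f x) * Re (f x) + Im (f x) * Im (f x))).
  by apply/funext => x; case: (f x).
apply: cont_comp; last exact: sqrt_continuous.
by apply: contD; exact: contM.
Qed.

Lemma cI_lin a f g : ccontinuous f -> ccontinuous g ->
  cI (fun x => a * f x + g x) = a * cI f + cI g.
Proof.
case: a => a b [f1 f2] [g1 g2]; rewrite /torus_integral.
have cl := @cont_lin R 'rV[R]_n.
have E1 x : Re ((a +i* b) * f x + g x) =
    a * Re (f x) + ((- b) * Im (f x) + Re (g x)).
  by rewrite cReD cReM /= mulNr addrA.
have E2 x : Im ((a +i* b) * f x + g x) =
    a * Im (f x) + (b * Re (f x) + Im (g x)).
  by rewrite cImD cImM /= addrA.
under eq_fun do rewrite E1.
rewrite [in RHS]/GRing.mul [in RHS]/GRing.add /=.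
rewrite !tI_lin//; try exact: cl.
under [X in _ +i* I X]eq_fun do rewrite E2.
by rewrite !tI_lin//; [rewrite mulNr !addrA|exact: cl].
Qed.

Lemma cI_cst (c : R[i]) : cI (fun _ : 'rV[R]_n => c) = c.
Proof. by rewrite /torus_integral !tI_cst; case: c. Qed.

Lemma cIZ a f : ccontinuous f -> cI (fun x => a * f x) = a * cI f.
Proof.
move=> cf; have := cI_lin a cf (cc_cst 0).
by under eq_fun do rewrite addr0; rewrite cI_cst addr0.
Qed.

Lemma cID f g : ccontinuous f -> ccontinuous g ->
  cI (fun x => f x + g x) = cI f + cI g.
Proof.
move=> cf cg; have := cI_lin 1 cf cg.
by under eq_fun do rewrite mul1r; rewrite mul1r.
Qed.

Lemma cIB f g : ccontinuous f -> ccontinuous g ->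
  cI (fun x => f x - g x) = cI f - cI g.
Proof.
move=> cf cg; have := cI_lin (-1) cg cf.
by under eq_fun do rewrite mulN1r addrC; rewrite mulN1r addrC.
Qed.

Lemma cc_cI_sum (J : Type) (r : seq J) (f : J -> 'rV[R]_n -> R[i]) :
  (forall j, ccontinuous (f j)) ->
  ccontinuous (fun x => \sum_(j <- r) f j x) /\
  cI (fun x => \sum_(j <- r) f j x) = \sum_(j <- r) cI (f j).
Proof.
move=> cf; elim: r => [|j r [cr IHr]].
  split; first by under eq_fun do rewrite big_nil; exact: cc_cst.
  by under eq_fun do rewrite big_nil; rewrite cI_cst big_nil.
split; first by under eq_fun do rewrite big_cons; exact: ccD.
by under eq_fun do rewrite big_cons; rewrite cID// IHr big_cons.
Qed.

(** After multiplication by a phase the integral of [f] is its modulus, hence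
    real, and only the real part of the integrand matters. *)
Lemma nm_cI f : ccontinuous f -> nm (cI f) <= I (fun x => nm (f x)).
Proof.
move=> cf; have [z0|z0] := eqVneq (cI f) 0.
  rewrite z0 nm0 -(@tI_cst R n 0); apply: tI_le => [||x _].
  - exact: cont_cst.
  - exact: cc_nm.
  - exact: nm_ge0.
pose a := `|cI f| / cI f.
have na : nm a = 1.
  apply: (@complexI R); rewrite -nmE normrM normfV normr_id divff//.
  by rewrite normr_eq0.
have -> : nm (cI f) = Re (a * cI f) by rewrite mulfVK// nmE.
rewrite -cIZ//= /torus_integral/=.
have caf : ccontinuous (fun x => a * f x) by apply: ccM => //; exact: cc_cst.
apply: tI_le => [||x _]; first by case: caf.
  exact: cc_nm.
apply: le_trans (ler_norm _) (le_trans (nm_Re _) _).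
by rewrite Normc.normcM na mul1r.
Qed.

Lemma nm_cI_le f c : ccontinuous f -> (forall x, in_cube x -> nm (f x) <= c) ->
  nm (cI f) <= c.
Proof.
move=> cf H; apply: le_trans (nm_cI cf) _; rewrite -(@tI_cst R n c).
by apply: tI_le => //; [exact: cc_nm|exact: cont_cst].
Qed.

Lemma cI_shift f h : ccontinuous f -> Zn_periodic f ->
  cI (fun x => f (x + h)) = cI f.
Proof.
move=> [f1 f2] pf; rewrite /torus_integral.
rewrite (@tI_shift _ _ (fun x => Re (f x)))// ?(@tI_shift _ _ (fun x => Im (f x)))//.
  by move=> x k; rewrite pf.
by move=> x k; rewrite pf.
Qed.

Lemma zper_cuniform f : ccontinuous f -> Zn_periodic f ->
  forall eps, 0 < eps -> exists2 d, 0 < d &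
    forall x y, `|x - y| <= d -> nm (f x - f y) <= eps.
Proof.
move=> [f1 f2] pf eps e0; have e2 : 0 < eps / 2 by rewrite divr_gt0.
have p1 : zper (fun x => Re (f x)) by move=> x k; rewrite pf.
have p2 : zper (fun x => Im (f x)) by move=> x k; rewrite pf.
have [d1 d10 H1] := zper_uniform f1 p1 e2.
have [d2 d20 H2] := zper_uniform f2 p2 e2.
exists (Num.min d1 d2); first by rewrite lt_min d10.
move=> x y; rewrite le_min => /andP[xy1 xy2].
apply: le_trans (nm_le _) _; rewrite cReB cImB [eps]splitr.
by rewrite lerD ?H1 ?H2.
Qed.

Lemma zper_cbounded f : ccontinuous f -> Zn_periodic f ->
  exists2 B, 0 < B & forall x, nm (f x) <= B.
Proof.
move=> cf pf; have [|B B0 H] := zper_bounded (cc_nm cf).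
  by move=> x k; rewrite pf.
by exists B => // x; rewrite -[nm _]ger0_norm ?nm_ge0.
Qed.

Lemma cuniform_cc f :
  (forall eps, 0 < eps -> exists2 d, 0 < d &
    forall x y, `|x - y| <= d -> nm (f x - f y) <= eps) -> ccontinuous f.
Proof.
move=> H; split; apply: cont_unif => eps /H[d d0 Hd];
    exists d => // x y /Hd; apply: le_trans.
  by rewrite -cReB nm_Re.
by rewrite -cImB nm_Im.
Qed.

End Fixed.

Lemma cI_swap n n' (G : 'rV[R]_n -> 'rV[R]_n' -> R[i]) :
  (forall eps, 0 < eps -> exists2 d, 0 < d & forall x x' y,
     `|x - x'| <= d -> nm (G x y - G x' y) <= eps) ->
  (forall eps, 0 < eps -> exists2 d, 0 < d & forall x y y',
     `|y - y'| <= d -> nm (G x y - G x y') <= eps) ->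
  cI (fun x => cI (fun y => G x y)) = cI (fun y => cI (fun x => G x y)).
Proof.
move=> Hx Hy; rewrite /torus_integral/=; congr (_ +i* _).
  apply: (@tI_swap _ _ _ (fun x y => Re (G x y))) => eps.
    move=> /Hx[d d0 H]; exists d => // x x' y /H{}H.
    by rewrite -cReB (le_trans (nm_Re _)).
  move=> /Hy[d d0 H]; exists d => // x y y' /H{}H.
  by rewrite -cReB (le_trans (nm_Re _)).
apply: (@tI_swap _ _ _ (fun x y => Im (G x y))) => eps.
  move=> /Hx[d d0 H]; exists d => // x x' y /H{}H.
  by rewrite -cImB (le_trans (nm_Im _)).
move=> /Hy[d d0 H]; exists d => // x y y' /H{}H.
by rewrite -cImB (le_trans (nm_Im _)).
Qed.

End ComplexMean.

(** * Fourier modes and trigonometric polynomials *)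

Section Modes.
Context {R : realType}.

Definition cis (t : R) : R[i] := cos t +i* sin t.

Lemma cisD s t : cis (s + t) = cis s * cis t.
Proof. by rewrite /cis cosD sinD; simpc; rewrite [sin s * _ + _]addrC. Qed.

Lemma cis0 : cis 0 = 1. Proof. by rewrite /cis cos0 sin0. Qed.

Lemma cispi : cis pi = -1.
Proof. by rewrite /cis cospi sinpi complexr0 rmorphN1. Qed.

Lemma nm_cis t : nm (cis t) = 1.
Proof. by rewrite /= cos2Dsin2 sqrtr1. Qed.

Lemma cisN t : cis (- t) = conjc (cis t).
Proof. by rewrite /cis cosN sinN. Qed.

Lemma cis_2pi_int (m : int) : cis (2 * pi * m%:~R) = 1.
Proof.
have cis2pi : cis (2 * pi) = 1 by rewrite mulr_natl mulr2n cisD cispi mulrNN mulr1.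
have H (k : nat) : cis (2 * pi * k%:R) = 1.
  elim: k => [|k IH]; first by rewrite mulr0 cis0.
  by rewrite -[k.+1%:R]natr1 mulrDr mulr1 cisD IH cis2pi mulr1.
case: m => k; first exact: H.
by rewrite NegzE mulrNz mulrN cisN -pmulrn H conjc1.
Qed.

Section Fixed.
Context {n : nat}.
Implicit Types (f g : 'rV[R]_n -> R[i]) (x y h : 'rV[R]_n) (k l : 'rV[int]_n).
Local Notation vec := (@vec_of_int R n).

Lemma modeE k x : e k x = cis (2 * pi * dot (vec k) x). Proof. by []. Qed.

Lemma dotDr x y h : dot x (y + h) = dot x y + dot x h.
Proof. by rewrite -big_split/=; apply: eq_bigr => i _; rewrite mxE mulrDr. Qed.

Lemma dotDl x y h : dot (x + y) h = dot x h + dot y h.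
Proof. by rewrite -big_split/=; apply: eq_bigr => i _; rewrite mxE mulrDl. Qed.

Lemma dotNl x y : dot (- x) y = - dot x y.
Proof. by rewrite -sumrN; apply: eq_bigr => i _; rewrite mxE mulNr. Qed.

Lemma dotZr a x y : dot x (a *: y) = a * dot x y.
Proof. by rewrite mulr_sumr; apply: eq_bigr => i _; rewrite mxE mulrCA. Qed.

Lemma dot_delta x i : dot x (delta_mx ord0 i) = x ord0 i.
Proof.
rewrite /dot (bigD1 i)//= mxE !eqxx mulr1 big1 ?addr0// => j ji.
by rewrite mxE eqxx (negbTE ji) mulr0.
Qed.

Lemma vecD k l : vec (k + l) = vec k + vec l. Proof. exact: map_mxD. Qed.
Lemma vecN k : vec (- k) = - vec k. Proof. exact: map_mxN. Qed.
Lemma vec0 : vec 0 = 0. Proof. exact: map_mx0. Qed.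
Lemma vecB k l : vec (k - l) = vec k - vec l. Proof. exact: map_mxB. Qed.

Lemma modeD k l x : e (k + l) x = e k x * e l x.
Proof. by rewrite !modeE vecD dotDl mulrDr cisD. Qed.

Lemma mode_shift k x y : e k (x + y) = e k x * e k y.
Proof. by rewrite !modeE dotDr mulrDr cisD. Qed.

Lemma mode0 x : e 0 x = 1.
Proof.
rewrite modeE vec0 /dot big1 ?mulr0 ?cis0// => i _; by rewrite mxE mul0r.
Qed.

Lemma modeN k x : e (- k) x = conjc (e k x).
Proof. by rewrite !modeE vecN dotNl mulrN cisN. Qed.

Lemma mode_opp k x : e k (- x) = conjc (e k x).
Proof.
by rewrite -modeN !modeE vecN dotNl -[- x]scaleN1r dotZr mulN1r.
Qed.

Lemma nm_mode k x : nm (e k x) = 1. Proof. exact: nm_cis. Qed.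

Lemma mode_periodic k : Zn_periodic (fourier_mode (R := R) k).
Proof.
move=> x l; rewrite mode_shift [X in _ * X]modeE.
have -> : dot (vec k) (vec l) = (\sum_i k ord0 i * l ord0 i)%:~R.
  by rewrite rmorph_sum/=; apply: eq_bigr => i _; rewrite !mxE intrM.
by rewrite cis_2pi_int mulr1.
Qed.

Lemma cont_dot y : continuous (fun x => dot y x).
Proof.
have [+ _] := @tI_sum R n _ (index_enum 'I_n) (fun i => y ord0 i) (fun i x => x ord0 i)
  (fun i => @coord_continuous _ _ _ _ i).
exact.
Qed.

Lemma cc_mode k : ccontinuous (fourier_mode (R := R) k).
Proof.
have cd : continuous (fun x : 'rV[R]_n => 2 * pi * dot (vec k) x).
  by apply: contM; [exact: cont_cst|exact: cont_dot].
by split; apply: (cont_comp cd); [exact: continuous_cos|exact: continuous_sin].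
Qed.

(** Translating by half a period of the mode changes its sign. *)
Lemma cI_mode k : cI (fourier_mode (R := R) k) = (k == 0)%:R.
Proof.
have [->|k0] := eqVneq k 0.
  rewrite (_ : fourier_mode 0 = (fun=> 1)) ?cI_cst//.
  by apply/funext => x; rewrite mode0.
have [i ki] : exists i, k ord0 i != 0.
  apply/existsP; apply: contraNT k0; rewrite negb_exists => /forallP H.
  by apply/eqP/rowP => i; rewrite mxE; have := H i; rewrite negbK => /eqP.
have kR : (k ord0 i)%:~R != 0 :> R by rewrite intr_eq0.
pose h : 'rV[R]_n := (2 * (k ord0 i)%:~R)^-1 *: delta_mx ord0 i.
have eh : e k h = -1.
  rewrite modeE dotZr dot_delta mxE -cispi; congr cis; field; exact: kR.
have := cI_shift h (cc_mode k) (@mode_periodic k).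
under eq_fun do rewrite mode_shift eh mulrC.
rewrite cIZ; last exact: cc_mode.
rewrite mulN1r => /eqP; rewrite -subr_eq0 -opprD oppr_eq0 -mulr2n mulrn_eq0/=.
by move=> /eqP.
Qed.

Definition fcoef f k : R[i] := cI (fun x => f x * e (- k) x).

Lemma fcoef_mode k l : fcoef (e k) l = (k == l)%:R.
Proof.
rewrite /fcoef; under eq_fun do rewrite -modeD.
by rewrite cI_mode subr_eq0.
Qed.

Lemma fcoef_lin a f g k : ccontinuous f -> ccontinuous g ->
  fcoef (fun x => a * f x + g x) k = a * fcoef f k + fcoef g k.
Proof.
move=> cf cg; rewrite /fcoef -cI_lin; try by apply: ccM => //; exact: cc_mode.
by under eq_fun do rewrite mulrDl -mulrA.
Qed.

Lemma fcoef_dist f g k eps : ccontinuous f -> ccontinuous g ->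
  (forall x, nm (f x - g x) <= eps) -> nm (fcoef f k - fcoef g k) <= eps.
Proof.
move=> cf cg H; rewrite /fcoef -cIB; try by apply: ccM => //; exact: cc_mode.
apply: nm_cI_le => [|x _].
  by apply: ccB; apply: ccM => //; exact: cc_mode.
by rewrite -mulrBl Normc.normcM nm_mode mulr1.
Qed.

Lemma fcoef_shift f h k : ccontinuous f -> Zn_periodic f ->
  fcoef (fun x => f (x + h)) k = e k h * fcoef f k.
Proof.
move=> cf pf; have cfm : ccontinuous (fun x => f x * e (- k) x).
  by apply: ccM => //; exact: cc_mode.
rewrite /fcoef -(cI_shift h cfm); last first.
  by move=> x l; rewrite pf mode_periodic.
rewrite -cIZ; last exact: cc_shift cfm.
congr cI; apply/funext => x; rewrite mode_shift.
transitivity (f (x + h) * e (- k) x * (e k h * e (- k) h)); last by ring.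
by rewrite -modeD subrr mode0 mulr1.
Qed.

Definition trig (s : seq (R[i] * 'rV[int]_n)) x := \sum_(p <- s) p.1 * e p.2 x.

Lemma cc_trig s : ccontinuous (trig s).
Proof.
by apply: (cc_cI_sum _ _).1 => p; apply: ccM; [exact: cc_cst|exact: cc_mode].
Qed.

Lemma trig_periodic s : Zn_periodic (trig s).
Proof. by move=> x k; apply: eq_bigr => p _; rewrite mode_periodic. Qed.

Definition is_trig f := exists s, forall x, f x = trig s x.

Lemma is_trig_cst c : is_trig (fun=> c).
Proof. by exists [:: (c, 0)] => x; rewrite /trig big_seq1 mode0 mulr1. Qed.

Lemma is_trig_mode k : is_trig (fourier_mode k).
Proof. by exists [:: (1, k)] => x; rewrite /trig big_seq1 mul1r. Qed.

Lemma is_trigD f g : is_trig f -> is_trig g -> is_trig (fun x => f x + g x).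
Proof.
by move=> [s Hs] [t Ht]; exists (s ++ t) => x; rewrite /trig big_cat/= Hs Ht.
Qed.

Lemma is_trigM f g : is_trig f -> is_trig g -> is_trig (fun x => f x * g x).
Proof.
move=> [s Hs] [t Ht].
exists [seq (p.1 * q.1, p.2 + q.2) | p <- s, q <- t] => x.
rewrite /trig big_allpairs_dep/= Hs Ht /trig mulr_suml; apply: eq_bigr => p _.
by rewrite mulr_sumr; apply: eq_bigr => q _; rewrite modeD mulrACA.
Qed.

Lemma is_trig_sum (J : Type) (r : seq J) (f : J -> 'rV[R]_n -> R[i]) :
  (forall j, is_trig (f j)) -> is_trig (fun x => \sum_(j <- r) f j x).
Proof.
move=> H; elim: r => [|j r IH].
  by under eq_fun do rewrite big_nil; exact: is_trig_cst.
by under eq_fun do rewrite big_cons; exact: is_trigD.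
Qed.

Lemma is_trig_prod (J : Type) (r : seq J) (f : J -> 'rV[R]_n -> R[i]) :
  (forall j, is_trig (f j)) -> is_trig (fun x => \prod_(j <- r) f j x).
Proof.
move=> H; elim: r => [|j r IH].
  by under eq_fun do rewrite big_nil; exact: is_trig_cst.
by under eq_fun do rewrite big_cons; exact: is_trigM.
Qed.

End Fixed.
End Modes.

(** * Partial derivatives *)

Section Derivatives.
Context {R : realType} {n : nat}.
Implicit Types (F G : 'rV[R]_n -> R) (f g : 'rV[R]_n -> R[i]).
Implicit Types (x y v : 'rV[R]_n) (k l : 'rV[int]_n) (i : 'I_n).
Local Notation delta i := (delta_mx ord0 i : 'rV[R]_n).

Lemma line_quotient F v x (t : R) :
  (fun h : R => h^-1 *: (F (h *: v + (t *: v + x)) - F (t *: v + x))) =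
  (fun h : R => h^-1 *: ((fun s => F (s *: v + x)) (h *: (1 : R^o) + t) - F (t *: v + x))).
Proof.
by apply/funext => h; rewrite /= addrA -scalerDl [h *: _]mulr1.
Qed.

Lemma derivable_line F v x (t : R) :
  derivable (fun s : R => F (s *: v + x)) t 1 = derivable F (t *: v + x) v.
Proof. by rewrite /derivable line_quotient. Qed.

Lemma derive_line F v x (t : R) :
  'D_1 (fun s : R => F (s *: v + x)) t = 'D_v F (t *: v + x).
Proof. by rewrite /derive line_quotient. Qed.

Lemma mean_value_line F v x (h : R) : (forall y, derivable F y v) ->
  exists2 s : R, `|s| <= `|h| & F (x + h *: v) - F x = h * 'D_v F (x + s *: v).
Proof.
move=> dF; pose phi (s : R) := F (s *: v + x).
have dphi (s : R) : is_derive s 1 phi ('D_v F (s *: v + x)).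
  by rewrite -derive_line; apply: DeriveDef => //; rewrite derivable_line.
have cphi a b : {within `[a, b], continuous phi}.
  by apply: derivable_within_continuous => s _; case: (dphi s).
have phi0 : phi 0 = F x by rewrite /phi scale0r add0r.
have phih : phi h = F (x + h *: v) by rewrite /phi addrC.
have [h0|h0] := leP 0 h.
  have [s sh] := MVT_segment h0 (fun s _ => dphi s) (cphi _ _).
  rewrite subr0 phi0 phih => E; exists s.
    by move: sh; rewrite in_itv/= => /andP[s0 sh]; rewrite !ger0_norm.
  by rewrite E mulrC [x + _]addrC.
have [s sh] := MVT_segment (ltW h0) (fun s _ => dphi s) (cphi _ _).
rewrite sub0r phi0 phih => E; exists s.
  move: sh; rewrite in_itv/= => /andP[sh s0].
  by rewrite !ler0_norm ?lerN2// ltW.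
by rewrite -opprB E mulrN opprK mulrC [x + _]addrC.
Qed.

Lemma cderivable_lin i a f g : cderivable i f -> cderivable i g ->
  cderivable i (fun x => a * f x + g x) /\
  cpartial i (fun x => a * f x + g x) =
    (fun x => a * cpartial i f x + cpartial i g x).
Proof.
case: a => a b df dg.
have lin (c d : R) (F1 F2 F3 : 'rV[R]_n -> R) x :
    derivable F1 x (delta i) -> derivable F2 x (delta i) ->
    derivable F3 x (delta i) ->
    is_derive x (delta i) (fun y => c * F1 y + d * F2 y + F3 y)
     (c * 'D_(delta i) F1 x + d * 'D_(delta i) F2 x + 'D_(delta i) F3 x).
  move=> d1 d2 d3.
  have D1 := @derivableP _ _ _ F1 x (delta i) d1.
  have D2 := @derivableP _ _ _ F2 x (delta i) d2.
  have D3 := @derivableP _ _ _ F3 x (delta i) d3.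
  exact: (is_deriveD (is_deriveD (is_deriveZ c D1) (is_deriveZ d D2)) D3).
have E1 : (fun y => Re ((a +i* b) * f y + g y)) =
    (fun y => a * Re (f y) + (- b) * Im (f y) + Re (g y)).
  by apply/funext => y; rewrite cReD cReM /= mulNr.
have E2 : (fun y => Im ((a +i* b) * f y + g y)) =
    (fun y => b * Re (f y) + a * Im (f y) + Im (g y)).
  by apply/funext => y; rewrite cImD cImM /= [X in X + _]addrC.
have H1 x := lin a (- b) _ _ _ x (df x).1 (df x).2 (dg x).1.
have H2 x := lin b a _ _ _ x (df x).1 (df x).2 (dg x).2.
split=> [x|]; first by rewrite E1 E2; case: (H1 x); case: (H2 x).
apply/funext => x; rewrite /cpartial E1 E2.
have [_ ->] := H1 x; have [_ ->] := H2 x.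
rewrite [in RHS]/GRing.mul [in RHS]/GRing.add /=.
by rewrite mulNr [X in _ +i* (X + _)]addrC.
Qed.

Lemma cderivableM i f g : cderivable i f -> cderivable i g ->
  cderivable i (fun x => f x * g x) /\
  cpartial i (fun x => f x * g x) =
    (fun x => f x * cpartial i g x + cpartial i f x * g x).
Proof.
move=> df dg.
have mul (F1 F2 G1 G2 : 'rV[R]_n -> R) (c : R) x :
    derivable F1 x (delta i) -> derivable F2 x (delta i) ->
    derivable G1 x (delta i) -> derivable G2 x (delta i) ->
    is_derive x (delta i) (fun y => F1 y * G1 y + c * (F2 y * G2 y))
     ((F1 x * 'D_(delta i) G1 x + G1 x * 'D_(delta i) F1 x) +
      c * (F2 x * 'D_(delta i) G2 x + G2 x * 'D_(delta i) F2 x)).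
  move=> d1 d2 d3 d4.
  have D1 := @derivableP _ _ _ F1 x (delta i) d1.
  have D2 := @derivableP _ _ _ F2 x (delta i) d2.
  have D3 := @derivableP _ _ _ G1 x (delta i) d3.
  have D4 := @derivableP _ _ _ G2 x (delta i) d4.
  exact: (is_deriveD (is_deriveM D1 D3) (is_deriveZ c (is_deriveM D2 D4))).
have E1 : (fun y => Re (f y * g y)) =
    (fun y => Re (f y) * Re (g y) + (-1) * (Im (f y) * Im (g y))).
  by apply/funext => y; rewrite cReM mulN1r.
have E2 : (fun y => Im (f y * g y)) =
    (fun y => Re (f y) * Im (g y) + 1 * (Im (f y) * Re (g y))).
  by apply/funext => y; rewrite cImM mul1r.
have H1 x := mul _ _ _ _ (-1) x (df x).1 (df x).2 (dg x).1 (dg x).2.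
have H2 x := mul _ _ _ _ 1 x (df x).1 (df x).2 (dg x).2 (dg x).1.
split=> [x|]; first by rewrite E1 E2; case: (H1 x); case: (H2 x).
apply/funext => x; rewrite /cpartial E1 E2.
have [_ ->] := H1 x; have [_ ->] := H2 x.
apply/eqP; rewrite eq_complex; apply/andP; split; apply/eqP.
  by rewrite /= cReD !cReM /=; ring.
by rewrite /= cImD !cImM /=; ring.
Qed.

Definition dcoef i k : R[i] := (2 * pi * (k ord0 i)%:~R)%:C * 'i%C.

Lemma cderivable_mode i k : cderivable i (fourier_mode (R := R) k) /\
  cpartial i (fourier_mode k) = (fun x => dcoef i k * e k x).
Proof.
set c := 2 * pi * (k ord0 i)%:~R : R.
have lin x : (fun s : R => 2 * pi * dot (vec_of_int k) (s *: delta i + x)) =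
    (fun s => c * s + 2 * pi * dot (vec_of_int k) x).
  apply/funext => s; rewrite dotDr dotZr dot_delta mxE mulrDr; congr (_ + _).
  by rewrite /c -[RHS]mulrA [RHS]mulrA; ring.
have dlin x : is_derive (0 : R) 1
    (fun s : R => 2 * pi * dot (vec_of_int k) (s *: delta i + x)) c.
  rewrite lin -[X in is_derive _ _ _ X]mulr1 -[X in is_derive _ _ _ X]addr0.
  exact: (is_deriveD (is_deriveZ c (is_derive_id (0 : R^o) 1))
    (is_derive_cst (2 * pi * dot (vec_of_int k) x : R^o) _ _)).
have x0 x : x = (0 : R) *: delta i + x by rewrite scale0r add0r.
have H (phi phi' : R -> R) x (dphi : forall t : R, is_derive t 1 phi (phi' t)) :
    is_derive x (delta i) (fun y => phi (2 * pi * dot (vec_of_int k) y))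
      (c * phi' (2 * pi * dot (vec_of_int k) x)).
  have D : is_derive (0 : R) 1
     (fun s : R => phi (2 * pi * dot (vec_of_int k) (s *: delta i + x)))
     (c * phi' (2 * pi * dot (vec_of_int k) (0 *: delta i + x))).
    rewrite [X in is_derive _ _ _ X]mulrC; exact: (is_derive1_comp (dphi _) (dlin x)).
  split.
    by rewrite [x in derivable _ x _]x0 -derivable_line; case: D.
  rewrite [x in LHS]x0 -derive_line; have [_ ->] := D.
  by rewrite -x0.
have Hc x := H cos (fun t => - sin t) x (fun t => is_derive_cos t).
have Hs x := H sin cos x (fun t => is_derive_sin t).
split=> [x|]; first by split; [case: (Hc x)|case: (Hs x)].
apply/funext => x; rewrite /cpartial /=.
have [_ ->] := Hc x; have [_ ->] := Hs x.
apply/eqP; rewrite eq_complex /dcoef /fourier_mode -/c.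
by apply/andP; split; apply/eqP; rewrite ?cReM ?cImM /=; ring.
Qed.

End Derivatives.

Section FourierDerivative.
Context {R : realType} {n : nat}.
Local Notation I := torus_Rintegral.
Implicit Types (F G : 'rV[R]_n -> R) (f g : 'rV[R]_n -> R[i]).
Implicit Types (x y v : 'rV[R]_n) (k l : 'rV[int]_n) (i : 'I_n).
Implicit Types (s : seq (R[i] * 'rV[int]_n)).
Local Notation delta i := (delta_mx ord0 i : 'rV[R]_n).

Definition dseq i (s : seq (R[i] * 'rV[int]_n)) :=
  [seq (p.1 * dcoef i p.2, p.2) | p <- s].

Lemma cderivable_trig i s : cderivable i (trig (R := R) s) /\
  cpartial i (trig s) = trig (dseq i s).
Proof.
elim: s => [|[c k] s [ds Ds]].
  have -> : trig [::] = (fun=> 0) :> ('rV[R]_n -> R[i]).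
    by apply/funext => x; rewrite /trig big_nil.
  split; first by move=> x; split; exact: derivable_cst.
  by apply/funext => x; rewrite /trig ?big_nil /cpartial !derive_cst.
have -> : trig ((c, k) :: s) = (fun x => c * e k x + trig s x).
  by apply/funext => x; rewrite /trig big_cons.
have [dk Dk] := @cderivable_mode R n i k.
have [? ->] := cderivable_lin c dk ds; split => //.
by apply/funext => x; rewrite Dk Ds /trig/= big_cons/= mulrA.
Qed.

Lemma cpartials_trig L s : cpartials L (trig (R := R) s) = trig (foldr dseq s L).
Proof.
by elim: L => //= i L ->; rewrite (cderivable_trig i _).2.
Qed.

Lemma test_function_trig s : test_function (trig (R := R) s).
Proof.
split; first exact: trig_periodic.
move=> m; split=> [l _|l i _]; rewrite cpartials_trig; first exact: cc_trig.
exact: (cderivable_trig i _).1.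
Qed.

Lemma cpartial_periodic i f : Zn_periodic f -> Zn_periodic (cpartial i f).
Proof.
move=> pf x k.
have D F : zper F -> 'D_(delta i) F (x + vec_of_int k) = 'D_(delta i) F x.
  move=> pF; rewrite /derive.
  have -> // : (fun h : R => h^-1 *: (F (h *: delta i + (x + vec_of_int k)) -
      F (x + vec_of_int k))) =
    (fun h : R => h^-1 *: (F (h *: delta i + x) - F x)).
  by apply/funext => h; rewrite addrA !pF.
by rewrite /cpartial !D// => y l; rewrite pf.
Qed.

(** The mean of a derivative vanishes because the mean of the difference
    quotients does, by translation invariance. *)
Lemma tI_derive i F : continuous F -> zper F ->
  (forall x, derivable F x (delta i)) -> continuous (fun x => 'D_(delta i) F x) ->
  zper (fun x => 'D_(delta i) F x) ->
  I (fun x => 'D_(delta i) F x) = 0.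
Proof.
move=> cF pF dF cD pD; apply/eqP; rewrite -normr_le0; apply/ler_addgt0Pr => eps e0.
rewrite add0r; have [d d0 H] := zper_uniform cD pD e0.
pose Q x := d^-1 * F (x + d *: delta i) + (- d^-1) * F x.
have cQ1 : continuous (fun x => (- d^-1) * F x).
  by apply: contM => //; exact: cont_cst.
have cQ : continuous Q by apply: cont_lin => //; exact: continuous_shift.
have IQ : I Q = 0.
  rewrite tI_lin//; last exact: continuous_shift.
  rewrite tI_shift//.
  rewrite tIZ//.
  by rewrite mulNr subrr.
rewrite -[X in `|X|]subr0 -IQ; apply: tI_dist => // x _.
have [s sd E] := mean_value_line x d dF.
have -> : Q x = 'D_(delta i) F (x + s *: delta i).
  by rewrite /Q mulNr -mulrBr E mulKf// gt_eqF.
apply: H; rewrite opprD addrA subrr sub0r normrN normrZ.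
have delta1 : `|delta i| <= 1.
  apply/rV_normP => // j; rewrite mxE eqxx/=.
  by case: (j == i); rewrite ?normr1 ?normr0.
by rewrite -[d]mulr1 ler_pM// (le_trans sd)// gtr0_norm.
Qed.

(** Integration by parts: [tI_derive] for the product [f e_(-k)]. *)
Lemma fcoef_partial i f k : ccontinuous f -> Zn_periodic f ->
  cderivable i f -> ccontinuous (cpartial i f) ->
  fcoef (cpartial i f) k = dcoef i k * fcoef f k.
Proof.
move=> cf pf df cD.
have [dm Dm] := @cderivable_mode R n i (- k).
have [dfm Dfm] := cderivableM df dm.
have cm := @cc_mode R n (- k).
have pm := @mode_periodic R n (- k).
have cfm : ccontinuous (fun x => f x * e (- k) x) by exact: ccM.
have cDm : ccontinuous (cpartial i (fourier_mode (- k) : 'rV[R]_n -> R[i])).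
  by rewrite Dm; apply: ccM => //; exact: cc_cst.
have cDfm : ccontinuous (cpartial i (fun x => f x * e (- k) x)).
  by rewrite Dfm; apply: ccD; exact: ccM.
have pfm : Zn_periodic (fun x => f x * e (- k) x).
  by move=> x l; rewrite pf pm.
have pDfm := cpartial_periodic i pfm.
have : cI (cpartial i (fun x => f x * e (- k) x)) = 0.
  rewrite /torus_integral/=.
  rewrite (@tI_derive i (fun x => Re (f x * e (- k) x))).
  - rewrite (@tI_derive i (fun x => Im (f x * e (- k) x)))//.
    + by case: cfm.
    + by move=> x l; rewrite pfm.
    + by move=> x; case: (dfm x).
    + by case: cDfm.
    + by move=> x l; have := pDfm x l; move=> [].
  - by case: cfm.
  - by move=> x l; rewrite pfm.
  - by move=> x; case: (dfm x).
  - by case: cDfm.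
  - by move=> x l; have := pDfm x l; move=> [].
rewrite Dfm Dm cID; try exact: ccM.
  rewrite addrC -/(fcoef (cpartial i f) k) => /eqP; rewrite addr_eq0 => /eqP ->.
  rewrite -mulN1r -cIZ; last by apply: ccM => //; rewrite -Dm.
  rewrite /fcoef -cIZ//; congr cI; apply/funext => x.
  have -> : dcoef i (- k) = - dcoef i k :> R[i].
    by rewrite /dcoef !mxE rmorphN/= mulrN rmorphN mulNr.
  by ring.
by apply: ccM => //; rewrite -Dm.
Qed.

End FourierDerivative.

(** * A positive summability kernel *)

Section Kernel.
Context {R : realType}.
Local Notation I := torus_Rintegral.
Local Notation mu := (@lebesgue_measure R).

Definition wt (t : R) := 1 - cos (2 * pi * t).

Lemma wt_ge0 t : 0 <= wt t. Proof. by rewrite subr_ge0 cos_le1. Qed.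

Lemma cont_wt : continuous wt.
Proof.
apply: contB; first exact: cont_cst.
apply: cont_comp; last exact: continuous_cos.
by apply: contM; [exact: cont_cst|move=> x; exact: cvg_id].
Qed.

Lemma wt_sym t : wt (1 - t) = wt t.
Proof.
have -> : wt (1 - t) = 1 - Re (cis (2 * pi * (1 - t))) by [].
by rewrite mulrBr mulr1 cisD -{1}[2 * pi]mulr1 (@cis_2pi_int R 1) mul1r /= cosN.
Qed.

(** [wt t = 2 sin(pi t)^2], and the sine lies above a chord on [0, pi/2]; the slope
    [cos 1] comes from the mean value theorem on [0, 1]. *)
Lemma sqr_le_wt : exists2 c : R, 0 < c &
  forall t, 0 <= t <= 1 / 2 -> c * t ^+ 2 <= wt t.
Proof.
exists (cos 1 ^+ 2) => [|t /andP[t0 t1]]; first by rewrite exprn_gt0// cos1_gt0.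
have c1 := @cos1_gt0 R.
have pi2 := @pihalf_lt2 R; have pi1 := @pi_ge2 R.
have small x : 0 <= x <= 1 -> cos 1 * x <= sin x :> R.
  move=> /andP[x0 x1].
  have [s] := @MVT_segment R sin cos 0 x x0 (fun s _ => is_derive_sin s)
    (continuous_subspaceT (@continuous_sin R)).
  rewrite sin0 !subr0 in_itv/= => /andP[s0 sx] ->; apply: ler_wpM2r => //.
  rewrite leNgt ltr_cos ?in_itv/= -?leNgt ?s0 ?(le_trans sx)//; lra.
have sinb x : 0 <= x <= pi / 2 -> cos 1 * (x / 2) <= sin x :> R.
  move=> /andP[x0 x2]; have [x1|x1] := leP x 1.
    by apply: le_trans (small x _); rewrite ?x0// ler_pM2l// ler_pdivrMr//; lra.
  apply: (@le_trans _ _ (sin 1)).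
    by apply: le_trans (small 1 _); rewrite ?lexx ?ler01// ler_pM2l//; lra.
  by rewrite leNgt ltr_sin ?in_itv/= -?leNgt ?(ltW x1)//; lra.
have E : wt t = 2 * sin (pi * t) ^+ 2.
  rewrite /wt -mulrA mulr_natl cos_mulr2n sin2cos2; ring.
have h : cos 1 * t <= sin (pi * t).
  apply: le_trans (sinb _ _); last by apply/andP; split; nra.
  by rewrite ler_pM2l//; nra.
have h0 : 0 <= cos 1 * t by rewrite mulr_ge0// ltW.
have := ler_pM h0 h0 h h; rewrite E; nra.
Qed.

(** The Fejer-type kernel [|D|^2 / A] built on a tent sequence rather than on a
    constant one: its Fourier coefficients are autocorrelations of the sequence,
    so that [1 - K^(1)] is half the energy of the increments over the energy of
    the sequence, which is of the order of [M^-2].  Constant sequences have a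
    jump at both ends and only give [M^-1]. *)
Definition tent M j : R := (minn j (M.*2 - j))%:R.

Definition tent_energy M := \sum_(j < M.*2) tent M j ^+ 2.

Definition dirichlet M t : R[i] := \sum_(j < M.*2) (tent M j)%:C * cis (2 * pi * (j%:R * t)).

Definition kern M t : R := (tent_energy M)^-1 * nm (dirichlet M t) ^+ 2.

(** The rising half of the tent contributes [1 + 4 + ... + M^2]. *)
Lemma tent_energy_ge M : (0 < M)%N -> M%:R ^+ 3 / 3 <= tent_energy M.
Proof.
move=> M0.
have H k : k%:R ^+ 3 / 3 <= \sum_(j < k.+1) (j%:R : R) ^+ 2.
  elim: k => [|k IH].
    by rewrite expr0n mul0r sumr_ge0// => j _; rewrite sqr_ge0.
  rewrite big_ord_recr/= -[k.+1%:R]natr1.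
  have k0 : 0 <= k%:R :> R by [].
  apply: le_trans (lerD IH (lexx _)).
  by rewrite ler_pdivrMr// mulrDl mulfVK//; nra.
apply: le_trans (H M) _; rewrite /tent_energy.
rewrite -(big_mkord xpredT (fun j => j%:R ^+ 2 : R)).
rewrite -(big_mkord xpredT (fun j => tent M j ^+ 2)).
have M2 : (M.+1 <= M.*2)%N by rewrite -addnn -addn1 leq_add2l.
rewrite [leRHS](big_cat_nat (leq0n _) M2)/= ler_wpDr//.
  by rewrite sumr_ge0// => j _; rewrite sqr_ge0.
rewrite le_eqVlt; apply/orP; left; apply/eqP.
apply: eq_big_nat => j /andP[_ jM]; rewrite /tent (minn_idPl _)//.
by rewrite -addnn; lia.
Qed.

Lemma tent_energy_gt0 M : (0 < M)%N -> 0 < tent_energy M.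
Proof.
move=> M0; apply: lt_le_trans (tent_energy_ge M0).
by rewrite divr_gt0// exprn_gt0// ltr0n.
Qed.

(** Twice the difference is the sum of the squared increments of the tent, each of
    which is [1] or [-1]. *)
Lemma tent_increments M :
  tent_energy M - \sum_(j < M.*2) tent M j * tent M j.+1 = M%:R.
Proof.
have shift : \sum_(j < M.*2) tent M j.+1 ^+ 2 = tent_energy M.
  have -> : tent_energy M = \sum_(j < M.*2.+1) tent M j ^+ 2.
    by rewrite big_ord_recr/= {2}/tent subnn minn0 expr0n addr0.
  by rewrite big_ord_recl/= {2}/tent min0n expr0n add0r.
have inc : \sum_(j < M.*2) (tent M j.+1 - tent M j) ^+ 2 = 2 * M%:R.
  rewrite -natrM mul2n -[in RHS](card_ord M.*2) -sumr_const.
  apply: eq_bigr => -[j /= jM] _; rewrite /tent.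
  have [jl|jl] := ltnP j M.
    have -> : minn j.+1 (M.*2 - j.+1) = j.+1 by lia.
    have -> : minn j (M.*2 - j) = j by lia.
    by rewrite -natr1 addrAC subrr add0r expr1n.
  have -> : minn j.+1 (M.*2 - j.+1) = (M.*2 - j.+1)%N by lia.
  have -> : minn j (M.*2 - j) = (M.*2 - j.+1).+1 by lia.
  by rewrite -[_.+1%:R]natr1 opprD addrA subrr add0r sqrrN expr1n.
have : \sum_(j < M.*2) (tent M j.+1 - tent M j) ^+ 2 =
   2 * (tent_energy M - \sum_(j < M.*2) tent M j * tent M j.+1).
  rewrite mulrBr [2 * tent_energy M]mulr_natl mulr2n -{1}shift /tent_energy.
  rewrite mulr_sumr -big_split -sumrB/=; apply: eq_bigr => j _; ring.
by rewrite inc => /mulfI -> //; rewrite pnatr_eq0.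
Qed.

Lemma kern_ge0 M t : 0 <= kern M t.
Proof.
rewrite mulr_ge0 ?sqr_ge0// invr_ge0 sumr_ge0// => j _; exact: sqr_ge0.
Qed.

Lemma conjc_realM (a : R) (z : R[i]) : conjc (a%:C * z) = a%:C * conjc z.
Proof. by case: z => b c; simpc. Qed.

Lemma conjc_sum (J : Type) (r : seq J) (f : J -> R[i]) :
  conjc (\sum_(j <- r) f j) = \sum_(j <- r) conjc (f j).
Proof. exact: rmorph_sum. Qed.

Lemma kern_sum M t : (kern M t)%:C = ((tent_energy M)^-1)%:C *
  \sum_(j < M.*2) \sum_(l < M.*2) (tent M j * tent M l)%:C *
    cis (2 * pi * ((j%:Z - l%:Z)%:~R * t)).
Proof.
rewrite rmorphM/=; congr (_ * _).
rewrite rmorphXn/= -nmE sqr_normc /dirichlet conjc_sum mulr_suml.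
apply: eq_bigr => j _; rewrite mulr_sumr; apply: eq_bigr => l _.
rewrite conjc_realM -cisN mulrACA -cisD -rmorphM/=.
congr (_ * cis _).
by rewrite intrB -!pmulrn; ring.
Qed.

Lemma kernN M t : kern M (- t) = kern M t.
Proof.
rewrite /kern /dirichlet -[in RHS]nm_conj conjc_sum; congr (_ * nm _ ^+ 2).
by apply: eq_bigr => j _; rewrite conjc_realM -cisN !mulrN.
Qed.

Section Coordinate.
Context {n : nat}.
Implicit Types (x y : 'rV[R]_n) (i : 'I_n) (q : int).

Definition kvec i q : 'rV[int]_n := \row_j (if j == i then q else 0).

Lemma mode_kvec i q y : e (kvec i q) y = cis (2 * pi * (q%:~R * y ord0 i)).
Proof.
rewrite modeE; congr cis; congr (_ * _); rewrite /dot (bigD1 i)//= !mxE eqxx.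
by rewrite big1 ?addr0// => j /negbTE ji; rewrite !mxE ji mul0r.
Qed.

Lemma kvec_eq0 i q : (kvec i q == 0) = (q == 0).
Proof.
apply/eqP/eqP => [/rowP/(_ i)|->]; first by rewrite !mxE eqxx.
by apply/rowP => j; rewrite !mxE; case: (j == i).
Qed.

Lemma kvecD i q r : kvec i (q + r) = kvec i q + kvec i r.
Proof. by apply/rowP => j; rewrite !mxE; case: (j == i); rewrite ?addr0. Qed.

Lemma kern_modes M i y : (kern M (y ord0 i))%:C = ((tent_energy M)^-1)%:C *
  \sum_(j < M.*2) \sum_(l < M.*2) (tent M j * tent M l)%:C *
    e (kvec i (j%:Z - l%:Z)) y.
Proof.
rewrite kern_sum; congr (_ * _); apply: eq_bigr => j _; apply: eq_bigr => l _.
by rewrite mode_kvec.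
Qed.

Lemma is_trig_kern M i : is_trig (fun y => (kern M (y ord0 i))%:C).
Proof.
under eq_fun do rewrite kern_modes.
apply: is_trigM; first exact: is_trig_cst.
apply: is_trig_sum => j; apply: is_trig_sum => l.
by apply: is_trigM; [exact: is_trig_cst|exact: is_trig_mode].
Qed.

Lemma cc_is_trig (f : 'rV[R]_n -> R[i]) : is_trig f -> ccontinuous f.
Proof. by move=> [s Hs]; rewrite (funext Hs); exact: cc_trig. Qed.

Lemma cont_kern_coord M i : continuous (fun y : 'rV[R]_n => kern M (y ord0 i)).
Proof. by have [] := cc_is_trig (@is_trig_kern M i). Qed.

Lemma cI_mode_kern M i q :
  cI (fun y => e (kvec i q) y * (kern M (y ord0 i))%:C) =
  ((tent_energy M)^-1 * \sum_(j < M.*2) \sum_(l < M.*2)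
     tent M j * tent M l * (q + (j%:Z - l%:Z) == 0)%:R)%:C.
Proof.
pose g (j l : 'I_M.*2) y : R[i] := (tent M j * tent M l)%:C *
  e (kvec i (q + (j%:Z - l%:Z))) y.
have cg j l : ccontinuous (g j l).
  by apply: ccM; [exact: cc_cst|exact: cc_mode].
have cG j := cc_cI_sum (index_enum 'I_M.*2) (cg j).
have [cGG IGG] := cc_cI_sum (index_enum 'I_M.*2) (fun j => (cG j).1).
have -> : (fun y => e (kvec i q) y * (kern M (y ord0 i))%:C) =
   (fun y => ((tent_energy M)^-1)%:C * \sum_(j < M.*2) \sum_(l < M.*2) g j l y).
  apply/funext => y; rewrite kern_modes mulrCA; congr (_ * _).
  rewrite mulr_sumr; apply: eq_bigr => j _; rewrite mulr_sumr.
  by apply: eq_bigr => l _; rewrite mulrCA -modeD -kvecD.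
rewrite cIZ// IGG rmorphM/=; congr (_ * _).
rewrite rmorph_sum/=; apply: eq_bigr => j _; rewrite (cG j).2 rmorph_sum/=.
apply: eq_bigr => l _; rewrite cIZ; last exact: cc_mode.
by rewrite cI_mode kvec_eq0 [in RHS]rmorphM; case: (_ == 0 :> int).
Qed.

Lemma kern_coord_mean M i : (0 < M)%N -> I (fun y : 'rV[R]_n => kern M (y ord0 i)) = 1.
Proof.
move=> M0; have : cI (fun y => e (kvec i 0) y * (kern M (y ord0 i))%:C) = 1.
  rewrite cI_mode_kern; apply: (congr1 (fun z : R => z%:C) (y := 1)).
  have -> : \sum_(j < M.*2) \sum_(l < M.*2)
     tent M j * tent M l * (0 + (j%:Z - l%:Z) == 0 :> int)%:R = tent_energy M.
    apply: eq_bigr => j _; rewrite (bigD1 j)//= subrr addr0 eqxx mulr1.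
    rewrite big1 ?addr0 ?expr2// => l lj.
    by rewrite add0r subr_eq0 eqz_nat eq_sym -val_eqE/= in lj *; rewrite (negbTE lj) mulr0.
  by rewrite mulVf// gt_eqF// tent_energy_gt0.
rewrite /torus_integral => -[+ _].
have -> // : (fun y => Re (e (kvec i 0) y * (kern M (y ord0 i))%:C)) =
   (fun y => kern M (y ord0 i)).
by apply/funext => y; rewrite (eqP (_ : kvec i 0 == 0)) ?kvec_eq0// mode0 mul1r.
Qed.

(** The moment is [1 - K^(1)], and [K^(1)] is the autocorrelation of the tent at
    lag one, which [tent_increments] evaluates. *)
Lemma kern_coord_moment M i : (0 < M)%N ->
  I (fun y : 'rV[R]_n => wt (y ord0 i) * kern M (y ord0 i)) <= 3 / M%:R ^+ 2.
Proof.
move=> M0; have A0 := tent_energy_gt0 M0.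
have : cI (fun y => e (kvec i 1) y * (kern M (y ord0 i))%:C) =
   (1 - M%:R / tent_energy M)%:C.
  rewrite cI_mode_kern; apply: (congr1 (fun z : R => z%:C)).
  have -> : \sum_(j < M.*2) \sum_(l < M.*2)
     tent M j * tent M l * (1 + (j%:Z - l%:Z) == 0 :> int)%:R =
     \sum_(j < M.*2) tent M j * tent M j.+1.
    apply: eq_bigr => j _.
    have E (l : 'I_M.*2) : (1 + (j%:Z - l%:Z) == 0 :> int) = (j.+1 == l :> nat).
      by rewrite addrA subr_eq0 -PoszD eqz_nat add1n.
    have [jM|jM] := ltnP j.+1 M.*2.
      rewrite (bigD1 (Ordinal jM))// E eqxx mulr1.
      rewrite big1 => [|l lj]; first by rewrite /= addr0.
      by rewrite E; case: eqVneq => [jl|_]; [move: lj; rewrite -val_eqE/= jl eqxx|rewrite mulr0].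
    have -> : tent M j.+1 = 0 by rewrite /tent (_ : minn _ _ = 0%N)//; lia.
    rewrite mulr0 big1// => l _; rewrite E.
    by case: eqVneq => [jl|]; rewrite ?mulr0//; move: (ltn_ord l); rewrite -jl ltnNge jM.
  have -> : \sum_(j < M.*2) tent M j * tent M j.+1 = tent_energy M - M%:R.
    by rewrite -tent_increments subKr.
  by field; rewrite gt_eqF.
rewrite /torus_integral => -[+ _].
have -> : (fun y => Re (e (kvec i 1) y * (kern M (y ord0 i))%:C)) =
   (fun y => (-1) * (wt (y ord0 i) * kern M (y ord0 i)) + kern M (y ord0 i)).
  apply/funext => y; rewrite mode_kvec mul1r cReM /= mulr0 subr0 /wt; ring.
have cK := @cont_kern_coord M i.
rewrite tI_lin//; last first.
  apply: contM => //; apply: cont_comp; last exact: cont_wt.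
  exact: coord_continuous.
rewrite kern_coord_mean// => H.
have -> : I (fun y : 'rV[R]_n => wt (y ord0 i) * kern M (y ord0 i)) = M%:R / tent_energy M.
  lra.
rewrite ler_pdivrMr//; apply: le_trans (ler_wpM2l _ (tent_energy_ge M0)); last first.
  by rewrite divr_ge0// exprn_ge0.
have Mn0 : M%:R != 0 :> R by rewrite pnatr_eq0 -lt0n.
by rewrite le_eqVlt; apply/orP; left; apply/eqP; field.
Qed.

(** The indices of the tent differ by less than [2M]. *)
Lemma cI_mode_kern_high M i q : (M.*2 <= `|q|)%N ->
  cI (fun y => e (kvec i q) y * (kern M (y ord0 i))%:C) = 0.
Proof.
move=> qM; rewrite cI_mode_kern big1 ?mulr0// => j _; rewrite big1// => l _.
case: eqP; rewrite ?mulr0// => /eqP.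
have := ltn_ord j; have := ltn_ord l; move: qM => /=; lia.
Qed.

End Coordinate.
End Kernel.

(** * Summation of Fourier series and uniqueness *)

Section Summability.
Context {R : realType}.
Local Notation I := torus_Rintegral.
Local Notation mu := (@lebesgue_measure R).
Local Notation I1 g := (\int[mu]_(t in `[0%R, 1%R]) g t)%R.

Lemma cont_coord n (g : R -> R) (i : 'I_n) : continuous g ->
  continuous (fun y : 'rV[R]_n => g (y ord0 i)).
Proof.
move=> cg x.
exact: (continuous_comp (@coord_continuous R 1 n ord0 i x) (cg _)).
Qed.

Lemma cont_prod n (g : 'I_n -> R -> R) : (forall i, continuous (g i)) ->
  continuous (fun y : 'rV[R]_n => \prod_i g i (y ord0 i)).
Proof.
move=> cg; elim: (index_enum _) => [|i r IH].
  by under eq_fun do rewrite big_nil; exact: cont_cst.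
under eq_fun do rewrite big_cons.
exact: (contM (cont_coord (cg i)) IH).
Qed.

Lemma tI_prod n (g : 'I_n -> R -> R) : (forall i, continuous (g i)) ->
  I (fun y : 'rV[R]_n => \prod_i g i (y ord0 i)) = \prod_i I1 (g i).
Proof.
elim: n g => [g _|m IH g cg]; first by rewrite /= !big_ord0.
rewrite big_ord_recl /=.
have E t : I (fun y : 'rV[R]_m => \prod_(i < m.+1)
    g i ((row_mx (t%:M : 'rV_1) y : 'rV_m.+1) ord0 i)) =
    \prod_(i < m) I1 (g (lift ord0 i)) * g ord0 t + 0.
  rewrite -(IH (fun i => g (lift ord0 i))) => [|i]; last exact: cg.
  have c0 : continuous (fun y : 'rV[R]_m => \prod_(i < m) g (lift ord0 i) (y ord0 i)).
    by apply: (cont_prod (g := fun i => g (lift ord0 i))) => i; exact: cg.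
  rewrite mulrC -[X in _ + X](@tI_cst R m) -tI_lin//; last exact: cont_cst.
  congr I; apply/funext => y; rewrite addr0 big_ord_recl; congr (g _ _ * _).
    by rewrite mxE; case: splitP => j; rewrite ?mxE ?(ord1 j) ?mulr1n.
  apply: eq_bigr => i _; congr (g _ _); rewrite mxE; case: splitP => j /=.
    by rewrite (ord1 j).
  by rewrite /bump/= !add1n => -[/val_inj ->].
have u0 : u01 (g ord0).
  have cc : continuous (fun y : 'rV[R]_1 => g ord0 (y ord0 ord0)).
    exact: cont_coord.
  move=> eps /(continuous_ucube cc)[d d0 Hd]; exists d => // s t s01 t01 st.
  have := Hd (const_mx s) (const_mx t).
  rewrite !mxE; apply; [by move=> i; rewrite mxE..|].
  by move=> i; rewrite !mxE.
under eq_Rintegral do rewrite E.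
rewrite I1_lin//; last exact: u01_cst.
by rewrite I1_cst addr0 mulrC.
Qed.

Lemma I1_torus (g : R -> R) : I1 g = I (fun y : 'rV[R]_1 => g (y ord0 ord0)).
Proof.
rewrite /=; apply: eq_Rintegral => t _; congr g.
by rewrite mxE; case: splitP => j; rewrite ?(ord1 j) ?mxE ?mulr1n.
Qed.

Lemma cont_kern M : continuous (@kern R M).
Proof.
have cm : continuous (fun t : R => const_mx t : 'rV[R]_1).
  move=> t; apply/(@cvgrPdist_le _ _ _ (nbhs t) _) => eps e0.
  have /cvgrPdist_le /(_ _ e0) := @cvg_id _ (nbhs t).
  apply: filterS => s st; apply/(rV_normP _ (ltW e0)) => i.
  by rewrite subrVE !mxE.
have := @cont_comp _ _ _ _ _ cm (@cont_kern_coord R 1 M ord0).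
by under [X in continuous X -> _]eq_fun do rewrite mxE.
Qed.

Section Fixed.
Context {n : nat}.
Implicit Types (f g : 'rV[R]_n -> R[i]) (x y : 'rV[R]_n).

Definition pkern M y : R := \prod_i kern M (y ord0 i).

Lemma pkern_ge0 M y : 0 <= pkern M y.
Proof. by apply: prodr_ge0 => i _; exact: kern_ge0. Qed.

Lemma pkernN M y : pkern M (- y) = pkern M y.
Proof. by apply: eq_bigr => i _; rewrite mxE kernN. Qed.

Lemma cont_pkern M : continuous (pkern M).
Proof. by apply: (cont_prod (g := fun=> kern M)) => i; exact: cont_kern. Qed.

Lemma is_trig_pkern M : is_trig (fun y => (pkern M y)%:C).
Proof.
under eq_fun do rewrite rmorph_prod; apply: is_trig_prod => i.
exact: is_trig_kern.
Qed.

Lemma pkern_mean M : (0 < M)%N -> I (pkern M) = 1.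
Proof.
move=> M0; rewrite (tI_prod (g := fun=> kern M)); last by move=> i; exact: cont_kern.
by rewrite big1// => i _; rewrite I1_torus kern_coord_mean.
Qed.

Lemma cont_wt_coord (i : 'I_n) : continuous (fun y : 'rV[R]_n => wt (y ord0 i)).
Proof. exact: cont_coord cont_wt. Qed.

Lemma pkern_moment M i : (0 < M)%N ->
  I (fun y => wt (y ord0 i) * pkern M y) <= 3 / M%:R ^+ 2.
Proof.
move=> M0; pose g (j : 'I_n) t : R := (if j == i then wt t else 1) * kern M t.
have cg j : continuous (g j).
  apply: contM; last exact: cont_kern.
  by case: (j == i); [exact: cont_wt|exact: cont_cst].
have -> : (fun y => wt (y ord0 i) * pkern M y) = (fun y => \prod_j g j (y ord0 j)).
  apply/funext => y; rewrite /g big_split/=; congr (_ * _).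
  by rewrite (bigD1 i)//= eqxx big1 ?mulr1// => j /negbTE ->.
rewrite tI_prod// (bigD1 i)//= big1 => [|j /negbTE ji].
  rewrite mulr1 I1_torus /g eqxx.
  exact: (@kern_coord_moment R 1 M ord0).
rewrite I1_torus /g ji; under eq_fun do rewrite mul1r.
exact: kern_coord_mean.
Qed.

Definition multiplier (s : seq (R[i] * 'rV[int]_n)) f :=
  trig [seq (p.1 * fcoef f p.2, p.2) | p <- s].

Lemma multiplierE s f x : ccontinuous f -> Zn_periodic f ->
  multiplier s f x = cI (fun y => f (y + x) * trig s (- y)).
Proof.
move=> cf pf.
pose G p y := p.1 * e p.2 x * (f y * e (- p.2) y).
have cG p : ccontinuous (G p).
  by apply: ccM; [exact: cc_cst|apply: ccM => //; exact: cc_mode].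
have [cS IS] := cc_cI_sum s cG.
have ES : (fun y => \sum_(p <- s) G p y) = (fun y => f y * trig s (x - y)).
  apply/funext => y; rewrite /trig mulr_sumr; apply: eq_bigr => p _.
  rewrite /G mode_shift mode_opp modeN; ring.
have pS : Zn_periodic (fun y => f y * trig s (x - y)).
  move=> y k; rewrite pf opprD addrA -vecN; congr (_ * _).
  exact: trig_periodic.
rewrite ES in cS IS.
have := cI_shift x cS pS; under eq_fun do rewrite opprD addrCA subrr addr0.
move=> ->; rewrite IS /multiplier /trig big_map; apply: eq_bigr => p _ /=.
rewrite /G cIZ; last by apply: ccM => //; exact: cc_mode.
by rewrite -/(fcoef f p.2) mulrAC.
Qed.

(** Near the lattice uniform continuity applies; elsewhere some coordinate of
    [y] is far from the integers and its weight [wt] is bounded below. *)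
Lemma modulus_by_weights f eps : ccontinuous f -> Zn_periodic f -> 0 < eps ->
  exists2 C, 0 < C & forall x y, in_cube y ->
    nm (f (y + x) - f x) <= eps + C * \sum_i wt (y ord0 i).
Proof.
move=> cf pf e0; have [d d0 Hd] := zper_cuniform cf pf e0.
have [B B0 HB] := zper_cbounded cf pf.
have [c c0 Hc] := @sqr_le_wt R.
have cd0 : 0 < c * d ^+ 2 by rewrite mulr_gt0// exprn_gt0.
exists (2 * B / (c * d ^+ 2)); first by rewrite divr_gt0// mulr_gt0.
move=> x y yc; pose k : 'rV[int]_n := \row_i (if y ord0 i <= 1 / 2 then 0 else -1).
have S0 (P : pred 'I_n) : 0 <= \sum_(i | P i) wt (y ord0 i).
  by apply: sumr_ge0 => i _; exact: wt_ge0.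
have [/forallP H|] := boolP [forall i, `|(y + vec_of_int k) ord0 i| <= d].
  apply: (@le_trans _ _ eps).
    rewrite -(pf _ k); apply: Hd; rewrite addrAC addrK.
    exact/(rV_normP _ (ltW d0)).
  by rewrite lerDl mulr_ge0// divr_ge0 ?mulr_ge0// ltW.
rewrite negb_forall; case/existsP => i; rewrite -ltNge !mxE => di.
apply: (@le_trans _ _ (2 * B)).
  apply: le_trans (le_normcD _ _) _; rewrite normcN mulr_natl mulr2n.
  by rewrite lerD.
rewrite ler_wpDl ?(ltW e0)// mulrAC ler_pdivlMr//.
rewrite ler_pM2l ?mulr_gt0// (bigD1 i)//= ler_wpDr//.
have /andP[y0 y1] := yc i.
move: di; case: ifPn => [yh|]; first rewrite addr0 ger0_norm//.
  move=> di; apply: le_trans (Hc (y ord0 i) _); last by rewrite y0.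
  by rewrite ler_pM2l// lerXn2r// ?nnegrE// ltW.
rewrite -ltNge => yh; rewrite ler0_norm; last lra.
rewrite opprD opprK addrC => di; rewrite -wt_sym.
apply: le_trans (Hc (1 - y ord0 i) _); last by apply/andP; split; lra.
by rewrite ler_pM2l// lerXn2r// ?nnegrE//; lra.
Qed.

Definition kern_seq M := projT1 (cid (is_trig_pkern M)).

Lemma trig_kern_seq M x : trig (kern_seq M) x = (pkern M x)%:C.
Proof. by rewrite /kern_seq; case: cid => s /= ->. Qed.

(** The weights [wt] have moments [O(M^-2)] against the kernel, so that the bound of
    [modulus_by_weights] makes it an approximate identity. *)
Lemma kern_seq_cvg f eps : ccontinuous f -> Zn_periodic f -> 0 < eps ->
  exists M0, forall M, (M0 <= M)%N ->
    forall x, nm (multiplier (kern_seq M) f x - f x) <= eps.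
Proof.
move=> cf pf e0; have e2 : 0 < eps / 2 by rewrite divr_gt0.
have [C C0 HC] := modulus_by_weights cf pf e2.
pose M1 := (Num.trunc (C * (n%:R * 3) / (eps / 2))).+1.
exists M1 => M M1M x; have M0 : (0 < M)%N by exact: leq_ltn_trans M1M.
have MM : C * (n%:R * 3) / (eps / 2) <= M%:R ^+ 2.
  apply: (@le_trans _ _ M1%:R).
    exact/ltW/truncnS_gt.
  apply: (@le_trans _ _ M%:R); first by rewrite ler_nat.
  by rewrite expr2 ler_peMl// ler1n.
have cfx : ccontinuous (fun y => f (y + x)) by exact: cc_shift.
have cK : ccontinuous (fun y : 'rV[R]_n => (pkern M y)%:C).
  exact/cc_real/cont_pkern.
rewrite multiplierE//.
have -> : (fun y => f (y + x) * trig (kern_seq M) (- y)) =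
    (fun y => f (y + x) * (pkern M y)%:C).
  by apply/funext => y; rewrite trig_kern_seq pkernN.
have -> : f x = cI (fun y : 'rV[R]_n => f x * (pkern M y)%:C).
  rewrite cIZ// (_ : cI _ = 1) ?mulr1// /torus_integral/=.
  by rewrite pkern_mean// tI_cst.
rewrite -cIB; [|exact: ccM|by apply: ccM => //; exact: cc_cst].
apply: le_trans (nm_cI _) _.
  by apply: ccB; apply: ccM => //; exact: cc_cst.
pose S y := \sum_i 1 * (wt (y ord0 i) * pkern M y).
have cwk i : continuous (fun y : 'rV[R]_n => wt (y ord0 i) * pkern M y).
  exact: (contM (@cont_wt_coord i) (@cont_pkern M)).
have [cS IS] := @tI_sum R n _ (index_enum 'I_n) (fun=> 1) _ cwk.
have ck := @cont_pkern M.
have cR : continuous (fun y => C * S y + (eps / 2) * pkern M y).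
  by apply: cont_lin => //; apply: contM => //; exact: cont_cst.
apply: (@le_trans _ _ (I (fun y => C * S y + (eps / 2) * pkern M y))).
  apply: tI_le => // [|y yc].
    by apply: cc_nm; apply: ccB; apply: ccM => //; exact: cc_cst.
  rewrite -mulrBl Normc.normcM nm_real ger0_norm ?pkern_ge0//.
  apply: le_trans (ler_wpM2r (pkern_ge0 M y) (HC x y yc)) _.
  rewrite le_eqVlt; apply/orP; left; apply/eqP; rewrite mulrDl addrC.
  congr (_ + _); rewrite /S -mulrA; congr (_ * _); rewrite mulr_suml.
  by apply: eq_bigr => i _; rewrite mul1r.
have cek : continuous (fun y : 'rV[R]_n => (eps / 2) * pkern M y).
  by apply: contM => //; exact: cont_cst.
rewrite tI_lin// IS.
rewrite tIZ// pkern_mean// mulr1.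
rewrite [leRHS]splitr lerD2r.
apply: (@le_trans _ _ (C * (n%:R * (3 / M%:R ^+ 2)))).
  rewrite ler_pM2l//.
  have -> : n%:R * (3 / M%:R ^+ 2) = \sum_(i < n) (3 / M%:R ^+ 2 : R).
    by rewrite sumr_const card_ord mulr_natl.
  by apply: ler_sum => i _; rewrite mul1r pkern_moment.
have M20 : 0 < M%:R ^+ 2 :> R by rewrite exprn_gt0// ltr0n.
have -> : C * (n%:R * (3 / M%:R ^+ 2)) = C * (n%:R * 3) / M%:R ^+ 2.
  by rewrite !mulrA.
by rewrite ler_pdivrMr// [leRHS]mulrC -ler_pdivrMr.
Qed.

(** Both functions are limits of the same kernel sums, which only see the Fourier
    coefficients. *)
Lemma fourier_uniqueness f g : ccontinuous f -> Zn_periodic f ->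
  ccontinuous g -> Zn_periodic g -> (forall k, fcoef f k = fcoef g k) -> f = g.
Proof.
move=> cf pf cg pg fg; apply/funext => x; apply/eqP; rewrite -subr_eq0.
apply/eqP/Normc.eq0_normc/eqP; rewrite eq_le nm_ge0 andbT.
apply/ler_addgt0Pr => eps e0; rewrite add0r.
have e2 : 0 < eps / 2 by rewrite divr_gt0.
have [M1 H1] := kern_seq_cvg cf pf e2.
have [M2 H2] := kern_seq_cvg cg pg e2.
have := H1 _ (leq_maxl M1 M2) x; have := H2 _ (leq_maxr M1 M2) x.
have -> : multiplier (kern_seq (maxn M1 M2)) g = multiplier (kern_seq (maxn M1 M2)) f.
  by rewrite /multiplier; congr trig; apply/eq_map => p; rewrite fg.
set s := multiplier _ _ _ => hg hf.
by rewrite (le_trans (nm_distD _ _ s))// [eps]splitr lerD// nmB.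
Qed.

End Fixed.
End Summability.

(** * Distributions and their continuous representatives *)

Section Distributions.
Context {R : realType} {n : nat}.
Implicit Types (f g phi psi : 'rV[R]_n -> R[i]) (x y : 'rV[R]_n).
Implicit Types (eps : R) (u : ('rV[R]_n -> R[i]) -> R[i]) (s : seq (R[i] * 'rV[int]_n)).

Lemma test_is_trig phi : is_trig phi -> test_function phi.
Proof. by move=> [s /funext ->]; exact: test_function_trig. Qed.

Lemma test_mode k : test_function (e k : 'rV[R]_n -> R[i]).
Proof. exact/test_is_trig/is_trig_mode. Qed.

Lemma test_cc phi L : test_function phi -> ccontinuous (cpartials L phi).
Proof. by move=> [_ H]; apply: (H (size L)).1. Qed.

Lemma test_cderivable phi L i : test_function phi -> cderivable i (cpartials L phi).
Proof. by move=> [_ H]; apply: (H (size L).+1).2. Qed.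

Lemma test_periodic phi L : test_function phi -> Zn_periodic (cpartials L phi).
Proof.
move=> [pphi _]; elim: L => //= i L IH; exact: cpartial_periodic.
Qed.

Lemma cpartials_lin a phi psi L : test_function phi -> test_function psi ->
  cpartials L (fun x => a * phi x + psi x) =
  (fun x => a * cpartials L phi x + cpartials L psi x).
Proof.
move=> tphi tpsi; elim: L => //= i L ->.
exact: (cderivable_lin a (test_cderivable L i tphi) (test_cderivable L i tpsi)).2.
Qed.

Lemma test_lin a phi psi : test_function phi -> test_function psi ->
  test_function (fun x => a * phi x + psi x).
Proof.
move=> tphi tpsi; split.
  by move=> x k; rewrite tphi.1 tpsi.1.
move=> m; split=> [l _|l i _]; rewrite cpartials_lin//.
  by apply: cc_lin; exact: test_cc.
exact: (cderivable_lin a (test_cderivable _ i tphi) (test_cderivable _ i tpsi)).1.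
Qed.

Lemma cpartials_multiplier s phi L : test_function phi ->
  cpartials L (multiplier s phi) = multiplier s (cpartials L phi).
Proof.
move=> tphi; elim: L => //= i L ->.
rewrite /multiplier (cderivable_trig i _).2; congr trig.
rewrite /dseq -map_comp; apply: eq_map => p /=; congr (_, _).
rewrite fcoef_partial; first by rewrite -mulrA [_ * dcoef _ _]mulrC.
- exact: test_cc.
- exact: test_periodic.
- exact: test_cderivable.
- by have := test_cc (i :: L) tphi.
Qed.

(** The kernel sums of [phi] commute with derivatives, so they converge together
    with all derivatives up to a given order. *)
Lemma trig_dense m eps phi : test_function phi -> 0 < eps ->
  exists s, (Ck_norm m (fun x => ((-1) * trig s x + phi x)%R) <= eps%:E)%E /\
    forall x, nm (phi x - trig s x) <= eps.
Proof.
move=> tphi e0; pose T := {ffun 'I_n -> 'I_m.+1}.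
pose L (b : T) := flatten [seq nseq (b i) i | i <- enum 'I_n].
pose eps' := eps / #|T|.+1%:R.
have e'0 : 0 < eps' by rewrite divr_gt0.
have e'e : eps' <= eps by rewrite ler_pdivrMr// ler_peMr ?ler1n// ltW.
have H (l : seq 'I_n) := kern_seq_cvg (test_cc l tphi) (test_periodic l tphi) e'0.
pose N l := projT1 (cid (H l)).
have HN l := projT2 (cid (H l)).
pose M := maxn (N [::]) (\max_(b : T) N (L b)).
pose s := @kern_seq R n M.
exists [seq (p.1 * fcoef phi p.2, p.2) | p <- s].
rewrite -/(multiplier s phi); split; last first.
  by move=> x; rewrite nmB; apply: le_trans (HN [::] M _ x) _; rewrite ?leq_maxl.
apply: (@le_trans _ _ (\sum_(b : T) eps'%:E)%E); last first.
  rewrite sumEFin lee_fin sumr_const -mulr_natr /eps' mulrAC ler_pdivrMr//.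
  by rewrite ler_pM2l// ler_nat.
rewrite /Ck_norm big_mkcond/=; apply: lee_sum => b _.
case: ifP => _; last by rewrite lee_fin ltW.
apply: ge_ereal_sup => _ [x _ <-]; rewrite lee_fin /multi_derive.
rewrite cpartials_lin//; last exact: test_function_trig.
rewrite -/(multiplier s phi) cpartials_multiplier// mulN1r addrC nmB.
apply: HN; apply: leq_trans (leq_maxr _ _).
exact: (leq_bigmax (F := fun b => N (L b)) b).
Qed.

Lemma distribution_trig u s : torus_distribution u ->
  u (trig s) = \sum_(p <- s) p.1 * u (e p.2).
Proof.
move=> [ulin _].
have t0 : test_function (fun _ : 'rV[R]_n => 0 : R[i]).
  exact/test_is_trig/is_trig_cst.
have u0 : u (fun=> 0) = 0.
  have := ulin 1 _ _ t0 t0; rewrite (_ : (fun x => 1 * 0 + 0) = (fun=> 0)).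
    by move=> /eqP; rewrite mul1r -subr_eq0 opprD addrA subrr add0r oppr_eq0 => /eqP.
  by apply/funext => x; rewrite mul1r addr0.
elim: s => [|p s IH].
  by rewrite big_nil -[RHS]u0; congr u; apply/funext => x; rewrite /trig big_nil.
have tm := test_mode p.2.
rewrite big_cons -IH -ulin//; last exact: test_function_trig.
by congr u; apply/funext => x; rewrite /trig big_cons.
Qed.

Lemma representative_fcoef u f k : continuous_representative u f ->
  fcoef f k = fourier_coef u k.
Proof.
move=> [_ _ H]; by rewrite /fourier_coef H//; exact: test_mode.
Qed.

(** Both functionals agree on trigonometric polynomials, which are dense for the
    norm in which [u] is continuous. *)
Lemma continuous_representativeP u f : torus_distribution u ->
  ccontinuous f -> Zn_periodic f -> (forall k, fcoef f k = fourier_coef u k) ->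
  continuous_representative u f.
Proof.
move=> du cf pf fu; split=> // phi tphi.
have [ulin [N [K uK]]] := du.
have [B B0 HB] := zper_cbounded cf pf.
apply/eqP; rewrite -subr_eq0; apply/eqP/Normc.eq0_normc/eqP.
rewrite eq_le nm_ge0 andbT; apply/ler_addgt0Pr => eps e0; rewrite add0r.
have KB : 0 < `|K| + B by rewrite ltr_wpDl.
have e1 : 0 < eps / (`|K| + B) by rewrite divr_gt0.
have [s [Hs1 Hs2]] := trig_dense N tphi e1.
have ts := test_function_trig s; have cs : ccontinuous (trig s) by exact: cc_trig.
have cphi : ccontinuous phi := test_cc [::] tphi.
have E : u (trig s) = cI (fun x => f x * trig s x).
  rewrite distribution_trig//.
  have cm (p : R[i] * 'rV[int]_n) : ccontinuous (fun x => f x * (p.1 * e p.2 x)).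
    by apply: ccM => //; apply: ccM; [exact: cc_cst|exact: cc_mode].
  have [_ IS] := cc_cI_sum s cm.
  have -> : (fun x => f x * trig s x) = (fun x => \sum_(p <- s) f x * (p.1 * e p.2 x)).
    by apply/funext => x; rewrite /trig mulr_sumr.
  rewrite IS; apply: eq_bigr => p _.
  have -> : u (e p.2) = fcoef f (- p.2) by rewrite fu /fourier_coef opprK.
  rewrite /fcoef opprK -cIZ; last by apply: ccM => //; exact: cc_mode.
  by congr cI; apply/funext => x; rewrite mulrCA.
have E1 : u phi - u (trig s) = u (fun x => (-1) * trig s x + phi x).
  by rewrite ulin// mulN1r addrC.
have E2 : cI (fun x => f x * phi x) - cI (fun x => f x * trig s x) =
    cI (fun x => f x * (phi x - trig s x)).
  rewrite -cIB; [|exact: ccM..].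
  by under [in RHS]eq_fun do rewrite mulrBr.
apply: le_trans (nm_distD _ _ (u (trig s))) _.
have -> : eps = `|K| * (eps / (`|K| + B)) + B * (eps / (`|K| + B)).
  by rewrite -mulrDl mulrCA divff ?mulr1// gt_eqF.
apply: lerD.
  rewrite E1 -lee_fin; apply: le_trans (uK _ _) _; first exact: test_lin.
  have C0 : (0 <= Ck_norm N (fun x => ((-1) * trig s x + phi x)%R))%E.
    apply: sume_ge0 => b _; apply: ereal_sup_ge.
    exists (nm (multi_derive b (fun x => (-1) * trig s x + phi x) 0))%:E.
      by exists 0.
    by rewrite lee_fin nm_ge0.
  apply: (@le_trans _ _ (`|K|%:E * Ck_norm N (fun x => ((-1) * trig s x + phi x)%R))%E).
    by apply: lee_wpmul2r => //; rewrite lee_fin ler_norm.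
  by rewrite EFinM; apply: lee_wpmul2l.
rewrite E nmB E2; apply: nm_cI_le => [|x _].
  by apply: ccM => //; exact: ccB.
by rewrite Normc.normcM ler_pM ?nm_ge0.
Qed.

End Distributions.

(** * A restricted Hausdorff-Young inequality *)

Section HausdorffYoung.
Context {R : realType}.
Local Notation I := torus_Rintegral.

Lemma conjc_mul (z w : R[i]) : conjc (z * w) = conjc z * conjc w.
Proof. exact: rmorphM. Qed.

Lemma cont_powR (T : topologicalType) (F : T -> R) p : 0 < p ->
  (forall x, 0 <= F x) -> continuous F -> continuous (fun x => F x `^ p).
Proof.
move=> p0 F0 cF x; have [Fx|Fx] := eqVneq (F x) 0.
  apply/(@cvgrPdist_le _ _ _ (nbhs x) _) => eps e0.
  have e1 : 0 < eps `^ p^-1 by rewrite powR_gt0.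
  have /cvgrPdist_le /(_ _ e1) := cF x.
  apply: filterS => y; rewrite Fx powR0 ?gt_eqF// !sub0r !normrN.
  rewrite !ger0_norm ?powR_ge0// => Fy.
  have := ge0_ler_powR (ltW p0) (F0 y) (powR_ge0 _ _) Fy.
  by rewrite -powRrM mulVf ?gt_eqF// powRr1// ltW.
have Fx0 : 0 < F x by rewrite lt_neqAle eq_sym Fx F0.
apply: (@continuous_comp _ _ _ F (fun a : R => a `^ p) x (cF x)).
apply: differentiable_continuous; apply/derivable1_diffP.
by apply: derivable_powR; rewrite in_itv/= Fx0.
Qed.

Section Fixed.
Context {n : nat}.
Implicit Types (g : 'rV[R]_n -> R[i]) (S : seq 'rV[int]_n).

Definition Lpn p g : R := (I (fun x => nm (g x) `^ p)) `^ p^-1.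

Lemma tI_ge0 (F : 'rV[R]_n -> R) : continuous F -> (forall x, 0 <= F x) -> 0 <= I F.
Proof.
move=> cF F0; rewrite -(@tI_cst R n 0); apply: tI_le => //; exact: cont_cst.
Qed.

Lemma Lpn_pow p g : 0 < p -> ccontinuous g ->
  Lpn p g `^ p = I (fun x => nm (g x) `^ p).
Proof.
move=> p0 cg; rewrite -powRrM mulVf ?gt_eqF// powRr1//; apply: tI_ge0.
  by apply: cont_powR => // [x|]; [exact: nm_ge0|exact: cc_nm].
by move=> x; exact: powR_ge0.
Qed.

Lemma parseval_phases S (th : 'rV[int]_n -> R[i]) : uniq S ->
  (forall k, nm (th k) = 1) ->
  I (fun x => nm (\sum_(k <- S) th k * e (- k) x) ^+ 2) = (size S)%:R.
Proof.
move=> uS th1.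
pose G k l x := th k * conjc (th l) * e (l - k) x : R[i].
have cG k l : ccontinuous (G k l).
  by apply: ccM; [exact: cc_cst|exact: cc_mode].
have cGl k := cc_cI_sum S (cG k).
have [cGG IGG] := cc_cI_sum S (fun k => (cGl k).1).
have E : (fun x => \sum_(k <- S) \sum_(l <- S) G k l x) =
    (fun x => (nm (\sum_(k <- S) th k * e (- k) x) ^+ 2)%:C).
  apply/funext => x; rewrite rmorphXn/= -nmE sqr_normc conjc_sum mulr_suml.
  apply: eq_bigr => k _; rewrite mulr_sumr; apply: eq_bigr => l _.
  rewrite conjc_mul -modeN opprK /G modeD; ring.
have IE : cI (fun x => \sum_(k <- S) \sum_(l <- S) G k l x) = (size S)%:R.
  rewrite IGG -sum1_size natr_sum; apply: eq_big_seq => k kS.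
  rewrite (cGl k).2 (bigD1_seq k)//= big1 => [|l lk].
    rewrite addr0 cIZ; last exact: cc_mode.
    rewrite cI_mode subrr eqxx mulr1.
    by apply/eqP; rewrite -sqr_normc nmE th1 expr1n.
  by rewrite cIZ ?cI_mode ?subr_eq0 ?(negbTE lk) ?mulr0//; exact: cc_mode.
move: IE; rewrite E -(rmorph_nat (real_complex R)) /torus_integral/=.
by move=> /eqP; rewrite eq_complex => /andP[/eqP].
Qed.

(** The sum is the pairing of [g] with [h = sum_k th_k e_(-k)] for suitable
    phases.  As [|h| <= N] and [int |h|^2 = N], where [N] is the number of
    frequencies, the conjugate norm of [h] is at most [N^(1/p)]; this is the
    Hausdorff-Young bound on a finite set of frequencies, without interpolation.
    Hoelder's inequality enters through Young's inequality, normalised by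
    [G + d] and [N^(1/p)]. *)
Lemma sum_fcoef_le g S p : ccontinuous g -> uniq S -> 1 < p -> p <= 2 ->
  \sum_(k <- S) nm (fcoef g k) <= (size S)%:R `^ p^-1 * Lpn p g.
Proof.
move=> cg uS p1 p2; have p0 : 0 < p by lra.
have [->|S0] := eqVneq S [::].
  by rewrite big_nil mulr_ge0// powR_ge0.
pose th k : R[i] := if fcoef g k == 0 then 1 else `|fcoef g k| / fcoef g k.
have th1 k : nm (th k) = 1.
  apply: (@complexI R); rewrite -nmE /th; case: ifPn => k0; first by rewrite normr1.
  by rewrite normrM normfV normr_id divff// normr_eq0.
have thE k : th k * fcoef g k = (nm (fcoef g k))%:C.
  rewrite /th; case: ifPn => [/eqP->|k0]; first by rewrite mulr0 nm0.
  by rewrite mulfVK// nmE.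
pose h x := \sum_(k <- S) th k * e (- k) x : R[i].
have ch : ccontinuous h.
  by apply: (cc_cI_sum _ _).1 => k; apply: ccM; [exact: cc_cst|exact: cc_mode].
pose N : R := (size S)%:R.
have N0 : 0 < N by rewrite ltr0n lt0n size_eq0.
have hN x : nm (h x) <= N.
  apply: le_trans (nm_sum _ _ _) _; rewrite /N -sum1_size natr_sum.
  by apply: ler_sum => k _; rewrite Normc.normcM th1 nm_mode mul1r.
have pair : (\sum_(k <- S) nm (fcoef g k))%:C = cI (fun x => g x * h x).
  have cm k : ccontinuous (fun x => th k * (g x * e (- k) x)).
    by apply: ccM; [exact: cc_cst|apply: ccM => //; exact: cc_mode].
  have [_ IS] := cc_cI_sum S cm.
  have -> : (fun x => g x * h x) = (fun x => \sum_(k <- S) th k * (g x * e (- k) x)).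
    by apply/funext => x; rewrite mulr_sumr; apply: eq_bigr => k _; rewrite mulrCA.
  rewrite IS rmorph_sum/=; apply: eq_bigr => k _; rewrite -thE cIZ//.
  by apply: ccM => //; exact: cc_mode.
have cgh : continuous (fun x => nm (g x) * nm (h x)).
  by apply: contM; exact: cc_nm.
apply: (@le_trans _ _ (I (fun x => nm (g x) * nm (h x)))).
  have sum0 : 0 <= \sum_(k <- S) nm (fcoef g k).
    by apply: sumr_ge0 => k _; exact: nm_ge0.
  rewrite -[leLHS](ger0_norm sum0) -nm_real pair.
  under [X in _ <= I X]eq_fun do rewrite -Normc.normcM.
  exact/nm_cI/ccM.
pose G := Lpn p g.
have G0 : 0 <= G by exact: powR_ge0.
apply/ler_addgt0Pr => eps e0.
pose H := N `^ p^-1; have H0 : 0 < H by rewrite powR_gt0.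
(* [d] keeps the denominator of Young's inequality positive when [g] vanishes. *)
suff key d : 0 < d -> I (fun x => nm (g x) * nm (h x)) <= (G + d) * H.
  apply: le_trans (key (eps / H) _) _; first by rewrite divr_gt0.
  by rewrite mulrDl mulfVK ?gt_eqF// mulrC.
move=> d0; have Gd : 0 < G + d by rewrite ltr_wpDl.
pose q := p / (p - 1).
have p10 : 0 < p - 1 by rewrite subr_gt0.
have q0 : 0 < q by rewrite divr_gt0.
have q2 : 2 <= q by rewrite ler_pdivlMr//; lra.
have pq : p^-1 + q^-1 = 1.
  by rewrite /q invf_div; field; rewrite gt_eqF.
have cgp : continuous (fun x => nm (g x) `^ p).
  by apply: cont_powR => // [x|]; [exact: nm_ge0|exact: cc_nm].
have ch2 : continuous (fun x => nm (h x) ^+ 2).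
  by under eq_fun do rewrite expr2; apply: contM; exact: cc_nm.
pose a := ((G + d) `^ p)^-1 / p; pose b := N^-1 / q.
have young x : ((G + d) * H)^-1 * (nm (g x) * nm (h x)) <=
    a * nm (g x) `^ p + b * nm (h x) ^+ 2.
  have -> : ((G + d) * H)^-1 * (nm (g x) * nm (h x)) =
      (nm (g x) / (G + d)) * (nm (h x) / H) by field; rewrite !gt_eqF.
  have g0 := nm_ge0 (g x); have h0 := nm_ge0 (h x).
  apply: le_trans (conjugate_powR _ _ p0 q0 pq) _; try by rewrite divr_ge0// ltW.
  rewrite lerD//.
    rewrite powRM ?invr_ge0 ?(ltW Gd)// -powR_inv1 ?(ltW Gd)// powRAC powR_inv1 ?powR_ge0//.
    by rewrite le_eqVlt /a; apply/orP; left; apply/eqP; ring.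
  rewrite /b mulrAC ler_pM2r ?invr_gt0//.
  rewrite powRM ?invr_ge0 ?(ltW H0)// -powR_inv1 ?(ltW H0)// powRAC powR_inv1 ?powR_ge0//.
  (* [|h|^q <= |h|^2 N^(q-2)] because [q >= 2]; the factor [|h|^2] is left for Parseval. *)
  have -> : H `^ q = N * N `^ (q - 2).
    rewrite /H -powRrM -{2}[N]powRr1 ?ltW// -powRD; last by rewrite (gt_eqF N0) implybT.
    congr (_ `^ _); rewrite /q; field; rewrite !gt_eqF//.
  have -> : nm (h x) `^ q = nm (h x) ^+ 2 * nm (h x) `^ (q - 2).
    have [->|hx0] := eqVneq (nm (h x)) 0.
      by rewrite powR0 ?gt_eqF// expr0n mul0r.
    by rewrite -powR_mulrn// -powRD ?hx0 ?implybT// addrC subrK.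
  rewrite ler_pdivrMr ?mulr_gt0 ?powR_gt0//.
  have -> : N^-1 * nm (h x) ^+ 2 * (N * N `^ (q - 2)) = nm (h x) ^+ 2 * N `^ (q - 2).
    by field; rewrite gt_eqF.
  rewrite ler_wpM2l ?sqr_ge0// ge0_ler_powR ?nnegrE ?(ltW N0)//; lra.
rewrite -[leLHS]mul1r -(mulfV (_ : (G + d) * H != 0)); last by rewrite gt_eqF// mulr_gt0.
rewrite -mulrA -[leRHS]mulr1 ler_pM2l ?mulr_gt0//.
rewrite -tIZ//.
have cR : continuous (fun x => a * nm (g x) `^ p + b * nm (h x) ^+ 2).
  by apply: cont_lin => //; apply: contM => //; exact: cont_cst.
apply: (@le_trans _ _ (I (fun x => a * nm (g x) `^ p + b * nm (h x) ^+ 2))).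
  by apply: tI_le => //; apply: contM => //; exact: cont_cst.
rewrite tI_lin//; last by apply: contM => //; exact: cont_cst.
rewrite tIZ// parseval_phases// -Lpn_pow// -/G -[leRHS]pq lerD//.
  rewrite /a mulrAC ler_piMl ?invr_ge0 ?(ltW p0)//.
  rewrite ler_pdivrMl ?powR_gt0// mulr1 ge0_ler_powR ?nnegrE ?(ltW p0)// ?(ltW Gd)//.
  by rewrite lerDl ltW.
have -> // : b * N = q^-1 by rewrite /b; field; rewrite !gt_eqF.
Qed.

End Fixed.
End HausdorffYoung.

(** * Small divisors and ergodic errors of trigonometric polynomials *)

Section SmallDivisors.
Context {R : realType}.

Lemma geometric_sum_le (r : R) L : 0 <= r -> r < 1 ->
  \sum_(l < L) r ^+ l <= (1 - r)^-1.
Proof.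
move=> r0 r1; have r10 : 0 < 1 - r by rewrite subr_gt0.
rewrite -[leRHS]mul1r ler_pdivlMr// mulrC -opprB mulNr -subrX1 opprB.
by rewrite gerBl exprn_ge0.
Qed.

(** Numbers that are [d]-separated have distinct integer parts in units of [d],
    so an interval of length [2 L d] contains at most [2 L] of them. *)
Lemma count_separated (K : eqType) (S : seq K) (v : K -> R) (d : R) L :
  0 < d -> uniq S ->
  {in S &, forall k l, k != l -> d <= `|v k - v l|} ->
  (forall k, k \in S -> `|v k| < L%:R * d) ->
  (size S <= L.*2)%N.
Proof.
move=> d0 uS sep vL.
pose fl k := Num.floor (v k / d).
have fl_inj : {in S &, injective fl}.
  move=> k l kS lS kl; apply/eqP; apply: contraT => /(sep _ _ kS lS).
  rewrite leNgt => /negP[]; rewrite -[ltRHS]mul1r -ltr_pdivrMr//.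
  rewrite -[d^-1]ger0_norm ?invr_ge0 ?(ltW d0)// -normrM mulrBl.
  have k1 := floor_le (v k / d); have k2 := floorD1_gt (v k / d).
  have l1 := floor_le (v l / d); have l2 := floorD1_gt (v l / d).
  move: k1 k2 l1 l2; rewrite -/(fl k) -/(fl l) kl !intrD1 => k1 k2 l1 l2.
  rewrite ltr_norml; apply/andP; split; lra.
pose T := [seq j%:Z - L%:Z | j <- iota 0 L.*2].
have -> : L.*2 = size T by rewrite size_map size_iota.
rewrite -(size_map fl); apply: uniq_leq_size; first by rewrite map_inj_in_uniq.
move=> _ /mapP[k kS ->].
have := vL k kS; rewrite -ltr_pdivrMr// -[d^-1]ger0_norm ?invr_ge0 ?(ltW d0)//.
rewrite -normrM ltr_norml => /andP[v1 v2].
have f1 : - L%:Z <= fl k by rewrite /fl floor_ge_int mulrNz ltW.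
have f2 : fl k < L%:Z by rewrite /fl floor_lt_int.
apply/mapP; exists (absz (fl k + L%:Z)); first by rewrite mem_iota; lia.
by rewrite gez0_abs; lia.
Qed.

(** The frequencies with [2^l d <= |v k| < 2^(l+1) d] are at most [2^(l+2)] in
    number, so they contribute at most a multiple of [2^(-l(1-1/p)) G / d]: the
    resulting geometric series converges precisely because [p > 1]. *)
Lemma divisor_sum_le p : 1 < p -> exists2 C : R, 0 < C &
  forall (K : eqType) (S : seq K) (v a : K -> R) (d G : R), 0 < d -> 0 <= G ->
  uniq S -> {in S &, forall k l, k != l -> d <= `|v k - v l|} ->
  (forall k, k \in S -> d <= `|v k|) ->
  (forall k, 0 <= a k) ->
  (forall S', uniq S' -> {subset S' <= S} ->
     \sum_(k <- S') a k <= (size S')%:R `^ p^-1 * G) ->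
  \sum_(k <- S) a k / `|v k| <= C / d * G.
Proof.
move=> p1; have p0 : 0 < p by apply: lt_trans p1.
pose r : R := 2 `^ (p^-1 - 1).
have r0 : 0 < r by rewrite powR_gt0.
have r1 : r < 1.
  have s0 : 0 < 1 - p^-1 by rewrite subr_gt0 invf_lt1.
  rewrite /r -opprB powRN invf_lt1 ?powR_gt0//.
  have := @gt0_ltr_powR R _ s0 1 2; rewrite powR1; apply; rewrite ?nnegrE//.
  by rewrite ltr1n.
exists (4 `^ p^-1 * (1 - r)^-1).
  by rewrite mulr_gt0 ?powR_gt0// invr_gt0 subr_gt0.
move=> K S v a d G d0 G0 uS sep vd a0 HS.
have key L : \sum_(k <- S | `|v k| < 2 ^+ L * d) a k / `|v k| <=
    \sum_(l < L) (4 `^ p^-1 / d * G) * r ^+ l.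
  elim: L => [|L IH].
    rewrite big_ord0 big_seq_cond big1// => k /andP[/vd kd].
    by rewrite expr0 mul1r ltNge kd.
  rewrite big_ord_recr/= (bigID (fun k => `|v k| < 2 ^+ L * d))/=; apply: lerD.
    apply: le_trans IH; rewrite le_eqVlt; apply/orP; left; apply/eqP.
    apply: eq_bigl => k; rewrite andbC andb_idr// => /lt_le_trans; apply.
    by rewrite ler_pM2r// exprS ler_peMl ?exprn_ge0// ler1n.
  pose P k := (`|v k| < 2 ^+ L.+1 * d) && ~~ (`|v k| < 2 ^+ L * d).
  rewrite -big_filter; set S' := [seq k <- S | _].
  have uS' : uniq S' by rewrite filter_uniq.
  have sS' : {subset S' <= S} by move=> k; rewrite mem_filter => /andP[].
  have L0 : 0 < 2 ^+ L * d by rewrite mulr_gt0// exprn_gt0.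
  have sz : (size S' <= (2 ^ L.+1).*2)%N.
    apply: (count_separated d0 uS' (v := v)).
      by move=> k l /sS' kS /sS' lS; exact: sep.
    by move=> k; rewrite mem_filter natrX => /andP[/andP[]].
  apply: (@le_trans _ _ ((2 ^+ L * d)^-1 * \sum_(k <- S') a k)).
    rewrite mulr_sumr; rewrite [leLHS]big_seq [leRHS]big_seq.
    apply: ler_sum => k; rewrite mem_filter => /andP[/andP[_ kL] kS].
    have kd : 0 < `|v k| := lt_le_trans d0 (vd k kS).
    have kL' : 2 ^+ L * d <= `|v k| by rewrite leNgt.
    by rewrite mulrC ler_wpM2r// lef_pV2 ?posrE.
  apply: (@le_trans _ _ ((2 ^+ L * d)^-1 * ((4 * 2 ^+ L) `^ p^-1 * G))).
    rewrite ler_pM2l ?invr_gt0//; apply: le_trans (HS _ uS' sS') _.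
    rewrite ler_wpM2r//; apply: ge0_ler_powR.
    - by rewrite invr_ge0 ltW.
    - by rewrite nnegrE.
    - by rewrite nnegrE mulr_ge0// exprn_ge0.
    rewrite -[4]/(2 * 2)%:R.
    apply: le_trans (_ : ((2 ^ L.+1).*2%:R : R) <= _); first by rewrite ler_nat.
    by rewrite -mul2n natrM natrX exprS mulrA -natrM.
  rewrite le_eqVlt; apply/orP; left; apply/eqP.
  have -> : (4 * 2 ^+ L) `^ p^-1 = 4 `^ p^-1 * (2 ^+ L * r ^+ L) :> R.
    rewrite powRM ?exprn_ge0//; congr (_ * _).
    rewrite -exprMn /r -[X in X * _](@powRr1 _ 2)// -powRD; last by rewrite pnatr_eq0 implybT.
    by rewrite addrC subrK -(powR_mulrn L (powR_ge0 2 p^-1)) -(powR_mulrn L (ler0n R 2)) powRAC.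
  by field; rewrite !gt_eqF ?exprn_gt0.
(* Finitely many frequencies are exhausted by finitely many shells. *)
have [L HL] : exists L, forall k, k \in S -> `|v k| < 2 ^+ L * d.
  pose X := \big[Num.max/0]_(k <- S) `|v k|.
  exists (Num.trunc (X / d)).+1 => k kS.
  rewrite -ltr_pdivrMr//; apply: (@le_lt_trans _ _ (X / d)).
    by rewrite ler_pM2r ?invr_gt0//; exact: (@Order.TotalTheory.le_bigmax_seq _ _ _ S 0 k predT (fun k => `|v k|)).

  apply: lt_le_trans (truncnS_gt _) _.
  by rewrite -natrX ler_nat ltnW// ltn_expl.
rewrite big_seq; under eq_bigl => k.
  rewrite (_ : (k \in S) = (k \in S) && (`|v k| < 2 ^+ L * d)); last first.
    by case: (boolP (k \in S)) => // /HL ->.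
  over.
rewrite -big_seq_cond; apply: le_trans (key L) _.
rewrite -mulr_sumr; have := geometric_sum_le L (ltW r0) r1 => gs.
have -> : 4 `^ p^-1 * (1 - r)^-1 / d * G = (4 `^ p^-1 / d * G) * (1 - r)^-1.
  by ring.
by rewrite ler_wpM2l// mulr_ge0// mulr_ge0 ?powR_ge0// invr_ge0 ltW.
Qed.

End SmallDivisors.

Section ErgodicError.
Context {R : realType}.
Local Notation mu := (@lebesgue_measure R).
Local Notation IT T g := (\int[mu]_(t in `[0%R, T]) g t)%R.

Lemma IT_integrable T (g : R -> R) : continuous g ->
  mu.-integrable `[0, T] (EFin \o g).
Proof.
move=> cg; apply: continuous_compact_integrable; first exact: segment_compact.
exact: continuous_subspaceT.
Qed.

Lemma IT_lin T (a : R) g h : continuous g -> continuous h ->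
  IT T (fun t => a * g t + h t) = a * IT T g + IT T h.
Proof.
move=> cg ch; rewrite -RintegralZl//; last exact: IT_integrable.
rewrite -RintegralD//; last exact: IT_integrable.
by apply: (@IT_integrable T (fun t => a * g t)); apply: contM => //; exact: cont_cst.
Qed.

Lemma IT_cst T (c : R) : 0 <= T -> IT T (fun=> c) = T * c.
Proof.
move=> T0; rewrite Rintegral_cst//= lebesgue_measure_itv/= lte_fin.
case: ltrgtP T0 => // [T0 _|<- _]; last by rewrite mulr0 mul0r.
by rewrite -EFinD/= subr0 mulrC.
Qed.

Lemma IT_norm_le T (g : R -> R) c : 0 <= T -> continuous g ->
  (forall t, `|g t| <= c) -> `|IT T g| <= T * c.
Proof.
move=> T0 cg gc; have ig := @IT_integrable T g cg.
apply: le_trans (le_normr_Rintegral _ ig) _ => //.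
rewrite -IT_cst//; apply: le_Rintegral => //.
  exact: (integrable_abse ig).
by apply: IT_integrable; exact: cont_cst.
Qed.

Lemma IT_derivative T (F f : R -> R) : 0 < T -> continuous f ->
  (forall t : R, is_derive t 1 F (f t)) -> IT T f = F T - F 0.
Proof.
move=> T0 cf dF; rewrite /Rintegral (@continuous_FTC2 R f F)//.
- exact: continuous_subspaceT.
- have cF : continuous F.
    move=> t; apply: differentiable_continuous; apply/derivable1_diffP.
    by case: (dF t).
  split; first by move=> t _; case: (dF t).
    exact/cvg_at_right_filter/cF.
  exact/cvg_at_left_filter/cF.
- by move=> t _; rewrite derive1E; case: (dF t).
Qed.

Section Fixed.
Context {n : nat}.
Variables (x omega : 'rV[R]_n) (T : R).
Hypothesis T0 : 0 < T.
Implicit Types (f g : 'rV[R]_n -> R[i]) (k : 'rV[int]_n).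

Lemma cont_orbit (F : 'rV[R]_n -> R) : continuous F ->
  continuous (fun t : R => F (x + t *: omega)).
Proof.
move=> cF t.
have c1 : {for t, continuous (fun _ : R => x)} by exact: cst_continuous.
have c2 : {for t, continuous (fun s : R => s *: omega)}.
  exact: scalel_continuous.
exact: (continuous_comp (continuousD c1 c2) (cF _)).
Qed.

Definition deviation f : R[i] := time_average f x omega T - cI f.

Lemma deviation_lin a f g : ccontinuous f -> ccontinuous g ->
  deviation (fun y => a * f y + g y) = a * deviation f + deviation g.
Proof.
move=> cf cg; rewrite /deviation cI_lin//.
suff -> : time_average (fun y => a * f y + g y) x omega T =
   a * time_average f x omega T + time_average g x omega T by ring.
case: cf cg => f1 f2 [g1 g2]; have := cont_orbit f1; have := cont_orbit f2.
have := cont_orbit g1; have := cont_orbit g2 => {}g2 {}g1 {}f2 {}f1.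
rewrite /time_average; case: a => a b.
have E1 : (fun t => Re ((a +i* b) * f (x + t *: omega) + g (x + t *: omega))) =
    (fun t => a * Re (f (x + t *: omega)) + ((- b) * Im (f (x + t *: omega)) +
      Re (g (x + t *: omega)))).
  by apply/funext => t; rewrite cReD cReM /= mulNr addrA.
have E2 : (fun t => Im ((a +i* b) * f (x + t *: omega) + g (x + t *: omega))) =
    (fun t => a * Im (f (x + t *: omega)) + (b * Re (f (x + t *: omega)) +
      Im (g (x + t *: omega)))).
  by apply/funext => t; rewrite cImD cImM /= addrA.
rewrite E1 E2 !IT_lin//; try exact: cont_lin.
set A1 := IT T (fun t => Re (f (x + t *: omega))).
set A2 := IT T (fun t => Im (f (x + t *: omega))).
set A3 := IT T (fun t => Re (g (x + t *: omega))).
set A4 := IT T (fun t => Im (g (x + t *: omega))).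
by apply/eqP; rewrite eq_complex; apply/andP; split; apply/eqP;
  rewrite ?cReD ?cImD ?cReM ?cImM /= ?cReM ?cImM/=; ring.
Qed.

Lemma deviationZ a f : ccontinuous f -> deviation (fun y => a * f y) = a * deviation f.
Proof.
move=> cf; have E (c : R[i]) : ccontinuous (fun _ : 'rV[R]_n => c) by exact: cc_cst.
have d0 : deviation (fun=> 0) = 0.
  have := deviation_lin (-1) (E 0) (E 0).
  under [X in deviation X = _ -> _]eq_fun do rewrite mulr0 addr0.
  by move=> ->; rewrite mulN1r addNr.
have := deviation_lin a cf (E 0).
by under [X in deviation X = _ -> _]eq_fun do rewrite addr0; rewrite d0 addr0.
Qed.

Lemma deviation_sum (J : Type) (r : seq J) (f : J -> 'rV[R]_n -> R[i]) :
  (forall j, ccontinuous (f j)) ->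
  deviation (fun y => \sum_(j <- r) f j y) = \sum_(j <- r) deviation (f j).
Proof.
move=> cf; elim: r => [|j r IH].
  rewrite big_nil; under [X in deviation X]eq_fun do rewrite big_nil.
  have := deviationZ 0 (@cc_cst R n 0).
  by under [X in deviation X = _ -> _]eq_fun do rewrite mulr0; rewrite mul0r.
rewrite big_cons -IH -[deviation (f j)]mul1r -deviation_lin//.
  by under [X in deviation X = _]eq_fun do rewrite big_cons -[f j _]mul1r.
exact: (cc_cI_sum r cf).1.
Qed.

Lemma nm_time_average_le f (c1 c2 : R) :
  `|IT T (fun t => Re (f (x + t *: omega)))| <= c1 ->
  `|IT T (fun t => Im (f (x + t *: omega)))| <= c2 ->
  nm (time_average f x omega T) <= (c1 + c2) / T.
Proof.
move=> H1 H2; rewrite /time_average Normc.normcM nm_real ger0_norm ?invr_ge0 ?(ltW T0)//.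
rewrite [leLHS]mulrC ler_pM2r ?invr_gt0//.
by apply: le_trans (nm_le _) _; rewrite lerD.
Qed.

(** The constant is [3] and not [2] because the time average is bounded through its
    real and imaginary parts. *)
Lemma nm_deviation_le f c : ccontinuous f -> (forall y, nm (f y) <= c) ->
  nm (deviation f) <= 3 * c.
Proof.
move=> cf fc; have -> : 3 * c = 2 * c + c by ring.
apply: le_trans (le_normcD _ _) _; rewrite normcN lerD//; last first.
  exact: nm_cI_le.
have -> : 2 * c = (T * c + T * c) / T by field; rewrite gt_eqF.
case: cf => f1 f2; apply: nm_time_average_le; apply: (IT_norm_le (ltW T0)).
- exact: cont_orbit f1.
- by move=> t; exact: le_trans (nm_Re _) (fc _).
- exact: cont_orbit f2.
- by move=> t; exact: le_trans (nm_Im _) (fc _).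
Qed.

Lemma deviation_mode0 : deviation (e 0) = 0.
Proof.
have -> : e 0 = (fun=> 1) :> ('rV[R]_n -> R[i]) by apply/funext => y; exact: mode0.
rewrite /deviation cI_cst /time_average/= !IT_cst ?(ltW T0)// mulr1 mulr0.
by rewrite complexr0 -rmorphM/= mulVf ?subrr// gt_eqF.
Qed.

(** Along the orbit the mode oscillates with frequency [k . omega], so its real and
    imaginary parts have primitives bounded by [1 / (2 pi |k . omega|)]. *)
Lemma nm_deviation_mode k : k != 0 -> dot (vec_of_int k) omega != 0 ->
  nm (deviation (e k)) <= T^-1 / `|dot (vec_of_int k) omega|.
Proof.
move=> k0 v0; set v := dot _ omega.
rewrite /deviation cI_mode (negbTE k0) subr0.
have pi0 := @pi_gt0 R; have pi2 := @pi_ge2 R.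
pose b := 2 * pi * v; pose a := 2 * pi * dot (vec_of_int k) x.
have b0 : b != 0 by rewrite /b !mulf_eq0 !negb_or pnatr_eq0 (gt_eqF pi0) v0.
have dlin (t : R) : is_derive t 1 (fun t : R => a + b * t) b.
  rewrite -[X in is_derive _ _ _ X]add0r -[X in is_derive _ _ _ (_ + X)]mulr1.
  exact: (is_deriveD (is_derive_cst (a : R^o) _ _)
    (is_deriveZ b (is_derive_id (t : R^o) 1))).
have clin : continuous (fun t : R => a + b * t).
  by apply: contD; [exact: cont_cst|apply: contM; [exact: cont_cst|move=> t; exact: cvg_id]].
have E t : 2 * pi * dot (vec_of_int k) (x + t *: omega) = a + b * t.
  by rewrite dotDr dotZr /a /b /v; ring.
have int phi dphi : continuous phi -> (forall t : R, is_derive t 1 dphi (phi t)) ->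
    (forall t, `|dphi t| <= 1) ->
    `|IT T (fun t => phi (2 * pi * dot (vec_of_int k) (x + t *: omega)))| <= 2 / `|b|.
  move=> cphi D dphi1; under eq_Rintegral do rewrite E.
  have cp : continuous (fun t => phi (a + b * t)) := cont_comp clin cphi.
  have -> : IT T (fun t => phi (a + b * t)) =
      b^-1 * dphi (a + b * T) - b^-1 * dphi (a + b * 0).
    apply: (@IT_derivative T (fun t => b^-1 * dphi (a + b * t)) _ T0 cp) => t.
    have -> : phi (a + b * t) = b^-1 * (phi (a + b * t) * b) by field.
    exact: (is_deriveZ b^-1 (is_derive1_comp (D _) (dlin t))).
  rewrite -mulrBr normrM normfV mulrC ler_pM2r ?invr_gt0 ?normr_gt0//.
  by rewrite (le_trans (ler_normB _ _))// [2]mulr2n lerD.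
apply: (@le_trans _ _ ((2 / `|b| + 2 / `|b|) / T)).
  apply: nm_time_average_le => /=.
    by apply: (int cos sin (@continuous_cos R) (fun t => is_derive_sin t)) => t; exact: sin_max.
  apply: (int sin (fun t => - cos t)); first exact: continuous_sin.
    move=> t; rewrite -[sin t]opprK; exact: (is_deriveN (is_derive_cos t)).
  by move=> t; rewrite normrN cos_max.
have vn : 0 < `|v| by rewrite normr_gt0.
have -> : `|b| = 2 * pi * `|v|.
  by rewrite /b !normrM (ger0_norm (ltW pi0)) ger0_norm.
have E2 (P V : R) : 0 < P -> 0 < V ->
    (2 / (2 * P * V) + 2 / (2 * P * V)) / T = 2 / P * (T^-1 / V).
  by move=> P0 V0; field; rewrite !gt_eqF.
rewrite E2//.
by rewrite ler_piMl ?ler_pdivrMr ?mul1r// divr_ge0 ?invr_ge0 ?ltW.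
Qed.

Lemma ergodic_errorE f : ergodic_error f x omega T = nm (deviation f).
Proof. by []. Qed.

End Fixed.
End ErgodicError.

Section DiophantineError.
Context {R : realType} {n : nat}.
Local Notation vec := (@vec_of_int R n).
Implicit Types (f g : 'rV[R]_n -> R[i]) (k l : 'rV[int]_n) (N : nat).

Definition zcube N : seq 'rV[int]_n :=
  [seq map_mx (fun j : 'I_N.*2.+1 => j%:Z - N%:Z) b | b <- enum 'rV['I_N.*2.+1]_n].

Lemma zcube_uniq N : uniq (zcube N).
Proof.
rewrite map_inj_uniq ?enum_uniq// => a b /rowP ab; apply/rowP => i.
have := ab i; rewrite !mxE => /addIr [] /val_inj.
by [].
Qed.

Lemma mem_zcube N k : (k \in zcube N) = [forall i, (absz (k ord0 i) <= N)%N].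
Proof.
apply/mapP/forallP => [[b _ ->] i|kN].
  by rewrite mxE; case: (b _ i) => j /= jN; lia.
exists (\row_i inord (absz (k ord0 i + N%:Z))); first by rewrite mem_enum.
apply/rowP => i; have := kN i; rewrite !mxE; move: (k _ i) => z zN.
by rewrite inordK; lia.
Qed.

Lemma zcube_size N : size (zcube N) = (N.*2.+1 ^ n)%N.
Proof. by rewrite size_map -cardE card_mx card_ord mul1n. Qed.

Lemma zcubeB N k l : k \in zcube N -> l \in zcube N -> k - l \in zcube N.*2.
Proof.
rewrite !mem_zcube => /forallP kN /forallP lN; apply/forallP => i.
by have := kN i; have := lN i; rewrite !mxE; move: (k _ i) (l _ i) => a b; lia.
Qed.

Lemma zcube_sub M N : (M <= N)%N -> {subset zcube M <= zcube N}.
Proof.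
move=> MN k; rewrite !mem_zcube => /forallP H; apply/forallP => i.
exact: leq_trans (H i) MN.
Qed.

Lemma dot_ge0 (x : 'rV[R]_n) : 0 <= dot x x.
Proof. by apply: sumr_ge0 => i _; rewrite -expr2 sqr_ge0. Qed.

Lemma enorm_le_zcube N k : k \in zcube N -> enorm (vec k) <= (n * N)%:R.
Proof.
rewrite mem_zcube => /forallP kN.
rewrite -[leRHS]ger0_norm// -sqrtr_sqr /enorm ler_sqrt ?sqr_ge0//.
apply: (@le_trans _ _ (\sum_(i < n) (N%:R ^+ 2 : R))).
  apply: ler_sum => i _; have := kN i; rewrite !mxE; move: (k _ i) => z zN.
  have zN' : `|z%:~R : R| <= N%:R by rewrite -intr_norm -natr_absz ler_nat.
  rewrite -expr2 -[leLHS]ger0_norm ?sqr_ge0// normrX.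
  by rewrite lerXn2r// nnegrE.
rewrite sumr_const card_ord -[leLHS]mulr_natl natrM exprMn ler_wpM2r ?sqr_ge0//.
by rewrite -natrX ler_nat; case: (n) => // m; rewrite leq_pmull.
Qed.

Lemma enorm_gt0 k : k != 0 -> 0 < enorm (vec k).
Proof.
move=> k0; rewrite sqrtr_gt0 lt_neqAle dot_ge0 andbT eq_sym.
apply: contra k0 => /eqP H; apply/eqP/rowP => i.
have /eqP := @psumr_eq0P R _ xpredT (fun i => vec k ord0 i * vec k ord0 i)
  (fun i _ => sqr_ge0 (vec k ord0 i)) H i isT.
by rewrite -expr2 sqrf_eq0 !mxE intr_eq0 => /eqP.
Qed.

Lemma diophantine_zcube (sigma Cw : R) omega N k : 0 < sigma -> 0 < Cw ->
  diophantine sigma Cw omega -> k \in zcube N -> k != 0 ->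
  Cw * (n * N)%:R `^ (- sigma) <= `|dot (vec k) omega|.
Proof.
move=> s0 C0 D kN k0; apply: le_trans (D k k0).
have e0 := enorm_gt0 k0; have eN := enorm_le_zcube kN.
have nN : 0 < (n * N)%:R :> R := lt_le_trans e0 eN.
rewrite ler_pM2l// !powRN lef_pV2 ?posrE ?powR_gt0//.
by apply: ge0_ler_powR; rewrite ?nnegrE// ltW.
Qed.

(** Differences of frequencies in the cube of size [N] lie in the cube of size [2N],
    so the Diophantine condition separates the numbers [k . omega] by a multiple of
    [Cw N^-sigma].  By [divisor_sum_le] the sum of the Fourier coefficients over
    their divisors is then no worse than for a single divisor of that size and the
    [L^p] norm: the number of frequencies does not enter. *)
Lemma deviation_zcube (p sigma : R) : (0 < n)%N -> 1 < p -> p <= 2 -> 0 < sigma ->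
  exists2 C, 0 < C & forall g N, ccontinuous g -> (0 < N)%N ->
    (forall y, g y = \sum_(k <- zcube N) fcoef g k * e k y) ->
    forall (Cw : R) omega x T, 0 < Cw -> diophantine sigma Cw omega -> 0 < T ->
    nm (deviation x omega T g) <= C / Cw * T^-1 * (N%:R `^ sigma * Lpn p g).
Proof.
move=> n0 p1 p2 s0; have [C1 C10 HC] := @divisor_sum_le R p p1.
exists (C1 * (n * 2)%:R `^ sigma).
  by rewrite mulr_gt0// powR_gt0// ltr0n muln_gt0 n0.
move=> g N cg N0 gE Cw omega x T Cw0 D T0.
pose d := Cw * (n * N.*2)%:R `^ (- sigma).
have nN : 0 < (n * N.*2)%:R :> R by rewrite ltr0n muln_gt0 n0 double_gt0.
have d0 : 0 < d by rewrite mulr_gt0// powR_gt0.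
pose v k := dot (vec k) omega.
have vd k : k \in zcube N.*2 -> k != 0 -> d <= `|v k|.
  exact: diophantine_zcube.
pose S := [seq k <- zcube N | k != 0].
have SN k : k \in S -> k != 0 /\ k \in zcube N by rewrite mem_filter => /andP.
have NN : (N <= N.*2)%N by rewrite -addnn leq_addr.
have uS : uniq S by rewrite filter_uniq// zcube_uniq.
have L0 : 0 <= Lpn p g by exact: powR_ge0.
have sep : {in S &, forall k l, k != l -> d <= `|v k - v l|}.
  move=> k l /SN[_ kN] /SN[_ lN] kl.
  have -> : v k - v l = v (k - l) by rewrite /v vecB dotDl dotNl.
  by apply: vd; [exact: zcubeB|rewrite subr_eq0].
have vS k : k \in S -> d <= `|v k|.
  by move=> /SN[k0 kN]; apply: vd => //; exact: zcube_sub NN _ kN.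
have := HC _ S v (fun k => nm (fcoef g k)) d (Lpn p g) d0 L0 uS sep vS
  (fun k => nm_ge0 _) (fun S' uS' _ => sum_fcoef_le cg uS' p1 p2).
move=> key; rewrite [X in deviation _ _ _ X](funext gE) deviation_sum; last first.
  by move=> k; apply: ccM; [exact: cc_cst|exact: cc_mode].
apply: (@le_trans _ _ (T^-1 * (C1 / d * Lpn p g))); last first.
  pose a := (n * 2)%:R `^ sigma : R; pose b := N%:R `^ sigma : R.
  have a0 : 0 < a by rewrite powR_gt0// ltr0n muln_gt0 n0.
  have b0 : 0 < b by rewrite powR_gt0// ltr0n.
  have dE : d = Cw / (a * b).
    rewrite /d (powRN _ sigma) (_ : (n * N.*2)%:R = (n * 2)%:R * N%:R).
      by rewrite powRM.
    by rewrite -natrM -muln2 -mulnA [(2 * N)%N]mulnC.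
  rewrite dE -/a -/b le_eqVlt; apply/orP; left; apply/eqP.
  have field_id (A B c L t : R) : 0 < A -> 0 < B -> 0 < c ->
      t * (C1 / (c / (A * B)) * L) = C1 * A / c * t * (B * L).
    by move=> A0 B0 c0; field; rewrite !gt_eqF.
  exact: field_id.
apply: le_trans (ler_wpM2l _ key); last by rewrite invr_ge0 ltW.
apply: le_trans (nm_sum _ _ _) _; rewrite mulr_sumr big_filter.
rewrite [leRHS]big_mkcond [leLHS]big_seq [leRHS]big_seq.
apply: ler_sum => k kN; rewrite deviationZ; last exact: cc_mode.
rewrite Normc.normcM; case: ifPn => [k0|].
  rewrite mulrCA; apply: ler_wpM2l; first exact: nm_ge0.
  apply: nm_deviation_mode => //.
  have /(lt_le_trans d0) : d <= `|v k| by apply: vS; rewrite mem_filter k0.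
  by rewrite normr_gt0.
by rewrite negbK => /eqP->; rewrite deviation_mode0// nm0 mulr0.
Qed.

End DiophantineError.

(** * Dyadic blocks *)

Section Blocks.
Context {R : realType} {n : nat}.
Local Notation vec := (@vec_of_int R n).
Implicit Types (f g : 'rV[R]_n -> R[i]) (k l : 'rV[int]_n) (m N : nat).
Implicit Types (u : ('rV[R]_n -> R[i]) -> R[i]).

Lemma fcoef_finite_sum (S : seq 'rV[int]_n) (c : 'rV[int]_n -> R[i]) l : uniq S ->
  fcoef (fun x => \sum_(k <- S) c k * e k x) l = if l \in S then c l else 0.
Proof.
move=> uS.
have cm k : ccontinuous (fun x : 'rV[R]_n => c k * (e k x * e (- l) x)).
  by apply: ccM; [exact: cc_cst|apply: ccM; exact: cc_mode].
have -> : fcoef (fun x => \sum_(k <- S) c k * e k x) l =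
    \sum_(k <- S) c k * fcoef (e k) l.
  have [_ IS] := cc_cI_sum S cm.
  rewrite /fcoef; have -> : (fun x : 'rV[R]_n => (\sum_(k <- S) c k * e k x) * e (- l) x) =
      (fun x => \sum_(k <- S) c k * (e k x * e (- l) x)).
    by apply/funext => x; rewrite mulr_suml; apply: eq_bigr => k _; rewrite mulrA.
  rewrite IS; apply: eq_bigr => k _; rewrite cIZ//.
  by apply: ccM; exact: cc_mode.
case: ifPn => lS.
  rewrite (bigD1_seq l)//= fcoef_mode eqxx mulr1 big1 ?addr0// => k kl.
  by rewrite fcoef_mode (negbTE kl) mulr0.
rewrite big_seq big1// => k kS; rewrite fcoef_mode.
by case: eqP => [kl|]; [rewrite -kl kS in lS|rewrite mulr0].
Qed.

Definition spectrum_in N g := forall y, g y = \sum_(k <- zcube N) fcoef g k * e k y.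

Lemma spectrum_cc N g : spectrum_in N g -> ccontinuous g.
Proof.
move=> H; rewrite (funext H); apply: (cc_cI_sum _ _).1 => k.
by apply: ccM; [exact: cc_cst|exact: cc_mode].
Qed.

Lemma spectrum_periodic N g : spectrum_in N g -> Zn_periodic g.
Proof.
move=> H; rewrite (funext H) => x k; apply: eq_bigr => l _.
by rewrite mode_periodic.
Qed.

(** By uniqueness, vanishing of the coefficients outside the cube suffices. *)
Lemma spectrum_inP N g : ccontinuous g -> Zn_periodic g ->
  (forall k, k \notin zcube N -> fcoef g k = 0) -> spectrum_in N g.
Proof.
move=> cg pg H; set h := (fun y : 'rV[R]_n => \sum_(k <- zcube N) fcoef g k * e k y).
suff : g = h by move=> E y; rewrite {1}E.
have ch : ccontinuous h.
  by apply: (cc_cI_sum _ _).1 => k; apply: ccM; [exact: cc_cst|exact: cc_mode].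
have ph : Zn_periodic h.
  by move=> x k; apply: eq_bigr => l _; rewrite mode_periodic.
apply: fourier_uniqueness => // k.
rewrite /h fcoef_finite_sum ?zcube_uniq//.
by case: ifPn => // /H.
Qed.

Section Cutoff.
Context {chi : R -> R}.
Hypothesis hchi : besov_cutoff chi.

Lemma chi_supp t : 4 / 3 < `|t| -> chi t = 0.
Proof.
move=> ht; apply/eqP; apply: contraT => ct; case: hchi => _ _ _ H.
have : closure [set t | chi t != 0] t by exact: subset_closure.
by rewrite H/= -ler_norml leNgt ht.
Qed.

Lemma cutoff_supp m t : 4 / 3 * 2 ^+ m < t -> dyadic_cutoff chi m t = 0.
Proof.
have two0 j : 0 < 2 ^+ j :> R by rewrite exprn_gt0.
case: m => [|j] ht /=.
  by apply: chi_supp; apply: lt_le_trans (ler_norm _); rewrite expr0 mulr1 in ht.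
have h2 : 4 / 3 < t / 2 ^+ j / 2.
  by rewrite ltr_pdivlMr// ltr_pdivlMr// -mulrA -exprS.
have h1 : 4 / 3 < t / 2 ^+ j by move: h2; set X := t / _; lra.
by rewrite !chi_supp ?subrr//; apply: lt_le_trans (ler_norm _).
Qed.

Lemma cutoff_sum M t : \sum_(m < M.+1) dyadic_cutoff chi m t = chi (t / 2 ^+ M).
Proof.
elim: M => [|M IH]; first by rewrite big_ord_recl big_ord0 /= addr0 expr0 divr1.
rewrite big_ord_recr/= IH addrC subrK exprS invfM mulrA.
by rewrite [_ / 2 ^+ M / 2]mulrAC.
Qed.

Lemma cutoff_sum_eventually t : 0 <= t -> exists M0, forall M, (M0 <= M)%N ->
  \sum_(m < M.+1) dyadic_cutoff chi m t = 1.
Proof.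
move=> t0; exists (Num.trunc (t * (4 / 3))).+1 => M MM.
rewrite cutoff_sum; case: hchi => _ _ H _; apply: H.
have M0 : 0 < 2 ^+ M :> R by rewrite exprn_gt0.
rewrite ger0_norm ?divr_ge0 ?(ltW M0)// ler_pdivrMr//.
have : t * (4 / 3) < 2 ^+ M.
  apply: lt_le_trans (truncnS_gt _) _.
  by rewrite -natrX ler_nat ltnW// (leq_ltn_trans MM)// ltn_expl.
lra.
Qed.

Lemma enorm_ge_coord k (i : 'I_n) : (absz (k ord0 i))%:R <= enorm (vec k).
Proof.
rewrite -[leLHS]ger0_norm// -sqrtr_sqr /enorm ler_sqrt ?dot_ge0//.
rewrite /dot (bigD1 i)//= !mxE natr_absz intr_norm.
rewrite real_normK ?num_real// -expr2 lerDl.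
by apply: sumr_ge0 => j _; rewrite -expr2 sqr_ge0.
Qed.

Lemma cutoff_zcube m k : k \notin zcube (2 ^ m.+1) ->
  dyadic_cutoff chi m (enorm (vec k)) = 0.
Proof.
rewrite mem_zcube negb_forall; case/existsP => i; rewrite -ltnNge => ki.
apply: cutoff_supp; apply: lt_le_trans (enorm_ge_coord k i).
apply: (@le_lt_trans _ _ (2 ^ m.+1)%:R); last by rewrite ltr_nat.
rewrite natrX exprS ler_pM2r ?exprn_gt0//; lra.
Qed.

Lemma dyadic_blockE m u x : dyadic_block chi m u x =
  \sum_(k <- zcube (2 ^ m.+1)) (dyadic_cutoff chi m (enorm (vec k)))%:C *
     fourier_coef u k * e k x.
Proof.
pose F k : R[i] := (dyadic_cutoff chi m (enorm (vec k)))%:C * fourier_coef u k * e k x.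
have F0 k : predT k -> k \notin zcube (2 ^ m.+1) -> F k = 0.
  by move=> _ kN; rewrite /F cutoff_zcube// !mul0r.
rewrite /dyadic_block -[RHS]/(\sum_(k <- zcube (2 ^ m.+1)) F k).
rewrite [RHS](bigfs _ (zcube_uniq _) F0).
by apply: eq_fsbigl; apply/seteqP; split.
Qed.

Lemma fcoef_block m u k : fcoef (dyadic_block chi m u) k =
  (dyadic_cutoff chi m (enorm (vec k)))%:C * fourier_coef u k.
Proof.
rewrite (funext (dyadic_blockE m u)) fcoef_finite_sum ?zcube_uniq//.
by case: ifPn => // /cutoff_zcube ->; rewrite mul0r.
Qed.

Lemma spectrum_block m u : spectrum_in (2 ^ m.+1) (dyadic_block chi m u).
Proof.
by move=> y; rewrite dyadic_blockE; apply: eq_bigr => k _; rewrite fcoef_block.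
Qed.

End Cutoff.

Lemma sup_norm_finite g : (sup_norm g < +oo)%E -> forall x, nm (g x) <= fine (sup_norm g).
Proof.
move=> goo x; have gx : ((nm (g x))%:E <= sup_norm g)%E.
  by apply: ereal_sup_ubound; exists x.
rewrite -lee_fin fineK// ge0_fin_numE//.
by apply: le_trans gx; rewrite lee_fin nm_ge0.
Qed.

Lemma sup_norm_ge0 g : (0 <= sup_norm g)%E.
Proof.
apply: ereal_sup_ge; exists (nm (g 0))%:E; first by exists 0.
by rewrite lee_fin nm_ge0.
Qed.

Lemma torus_Lp_norm_ge0 p g : (0 <= torus_Lp_norm p g)%E.
Proof.
case: p => [p||]; try exact: sup_norm_ge0.
by rewrite lee_fin powR_ge0.
Qed.

Lemma besov_term_ge0 chi s p u m : (0 <= besov_term chi s p u m)%E.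
Proof. by rewrite mule_ge0 ?torus_Lp_norm_ge0// lee_fin powR_ge0. Qed.

(** Young's inequality for the exponents [r] and [q = r / (r - 1)], applied to
    [b m / (B + d)] and [J^(-1/q)] and summed; the small [d] keeps the first
    denominator positive when [B = 0]. *)
Lemma power_mean J (b : nat -> R) (r B : R) : 1 <= r -> 0 <= B ->
  (forall m, 0 <= b m) -> \sum_(m < J) b m `^ r <= B `^ r ->
  \sum_(m < J) b m <= J%:R `^ (1 - r^-1) * B.
Proof.
move=> r1 B0 b0; have r0 : 0 < r by exact: lt_le_trans r1.
have [->|rn1] := eqVneq r 1.
  rewrite invr1 subrr powRr0 mul1r powRr1//.
  by apply: le_trans; apply: ler_sum => m _; rewrite powRr1.
have {rn1}r1 : 1 < r by rewrite lt_neqAle eq_sym rn1.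
move=> H; have [->|J0] := posnP J.
  by rewrite big_ord0 mulr_ge0 ?powR_ge0.
have Jr : 0 < J%:R :> R by rewrite ltr0n.
have r10 : 0 < r - 1 by rewrite subr_gt0.
pose q := r / (r - 1); have q0 : 0 < q by rewrite divr_gt0.
have rq : r^-1 + q^-1 = 1 by rewrite /q invf_div; field; rewrite gt_eqF.
have -> : 1 - r^-1 = q^-1 by rewrite -rq addrAC subrr add0r.
pose H0 := J%:R `^ q^-1 : R; have H00 : 0 < H0 by rewrite powR_gt0.
suff key d : 0 < d -> \sum_(m < J) b m <= H0 * (B + d).
  apply/ler_addgt0Pr => eps e0.
  apply: le_trans (key (eps / H0) _) _; first by rewrite divr_gt0.
  by rewrite mulrDr [H0 * (_ / _)]mulrC mulfVK// gt_eqF.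
move=> d0; have Bd : 0 < B + d by rewrite ltr_wpDl.
have young m : (H0 * (B + d))^-1 * b m <=
    ((B + d) `^ r)^-1 / r * b m `^ r + J%:R^-1 / q.
  have -> : (H0 * (B + d))^-1 * b m = (b m / (B + d)) * H0^-1.
    by field; rewrite !gt_eqF.
  apply: le_trans (conjugate_powR _ _ r0 q0 rq) _.
  - by rewrite divr_ge0// ltW.
  - by rewrite invr_ge0 ltW.
  rewrite lerD//.
    rewrite powRM ?invr_ge0 ?(ltW Bd)// -(powR_inv1 (ltW Bd)) powRAC powR_inv1 ?powR_ge0//.
    by rewrite le_eqVlt; apply/orP; left; apply/eqP; ring.
  rewrite ler_pM2r ?invr_gt0// -(powR_inv1 (ltW H00)) powRAC powR_inv1 ?powR_ge0//.
  by rewrite /H0 -powRrM mulVf ?gt_eqF// powRr1.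
rewrite -[leLHS](@mulVKf _ (H0 * (B + d))); last by rewrite gt_eqF// mulr_gt0.
rewrite -[leRHS]mulr1 ler_pM2l ?mulr_gt0// mulr_sumr.
apply: (@le_trans _ _ (\sum_(m < J)
    (((B + d) `^ r)^-1 / r * b m `^ r + J%:R^-1 / q))).
  by apply: ler_sum => m _; exact: young.
rewrite big_split/= -mulr_sumr sumr_const card_ord -[leRHS]rq lerD//.
  rewrite mulrAC ler_piMl ?invr_ge0 ?(ltW r0)//.
  rewrite ler_pdivrMl ?powR_gt0// mulr1; apply: le_trans H _.
  by apply: ge0_ler_powR; rewrite ?nnegrE ?(ltW r0)// ?(ltW Bd)// lerDl ltW.
by rewrite -[leLHS]mulr_natl mulrA mulfV ?gt_eqF// mul1r.
Qed.

(** The index [q] enters all later estimates through these two bounds on the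
    weighted norms of the blocks. *)
Lemma besov_terms chi s p q u : (1 <= q)%E -> in_besov chi s p q u ->
  let B := fine (besov_norm chi s p q u) in
  exists b : nat -> R,
  [/\ 0 <= B, forall m, besov_term chi s p u m = (b m)%:E,
      forall m, 0 <= b m <= B &
      forall J, \sum_(m < J) b m <= J%:R `^ conjugate_inv q * B].
Proof.
move=> q1 [_ Boo] B; pose b m := fine (besov_term chi s p u m); exists b.
have t0 := besov_term_ge0 chi s p u.
have N0 : (0 <= besov_norm chi s p q u)%E.
  case: (q) => [r||]; first exact: poweR_ge0.
    by apply: le_trans (t0 0%N) _; apply: ereal_sup_ubound; exists 0%N.
  by apply: le_trans (t0 0%N) _; apply: ereal_sup_ubound; exists 0%N.
have BE : besov_norm chi s p q u = B%:E by rewrite fineK// ge0_fin_numE.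
have B0 : 0 <= B by rewrite fine_ge0.
have finite_terms : (forall m, (besov_term chi s p u m <= B%:E)%E) ->
   (forall m, besov_term chi s p u m = (b m)%:E) /\ forall m, 0 <= b m <= B.
  move=> tB; have tE m : besov_term chi s p u m = (b m)%:E.
    by rewrite fineK// ge0_fin_numE// (le_lt_trans (tB m)) ?ltry.
  by split=> // m; have := tB m; have := t0 m; rewrite tE !lee_fin => -> ->.
case: q q1 Boo @B N0 BE B0 finite_terms => [r||//] q1 Boo B N0 BE B0 FT.
  have r1 : 1 <= r by rewrite -lee_fin.
  have r0 : 0 < r by exact: lt_le_trans r1.
  have sumE : (\sum_(0 <= m <oo) besov_term chi s p u m `^ r = (B `^ r)%:E)%E.
    rewrite -poweR_EFin -BE /besov_norm -poweRrM mulVf ?gt_eqF// poweRe1//.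
    by apply: nneseries_ge0 => m _ _; exact: poweR_ge0.
  have part J : (\sum_(m < J) besov_term chi s p u m `^ r <= (B `^ r)%:E)%E.
    rewrite -sumE -(big_mkord xpredT (fun m => besov_term chi s p u m `^ r)%E).
    by apply: nneseries_lim_ge => m _ _; exact: poweR_ge0.
  have [tE bB] : (forall m, besov_term chi s p u m = (b m)%:E) /\ forall m, 0 <= b m <= B.
    apply: FT => m; have : (besov_term chi s p u m `^ r <= (B `^ r)%:E)%E.
      apply: le_trans (part m.+1); rewrite big_ord_recr/= leeDr// sume_ge0// => i _.
      exact: poweR_ge0.
    rewrite -poweR_EFin => tB; have ri : (0 <= r^-1)%R by rewrite invr_ge0 ltW.
    have : ((besov_term chi s p u m `^ r) `^ r^-1 <= (B%:E `^ r) `^ r^-1)%E.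
      have mem (z : \bar R) : (0 <= z)%E -> z \in `[0%E, +oo%E] by rewrite in_itv/= leey => ->.
      by apply: gt0_ler_poweR => //; apply: mem; exact: poweR_ge0.
    by rewrite -!poweRrM mulfV ?gt_eqF// !poweRe1.
  split=> // J; apply: power_mean => // [m|]; first by case/andP: (bB m).
  have := part J; rewrite -lee_fin; apply: le_trans.
  rewrite -sumEFin le_eqVlt; apply/orP; left; apply/eqP.
  by apply: eq_bigr => m _; rewrite tE poweR_EFin.
have [tE bB] : (forall m, besov_term chi s p u m = (b m)%:E) /\ forall m, 0 <= b m <= B.
  by apply: FT => m; rewrite -BE; apply: ereal_sup_ubound; exists m.
split=> // J; rewrite /conjugate_inv powRr1//.
have -> : J%:R * B = \sum_(m < J) B by rewrite sumr_const card_ord mulr_natl.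
by apply: ler_sum => m _; case/andP: (bB m).
Qed.

End Blocks.

(** * Uniformly convergent series of trigonometric polynomials *)

Section UniformSeries.
Context {R : realType} {n : nat}.
Implicit Types (f F : 'rV[R]_n -> R[i]) (k : 'rV[int]_n) (m M J : nat).
Implicit Types (g S : nat -> 'rV[R]_n -> R[i]).

Definition unif_limit S F := forall eps, 0 < eps ->
  exists M0, forall M, (M0 <= M)%N -> forall x, nm (F x - S M x) <= eps.

Definition psum g M : 'rV[R]_n -> R[i] := fun x => \sum_(m < M) g m x.

Lemma unif_limit_periodic S F : (forall M, Zn_periodic (S M)) -> unif_limit S F ->
  Zn_periodic F.
Proof.
move=> pS SF x k; apply/eqP; rewrite -subr_eq0; apply/eqP/Normc.eq0_normc/eqP.
rewrite eq_le nm_ge0 andbT; apply/ler_addgt0Pr => eps e0; rewrite add0r.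
have e2 : 0 < eps / 2 by rewrite divr_gt0.
have [M0 H] := SF _ e2; have H0 := H M0 (leqnn _).
rewrite [eps]splitr; apply: le_trans (nm_distD _ _ (S M0 x)) _.
by apply: lerD; [rewrite -(pS M0 x k)|rewrite nmB].
Qed.

Lemma unif_limit_cc S F : (forall M, ccontinuous (S M)) ->
  (forall M, Zn_periodic (S M)) -> unif_limit S F -> ccontinuous F.
Proof.
move=> cS pS SF; apply: cuniform_cc => eps e0.
have e4 : 0 < eps / 2 / 2 by rewrite !divr_gt0.
have e2 : 0 < eps / 2 by rewrite divr_gt0.
have [M0 H] := SF _ e4; have H0 := H M0 (leqnn _).
have [d d0 Hd] := zper_cuniform (cS M0) (pS M0) e2.
exists d => // x y xy.
apply: le_trans (nm_distD _ _ (S M0 x)) _.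
have -> : eps = eps / 2 / 2 + (eps / 2 + eps / 2 / 2) by field.
apply: lerD => //; apply: le_trans (nm_distD _ _ (S M0 y)) _.
by apply: lerD; [exact: Hd|rewrite nmB].
Qed.

Lemma unif_limit_fcoef S F k c : (forall M, ccontinuous (S M)) -> ccontinuous F ->
  unif_limit S F -> (exists M1, forall M, (M1 <= M)%N -> fcoef (S M) k = c) ->
  fcoef F k = c.
Proof.
move=> cS cF SF [M1 H1]; apply/eqP; rewrite -subr_eq0; apply/eqP/Normc.eq0_normc/eqP.
rewrite eq_le nm_ge0 andbT; apply/ler_addgt0Pr => eps e0; rewrite add0r.
have [M0 H] := SF _ e0.
rewrite -(H1 (maxn M0 M1)) ?leq_maxr//; apply: fcoef_dist => // x.
by apply: H; rewrite leq_maxl.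
Qed.

Lemma unif_limit_tail g F a M tau : unif_limit (psum g) F ->
  (forall m x, nm (g m x) <= a m) ->
  (forall M', (M <= M')%N -> \sum_(M <= m < M') a m <= tau) ->
  forall x, nm (F x - psum g M x) <= tau.
Proof.
move=> gF ga H x; apply/ler_addgt0Pr => eps /gF[M0 H0].
have {}H0 := H0 (maxn M0 M) (leq_maxl _ _) x.
have {}H := H (maxn M0 M) (leq_maxr _ _).
rewrite [leRHS]addrC; apply: le_trans (nm_distD _ _ (psum g (maxn M0 M) x)) _.
apply: lerD => //; apply: le_trans H; rewrite /psum.
rewrite -!(big_mkord xpredT (fun m => g m x)).
rewrite (big_cat_nat (leq0n M) (leq_maxr M0 M))/= [X in X - _]addrC addrK.
by apply: le_trans (nm_sum _ _ _) _; exact: ler_sum.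
Qed.

Lemma unif_series g a A : (forall m x, nm (g m x) <= a m) ->
  (forall M, \sum_(m < M) a m <= A) -> exists F, unif_limit (psum g) F.
Proof.
move=> ga aA; have a0 m : 0 <= a m := le_trans (nm_ge0 _) (ga m 0).
have ca : cvgn (series a).
  apply: nondecreasing_is_cvgn.
    by apply/nondecreasing_seqP => m; rewrite /series/= big_nat_recr//= lerDl.
  by exists A => _ [M _ <-]; rewrite /series/= big_mkord.
have real_series (w : nat -> 'rV[R]_n -> R) : (forall m x, `|w m x| <= a m) ->
    forall x, (fun M => \sum_(m < M) w m x) @ \oo --> limn (series (fun m => w m x)).
  move=> wa x.
  have cw : cvgn (series (fun m => w m x)).
    apply: normed_cvg; apply: (@series_le_cvg _ _ a) => [m|m|m|].
    - exact: normr_ge0.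
    - exact: a0.
    - exact: wa.
    - exact: ca.
  rewrite (_ : (fun M => _) = series (fun m => w m x))//.
  by apply/funext => M; rewrite /series/= big_mkord.
have HRe m x : `|Re (g m x)| <= a m := le_trans (nm_Re _) (ga m x).
have HIm m x : `|Im (g m x)| <= a m := le_trans (nm_Im _) (ga m x).
pose F x := limn (series (fun m => Re (g m x))) +i* limn (series (fun m => Im (g m x))).
have pointwise x eps : 0 < eps -> exists M0, forall M, (M0 <= M)%N ->
    nm (F x - psum g M x) <= eps.
  move=> e0; have e2 : 0 < eps / 2 by rewrite divr_gt0.
  have /cvgrPdist_le /(_ _ e2) [M1 _ H1] := real_series _ HRe x.
  have /cvgrPdist_le /(_ _ e2) [M2 _ H2] := real_series _ HIm x.
  exists (maxn M1 M2) => M MM; apply: le_trans (nm_le _) _.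
  have E1 : Re (psum g M x) = \sum_(m < M) Re (g m x).
    by rewrite /psum; elim/big_rec2 : _ => // m y1 y2 _ <-; rewrite cReD.
  have E2 : Im (psum g M x) = \sum_(m < M) Im (g m x).
    by rewrite /psum; elim/big_rec2 : _ => // m y1 y2 _ <-; rewrite cImD.
  rewrite cReB cImB E1 E2 [eps]splitr lerD//.
    by apply: H1 => /=; exact: leq_trans (leq_maxl _ _) MM.
  by apply: H2 => /=; exact: leq_trans (leq_maxr _ _) MM.
exists F => eps e0; have e2 : 0 < eps / 2 by rewrite divr_gt0.
have /cvgrPdist_le /(_ _ e2) [M0 _ H0] := ca.
exists M0 => M MM x.
have [M1 H1] := pointwise x _ e2.
have {}H1 := H1 (maxn M1 M) (leq_maxl _ _).
apply: le_trans (nm_distD _ _ (psum g (maxn M1 M) x)) _; rewrite [eps]splitr lerD//.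
rewrite /psum -!(big_mkord xpredT (fun m => g m x)).
rewrite (big_cat_nat (leq0n M) (leq_maxr M1 M))/= [X in X - _]addrC addrK.
apply: le_trans (nm_sum _ _ _) _.
apply: (@le_trans _ _ (\sum_(M <= m < maxn M1 M) a m)).
  by apply: ler_sum => m _; exact: ga.
have := H0 M MM; apply: le_trans; apply: le_trans (ler_norm _).
rewrite lerBrDl /series/= -big_cat_nat//=; last exact: leq_maxr.
apply: (@nondecreasing_cvgn_le _ (series a)) => //.
by apply/nondecreasing_seqP => m; rewrite /series/= big_nat_recr//= lerDl.
Qed.

Lemma psum_cc g M : (forall m, ccontinuous (g m)) -> ccontinuous (psum g M).
Proof.
move=> cg; elim: M => [|M IH].
  rewrite (_ : psum g 0 = (fun=> 0)); first exact: cc_cst.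
  by apply/funext => x; rewrite /psum big_ord0.
rewrite (_ : psum g M.+1 = (fun x => psum g M x + g M x)); first exact: ccD.
by apply/funext => x; rewrite /psum big_ord_recr.
Qed.

Lemma psum_periodic g M : (forall m, Zn_periodic (g m)) -> Zn_periodic (psum g M).
Proof. by move=> pg x k; apply: eq_bigr => m _; rewrite pg. Qed.

Lemma deviation_series g F M tau x omega T : 0 < T -> (forall m, ccontinuous (g m)) ->
  ccontinuous F -> (forall y, nm (F y - psum g M y) <= tau) ->
  nm (deviation x omega T F) <=
    \sum_(m < M) nm (deviation x omega T (g m)) + 3 * tau.
Proof.
move=> T0 cg cF H; have cS := psum_cc M cg.
have -> : F = (fun y => 1 * psum g M y + (F y - psum g M y)).
  by apply/funext => y; rewrite mul1r addrC subrK.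
have cD : ccontinuous (fun y => F y - psum g M y) by exact: ccB.
rewrite deviation_lin// mul1r; apply: le_trans (le_normcD _ _) _; apply: lerD.
  rewrite /psum deviation_sum => [|m]; last exact: cg.
  exact: nm_sum.
exact: nm_deviation_le.
Qed.

Lemma deviation_series_le g F E x omega T : 0 < T -> (forall m, ccontinuous (g m)) ->
  ccontinuous F -> unif_limit (psum g) F ->
  (forall M, \sum_(m < M) nm (deviation x omega T (g m)) <= E) ->
  nm (deviation x omega T F) <= E.
Proof.
move=> T0 cg cF gF H; apply/ler_addgt0Pr => eps e0.
have e3 : 0 < eps / 3 by rewrite divr_gt0.
have [M0 H0] := gF _ e3.
apply: le_trans (deviation_series x omega T0 cg cF (H0 M0 (leqnn _))) _.
apply: lerD => //; lra.
Qed.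

End UniformSeries.

(** * Summation of the dyadic contributions *)

Section Rates.
Context {R : realType}.

Lemma pow2_mul (a : R) m : 2 `^ (m%:R * a) = (2 `^ a) ^+ m.
Proof. by rewrite mulrC powRrM powR_mulrn ?powR_ge0. Qed.

Lemma pow2_gt1 (a : R) : 0 < a -> 1 < 2 `^ a.
Proof.
move=> a0; have := @gt0_ltr_powR R _ a0 1 2; rewrite powR1; apply;
  by rewrite ?nnegrE// ltr1n.
Qed.

Lemma pow2_lt1 (a : R) : a < 0 -> 2 `^ a < 1.
Proof.
move=> a0; rewrite -[a]opprK (powRN _ (- a)) invf_lt1 ?powR_gt0//.
by apply: pow2_gt1; rewrite oppr_gt0.
Qed.

Lemma geometric_tail (r : R) M M' : 0 <= r -> r < 1 -> (M <= M')%N ->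
  \sum_(M <= m < M') r ^+ m <= r ^+ M / (1 - r).
Proof.
move=> r0 r1 MM; rewrite -{1}[M]add0n big_addn big_mkord.
under eq_bigr do rewrite exprD mulrC.
rewrite -mulr_sumr ler_wpM2l ?exprn_ge0//; exact: geometric_sum_le.
Qed.

Lemma geometric_growth (r : R) J : 1 < r -> \sum_(m < J) r ^+ m <= r ^+ J / (r - 1).
Proof.
move=> r1; have r10 : 0 < r - 1 by rewrite subr_gt0.
by rewrite ler_pdivlMr// mulrC -subrX1 gerBl.
Qed.

(** The scale at which the low frequency and high frequency bounds meet. *)
Lemma balancing_scale (sigma T : R) : 0 < sigma -> 1 <= T -> exists J,
  [/\ (0 < J)%N, T <= (2 `^ sigma) ^+ J, (2 `^ sigma) ^+ J <= 2 `^ sigma * T &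
      J%:R <= ln T / (sigma * ln 2) + 1].
Proof.
move=> s0 T1; have T0 : 0 < T by exact: lt_le_trans T1.
have l2 : 0 < ln 2 :> R by rewrite ln_gt0// ltr1n.
have sl : 0 < sigma * ln 2 by rewrite mulr_gt0.
have lT : 0 <= ln T / (sigma * ln 2) by rewrite divr_ge0 ?ln_ge0// ltW.
pose j := Num.trunc (ln T / (sigma * ln 2)).
have /andP[j1 j2] := truncn_itv lT.
have expE (k : nat) : (2 `^ sigma) ^+ k = expR (k%:R * (sigma * ln 2)).
  by rewrite -pow2_mul /powR pnatr_eq0/= mulrA.
exists j.+1; split=> //.
- rewrite expE -[leLHS]lnK ?posrE// ler_expR.
  by rewrite -ler_pdivrMr// ltW.
- rewrite exprS ler_pM2l ?powR_gt0// expE -[leRHS]lnK ?posrE// ler_expR.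
  by rewrite -ler_pdivlMr.
- by rewrite -natr1 lerD2r.
Qed.

Section Fixed.
Context {n : nat}.
Implicit Types (g : nat -> 'rV[R]_n -> R[i]) (F : 'rV[R]_n -> R[i]).

Lemma Lpn2_le (f : 'rV[R]_n -> R[i]) c : 0 <= c -> ccontinuous f ->
  (forall x, nm (f x) <= c) -> Lpn 2 f <= c.
Proof.
move=> c0 cf fc; rewrite /Lpn.
have cf2 : continuous (fun x => nm (f x) `^ 2).
  by apply: cont_powR => // [x|]; [exact: nm_ge0|exact: cc_nm].
have le2 : torus_Rintegral (fun x => nm (f x) `^ 2) <= c `^ 2.
  rewrite -(@tI_cst R n (c `^ 2)); apply: tI_le => // [|x _]; first exact: cont_cst.
  by apply: ge0_ler_powR; rewrite ?nnegrE ?nm_ge0.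
apply: (@le_trans _ _ ((c `^ 2) `^ 2^-1)).
  apply: ge0_ler_powR => //; rewrite nnegrE ?powR_ge0//.
  by apply: tI_ge0 => // x; exact: powR_ge0.
by rewrite -powRrM mulfV ?powRr1.
Qed.

Lemma deviation_block (p sigma : R) : (0 < n)%N -> 1 < p -> p <= 2 -> 0 < sigma ->
  exists2 C, 0 < C & forall (g : 'rV[R]_n -> R[i]) m, spectrum_in (2 ^ m.+1) g ->
    forall Cw omega x T, 0 < Cw -> diophantine sigma Cw omega -> 0 < T ->
    nm (deviation x omega T g) <= C / Cw * T^-1 * ((2 `^ sigma) ^+ m * Lpn p g).
Proof.
move=> n0 p1 p2 s0; have [C C0 H] := @deviation_zcube R n p sigma n0 p1 p2 s0.
exists (C * 2 `^ sigma); first by rewrite mulr_gt0// powR_gt0.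
move=> g m gs Cw omega x T Cw0 D T0.
apply: le_trans (H g _ (spectrum_cc gs) _ gs _ _ x _ Cw0 D T0) _.
  by rewrite expn_gt0.
have -> : (2 ^ m.+1)%:R `^ sigma = 2 `^ sigma * (2 `^ sigma) ^+ m :> R.
  rewrite natrX -powR_mulrn// -powRrM mulrC (powRrM _ sigma).
  by rewrite powR_mulrn ?powR_ge0// exprS.
rewrite le_eqVlt; apply/orP; left; apply/eqP.
by move: (2 `^ sigma) (Lpn p g) => a L; ring.
Qed.

Lemma rate_ge0 (sigma s ee T : R) : 0 < T -> 0 <= rate sigma s ee T.
Proof.
move=> T0; rewrite /rate; case: ifP => _; first by rewrite invr_ge0 ltW.
by case: ifP => _; rewrite ?mulr_ge0 ?powR_ge0// invr_ge0 ltW.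
Qed.

(** The low frequencies are treated with the Diophantine condition, which costs
    [2^(m sigma) / (Cw T)], and the high ones with the size of the block, so
    that [Cw <= M0] is needed to absorb their contribution. *)
Lemma deviation_rate (sigma s ee M0 : R) : (0 < n)%N -> 0 < sigma -> 0 < s -> 0 <= ee ->
  exists2 C, 0 < C & forall g F (b : nat -> R) B,
    (forall m, spectrum_in (2 ^ m.+1) (g m)) ->
    (forall m x, nm (g m x) <= (2 `^ (- s)) ^+ m * b m) ->
    (forall m, 0 <= b m <= B) ->
    (forall J, \sum_(m < J) b m <= J%:R `^ ee * B) ->
    unif_limit (psum g) F ->
    forall (Cw : R) omega x T, 0 < Cw -> diophantine sigma Cw omega ->
    [\/ sigma < s, s = sigma /\ ee = 0 | Cw <= M0] -> admissible_time sigma s T ->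
    nm (deviation x omega T F) <= C / Cw * B * rate sigma s ee T.
Proof.
move=> n0 s0 ss0 ee0.
have [C1 C10 HC1] := @deviation_block 2 sigma n0 (ltr1n _ _ : 1 < 2 :> R) (lexx _) s0.
have l2 : 0 < ln 2 :> R by rewrite ln_gt0// ltr1n.
pose P : R := 2 `^ (- s); pose Q : R := 2 `^ (sigma - s).
have P0 : 0 < P by rewrite powR_gt0.
have P1 : P < 1 by rewrite pow2_lt1// oppr_lt0.
have Q0 : 0 < Q by rewrite powR_gt0.
have PQ m : (2 `^ sigma) ^+ m * P ^+ m = Q ^+ m.
  by rewrite -exprMn /P -powRD// pnatr_eq0 implybT.
(* [M1] is positive and [1 <= M1 / Cw] as soon as [Cw <= M0]. *)
pose M1 := `|M0| + 1; have M10 : 0 < M1 by rewrite ltr_wpDl.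
have P10 : 0 < 1 - P by rewrite subr_gt0.
pose K := 3 * M1 / (1 - P); have K0 : 0 < K by rewrite divr_gt0// mulr_gt0.
pose c := (sigma * ln 2)^-1 + (ln 2)^-1.
have c0 : 0 < c by rewrite addr_gt0// invr_gt0// mulr_gt0.
(* One constant for each position of [s] relative to [sigma]: above, equal, below. *)
pose Ca := C1 / `|1 - Q|.
pose Cb := C1 * c `^ ee + K / (ln 2) `^ ee.
pose Cd := C1 * Q / `|1 - Q| + K.
have Ca0 : 0 <= Ca by rewrite divr_ge0// ltW.
have Cb0 : 0 <= Cb.
  by rewrite addr_ge0 ?divr_ge0 ?mulr_ge0 ?powR_ge0// ltW.
have Cd0 : 0 <= Cd.
  by rewrite addr_ge0 ?divr_ge0 ?mulr_ge0// ltW.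
exists (C1 + Ca + Cb + Cd); first by rewrite !ltr_wpDr.
move=> g F b B gs gb bB bsum gF Cw omega x T Cw0 D hyp adm.
have B0 : 0 <= B by have /andP[b0 /(le_trans b0)] := bB 0%N.
have T0 : 0 < T.
  by move: adm; rewrite /admissible_time; case: ifP => // _; lra.
have Rt := rate_ge0 sigma s ee T0.
suff main C' : C' <= C1 + Ca + Cb + Cd ->
    nm (deviation x omega T F) <= C' / Cw * B * rate sigma s ee T ->
    nm (deviation x omega T F) <= (C1 + Ca + Cb + Cd) / Cw * B * rate sigma s ee T.
  have cg m := spectrum_cc (gs m); have pg m := spectrum_periodic (gs m).
  have cF : ccontinuous F.
    by apply: unif_limit_cc gF => M; [exact: psum_cc|exact: psum_periodic].
  have gc m : nm (deviation x omega T (g m)) <= C1 / Cw * T^-1 * (Q ^+ m * b m).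
    apply: le_trans (HC1 _ m (gs m) _ _ x _ Cw0 D T0) _.
    have /andP[bm0 _] := bB m.
    rewrite ler_pM2l ?mulr_gt0 ?invr_gt0// -PQ -mulrA ler_pM2l ?exprn_gt0 ?powR_gt0//.
    by apply: Lpn2_le => //; rewrite mulr_ge0// exprn_ge0// ltW.
  have low J : \sum_(m < J) nm (deviation x omega T (g m)) <=
      C1 / Cw * T^-1 * \sum_(m < J) Q ^+ m * b m.
    by rewrite mulr_sumr; apply: ler_sum => m _; exact: gc.
  have CT : 0 < C1 / Cw * T^-1 by rewrite !mulr_gt0 ?invr_gt0.
  have lowB J : \sum_(m < J) Q ^+ m * b m <= (\sum_(m < J) Q ^+ m) * B.
    rewrite mulr_suml; apply: ler_sum => m _; rewrite ler_pM2l ?exprn_gt0//.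
    by case/andP: (bB m).
  have tail J y : nm (F y - psum g J y) <= P ^+ J / (1 - P) * B.
    apply: (unif_limit_tail gF gb) => M' JM.
    apply: (@le_trans _ _ ((\sum_(J <= m < M') P ^+ m) * B)).
      rewrite mulr_suml; apply: ler_sum => m _; rewrite ler_pM2l ?exprn_gt0//.
      by case/andP: (bB m).
    by rewrite ler_wpM2r// geometric_tail// ltW.
  have split J : nm (deviation x omega T F) <=
      C1 / Cw * T^-1 * (\sum_(m < J) Q ^+ m * b m) + 3 * (P ^+ J / (1 - P) * B).
    apply: le_trans (deviation_series x omega T0 cg cF (tail J)) _.
    by rewrite lerD.
  have M1C : Cw <= M0 -> 1 <= M1 / Cw.
    move=> CM; rewrite ler_pdivlMr// mul1r (le_trans CM)//.
    by rewrite (le_trans (ler_norm _))// lerDl.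
  have [ss|ss] := ltP sigma s.
    (* The low frequency bounds are summable over all scales. *)
    have Q1 : Q < 1 by rewrite pow2_lt1// subr_lt0.
    have Q10 : 0 < 1 - Q by rewrite subr_gt0.
    apply: (main Ca); first by move: C10 Ca0 Cb0 Cd0; clear; lra.
    rewrite /rate ss; apply: (deviation_series_le T0 cg cF gF) => J.
    apply: le_trans (low J) _.
    have -> : Ca / Cw * B / T = C1 / Cw * T^-1 * ((1 - Q)^-1 * B).
      by rewrite /Ca gtr0_norm//; move: (Q) (B) => *; ring.
    rewrite ler_pM2l//; apply: le_trans (lowB J) _.
    by rewrite ler_wpM2r// geometric_sum_le// ltW.
  have [ss'|ss'] := eqVneq s sigma.
    have Q1 : Q = 1 by rewrite /Q ss' subrr powRr0.
    have lowC J : \sum_(m < J) Q ^+ m * b m <= J%:R `^ ee * B.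
      by apply: le_trans (bsum J); under eq_bigr do rewrite Q1 expr1n mul1r.
    have rE : rate sigma s ee T = T^-1 * ln T `^ ee by rewrite /rate ltNge ss/= ss' eqxx.
    have T2 : 2 <= T by move: adm; rewrite /admissible_time ss' eqxx.
    case: hyp => [|[_ ee00]|CM]; first by rewrite ltNge ss.
      apply: (main C1); first by move: C10 Ca0 Cb0 Cd0; clear; lra.
      rewrite rE ee00 powRr0 mulr1.
      apply: (deviation_series_le T0 cg cF gF) => J.
      apply: le_trans (low J) _; have := lowC J; rewrite ee00 powRr0 mul1r => h.
      by rewrite -[leRHS]mulrA [B * _]mulrC mulrA ler_pM2l.
    apply: (main Cb); first by move: C10 Ca0 Cb0 Cd0; clear; lra.
    have T1 : 1 <= T by apply: le_trans T2; rewrite ler1n.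
    have [J [J0 TW _ JL]] := balancing_scale s0 T1.
    have L2 : ln 2 <= ln T by rewrite ler_ln ?posrE.
    have L0 : 0 < ln T by exact: lt_le_trans L2.
    have PT : P ^+ J <= T^-1.
      rewrite /P (powRN _ s) ss' exprVn lef_pV2 ?posrE// exprn_gt0// powR_gt0//.
    have JT : J%:R `^ ee <= c `^ ee * ln T `^ ee.
      rewrite -powRM ?(ltW c0) ?(ltW L0)//; apply: ge0_ler_powR;
        rewrite ?nnegrE ?mulr_ge0 ?(ltW c0) ?(ltW L0)//.
      apply: le_trans JL _; rewrite /c mulrDl mulrC lerD2l.
      by rewrite ler_pdivlMl// mulr1.
    (* The high frequencies carry no logarithm; it is supplied by [T >= 2]. *)
    have LL : 1 <= ln T `^ ee / ln 2 `^ ee.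
      rewrite ler_pdivlMr ?powR_gt0// mul1r; apply: ge0_ler_powR => //;
        by rewrite nnegrE ltW.
    apply: le_trans (split J) _; rewrite rE.
    have -> : Cb / Cw * B * (T^-1 * ln T `^ ee) =
       C1 / Cw * T^-1 * (c `^ ee * ln T `^ ee * B) +
       3 * (T^-1 / (1 - P) * B) * ((M1 / Cw) * (ln T `^ ee / ln 2 `^ ee)).
      rewrite /Cb /K; move: (c `^ ee) (ln T `^ ee) (ln 2 `^ ee) (1 - P) (M1) (B) => *; ring.
    apply: lerD.
      rewrite ler_pM2l//; apply: le_trans (lowC J) _.
      by rewrite ler_wpM2r.
    have h1 := M1C CM.
    have X0 : 0 <= 3 * (T^-1 / (1 - P) * B).
      by rewrite !mulr_ge0// ?invr_ge0 ltW.
    apply: (@le_trans _ _ (3 * (T^-1 / (1 - P) * B))).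
      by rewrite ler_pM2l// ler_wpM2r// ler_pM2r// invr_gt0.
    by rewrite ler_peMr// -[leLHS]mulr1 ler_pM.
  have ss1 : s < sigma by rewrite lt_neqAle ss' ss.
  have Q1 : 1 < Q by rewrite pow2_gt1// subr_gt0.
  have Q10 : 0 < Q - 1 by rewrite subr_gt0.
  case: hyp => [|[sE _]|CM]; first by rewrite ltNge ss.
    by move: ss'; rewrite sE eqxx.
  have rE : rate sigma s ee T = T `^ (- (s / sigma)).
    by rewrite /rate ltNge ss/= (negbTE ss').
  have Tr0 : 0 < T `^ (- (s / sigma)) by rewrite powR_gt0.
  have h1 := M1C CM.
  apply: (main Cd); first by move: C10 Ca0 Cb0 Cd0; clear; lra.
  have KE : K / Cw * B * T `^ (- (s / sigma)) =
      3 * (T `^ (- (s / sigma)) / (1 - P) * B) * (M1 / Cw).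
    by rewrite /K; move: (T `^ _) (1 - P) (M1) (B) => *; ring.
  have high (X : R) : X <= T `^ (- (s / sigma)) ->
      3 * (X / (1 - P) * B) <= K / Cw * B * T `^ (- (s / sigma)).
    move=> XT; rewrite KE.
    apply: (@le_trans _ _ (3 * (T `^ (- (s / sigma)) / (1 - P) * B))).
      by rewrite ler_pM2l// ler_wpM2r// ler_pM2r// invr_gt0.
    by rewrite ler_peMr// !mulr_ge0// ?invr_ge0 ltW.
  have CdE : Cd / Cw * B * T `^ (- (s / sigma)) =
      C1 / Cw * (Q / (Q - 1) * B * T `^ (- (s / sigma))) + K / Cw * B * T `^ (- (s / sigma)).
    rewrite /Cd distrC gtr0_norm//; move: (T `^ _) (Q) (K) (B) => *; ring.
  rewrite rE CdE; have [T1|T1] := leP 1 T; last first.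
    (* For short times the trivial bound on the whole series is enough. *)
    apply: le_trans (split 0%N) _; rewrite big_ord0 mulr0; apply: lerD.
      by rewrite !mulr_ge0// ?invr_ge0 ltW.
    apply: high; rewrite expr0 powRN -[leLHS]invr1 lef_pV2 ?posrE ?powR_gt0//.
    rewrite -[leRHS](powRr0 T); apply: ger_powR; first by rewrite T0 ltW.
    by rewrite divr_ge0 ?(ltW ss0) ?(ltW s0).
  have [J [_ TW WT _]] := balancing_scale s0 T1.
  have sn0 : sigma != 0 by rewrite gt_eqF.
  have W0 : 0 < (2 `^ sigma) ^+ J :> R by rewrite exprn_gt0// powR_gt0.
  have PT : P ^+ J <= T `^ (- (s / sigma)).
    have -> : P ^+ J = ((2 `^ sigma) ^+ J) `^ (- (s / sigma)).
      rewrite -(pow2_mul sigma) -powRrM /P -pow2_mul; congr (_ `^ _).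
      by field.
    rewrite !(powRN _ (s / sigma)) lef_pV2 ?posrE ?powR_gt0//.
    by apply: ge0_ler_powR; rewrite ?nnegrE ?divr_ge0// ltW.
  have QT : T^-1 * Q ^+ J <= Q * T `^ (- (s / sigma)).
    have th0 : 0 <= 1 - s / sigma by rewrite subr_ge0 ler_pdivrMr// mul1r ltW.
    have QE (k : nat) : Q ^+ k = ((2 `^ sigma) ^+ k) `^ (1 - s / sigma).
      by rewrite -(pow2_mul sigma) -powRrM /Q -pow2_mul; congr (_ `^ _); field.
    rewrite ler_pdivrMl//.
    have -> : T * (Q * T `^ (- (s / sigma))) = (2 `^ sigma * T) `^ (1 - s / sigma).
      rewrite powRM ?powR_ge0 ?(ltW T0)// -[X in _ = X `^ _ * _]expr1 -QE expr1.
      rewrite mulrCA; congr (_ * _); rewrite -{1}[T]powRr1 ?(ltW T0)//.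
      by rewrite -powRD// (gt_eqF T0) implybT.
    rewrite QE; apply: ge0_ler_powR => //; rewrite nnegrE ltW//.
    by rewrite mulr_gt0// powR_gt0.
  apply: le_trans (split J) _; apply: lerD; last exact: high.
  rewrite -[leLHS]mulrA ler_pM2l ?mulr_gt0 ?invr_gt0//.
  apply: (@le_trans _ _ (T^-1 * (Q ^+ J / (Q - 1) * B))).
    rewrite ler_pM2l ?invr_gt0//; apply: le_trans (lowB J) _.
    by rewrite ler_wpM2r// geometric_growth.
  have -> : T^-1 * (Q ^+ J / (Q - 1) * B) = T^-1 * Q ^+ J * ((Q - 1)^-1 * B) by ring.
  have -> : Q / (Q - 1) * B * T `^ (- (s / sigma)) =
     Q * T `^ (- (s / sigma)) * ((Q - 1)^-1 * B).
    by move: (T `^ _) => *; ring.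
  by rewrite ler_wpM2r// mulr_ge0// invr_ge0 ltW.
move=> C'C H; apply: le_trans H _.
by rewrite ler_wpM2r// ler_wpM2r// ler_pM2r// invr_gt0.
Qed.

End Fixed.
End Rates.

(** * Besov regularity *)

Section BesovErgodic.
Context {R : realType} {n : nat} {chi : R -> R}.
Hypothesis n0 : (0 < n)%N.
Hypothesis hchi : besov_cutoff chi.
Implicit Types (f F : 'rV[R]_n -> R[i]) (u : ('rV[R]_n -> R[i]) -> R[i]).
Implicit Types (b : nat -> R).

Lemma fcoef_psum (g : nat -> 'rV[R]_n -> R[i]) M k : (forall m, ccontinuous (g m)) ->
  fcoef (psum g M) k = \sum_(m < M) fcoef (g m) k.
Proof.
move=> cg; elim: M => [|M IH].
  rewrite big_ord0 (_ : psum g 0 = (fun=> 0)).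
    rewrite /fcoef; under [X in torus_integral X]eq_fun do rewrite mul0r.
    exact: cI_cst.
  by apply/funext => x; rewrite /psum big_ord0.
rewrite big_ord_recr/= -IH (_ : psum g M.+1 = (fun x => 1 * psum g M x + g M x)).
  by rewrite fcoef_lin ?mul1r//; exact: psum_cc.
by apply/funext => x; rewrite /psum big_ord_recr mul1r.
Qed.

(** The partial sums converge uniformly to a function with the Fourier coefficients
    of [u].  It represents [u], and [fourier_uniqueness] identifies it with any
    other continuous representative. *)
Lemma block_series u (a : nat -> R) A : torus_distribution u ->
  (forall m x, nm (dyadic_block chi m u x) <= a m) ->
  (forall M, \sum_(m < M) a m <= A) ->
  (exists f, continuous_representative u f) /\
  forall f, continuous_representative u f ->
    unif_limit (psum (fun m => dyadic_block chi m u)) f.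
Proof.
move=> du ga aA; set g := fun m => dyadic_block chi m u.
have [F gF] := unif_series ga aA.
have cg m : ccontinuous (g m) := spectrum_cc (spectrum_block hchi m u).
have pg m : Zn_periodic (g m) := spectrum_periodic (spectrum_block hchi m u).
have cS M := psum_cc M cg; have pS M : Zn_periodic (psum g M) by exact: psum_periodic.
have cF := unif_limit_cc cS pS gF; have pF := unif_limit_periodic pS gF.
have Fu k : fcoef F k = fourier_coef u k.
  apply: (unif_limit_fcoef cS cF gF).
  have [M0 H] := cutoff_sum_eventually hchi (sqrtr_ge0 _ : 0 <= enorm (vec_of_int k)).
  exists M0.+1 => -[//|M] MM; rewrite fcoef_psum//.
  under eq_bigr do rewrite fcoef_block//.
  by rewrite -mulr_suml -rmorph_sum/= H// mul1r.
have repF := continuous_representativeP du cF pF Fu.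
split; first by exists F.
move=> f fu; have [pf cf _] := fu.
by rewrite (fourier_uniqueness cf pf cF pF)// => k; rewrite (representative_fcoef k fu) Fu.
Qed.

Lemma besov_block_norm s p u m (bm : R) : besov_term chi s p u m = bm%:E ->
  torus_Lp_norm p (dyadic_block chi m u) =
    ((2 `^ (- s)) ^+ m * (2 `^ s * bm))%:E.
Proof.
rewrite /besov_term => H.
have X0 := torus_Lp_norm_ge0 p (dyadic_block chi m u).
have c0 : 0 < 2 `^ ((m%:R - 1) * s) :> R by rewrite powR_gt0.
move: X0 H; case: torus_Lp_norm => [x| |]//= x0.
  move=> -[<-]; congr _%:E.
  rewrite mulrA mulrA -pow2_mul -!powRD ?pnatr_eq0 ?implybT//.
  have -> : m%:R * - s + s + (m%:R - 1) * s = 0 by ring.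
  by rewrite powRr0 mul1r.
by rewrite gt0_muley ?lte_fin.
Qed.

Lemma psum_weighted (P B : R) b J : 0 < P -> P < 1 -> (forall m, 0 <= b m <= B) ->
  \sum_(m < J) P ^+ m * b m <= (1 - P)^-1 * B.
Proof.
move=> P0 P1 bB; have B0 : 0 <= B by have /andP[b0 /(le_trans b0)] := bB 0%N.
apply: (@le_trans _ _ ((\sum_(m < J) P ^+ m) * B)).
  rewrite mulr_suml; apply: ler_sum => m _; rewrite ler_pM2l ?exprn_gt0//.
  by case/andP: (bB m).
by rewrite ler_wpM2r// geometric_sum_le// ltW.
Qed.

Lemma conjugate_inv_ge0 (q : \bar R) : (1 <= q)%E -> 0 <= conjugate_inv q.
Proof.
case: q => [r||]//= r1; rewrite lee_fin in r1.
by rewrite subr_ge0 invf_le1// (lt_le_trans ltr01).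
Qed.

(** The blocks satisfy the hypotheses of [deviation_rate] with [ee = 1 - 1/q]. *)
Lemma besov_sup_ergodic (sigma s : R) (q : \bar R) (M : R) :
  0 < sigma -> 0 < s -> (1 <= q)%E ->
  exists C : R, 0 < C /\
  forall u, in_besov chi s +oo%E q u ->
    (exists f, continuous_representative u f) /\
    forall f, continuous_representative u f ->
    forall (Comega : R) (omega x : 'rV[R]_n) (T : R),
      0 < Comega -> diophantine sigma Comega omega ->
      [\/ sigma < s, s = sigma /\ q = 1%E | Comega <= M] ->
      admissible_time sigma s T ->
      ergodic_error f x omega T <=
        C / Comega * fine (besov_norm chi s +oo%E q u) *
        rate sigma s (conjugate_inv q) T.
Proof.
move=> s0 ss0 q1.
have [C C0 HC] := @deviation_rate R n sigma s _ M n0 s0 ss0 (conjugate_inv_ge0 q1).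
exists (C * 2 `^ s); split; first by rewrite mulr_gt0// powR_gt0.
move=> u ub; have [du _] := ub.
have [b [B0 bE bB bsum]] := besov_terms q1 ub.
set B := fine _ in B0 bB bsum *.
have S0 : 0 < 2 `^ s :> R by rewrite powR_gt0.
pose P : R := 2 `^ (- s); have P0 : 0 < P by rewrite powR_gt0.
have P1 : P < 1 by rewrite pow2_lt1// oppr_lt0.
have gb m x : nm (dyadic_block chi m u x) <= P ^+ m * (2 `^ s * b m).
  have := besov_block_norm (bE m); rewrite /torus_Lp_norm => E.
  have := @sup_norm_finite _ _ (dyadic_block chi m u); rewrite E ltry.
  by move=> /(_ isT x).
have bB' m : 0 <= 2 `^ s * b m <= 2 `^ s * B.
  by have /andP[b0 bB0] := bB m; rewrite mulr_ge0 ?(ltW S0)//= ler_pM2l.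
have [ex lim] := block_series du gb (fun J => psum_weighted J P0 P1 bB').
split=> // f /lim fl Cw omega x T Cw0 D hyp adm.
rewrite ergodic_errorE.
have -> : C * 2 `^ s / Cw * B = C / Cw * (2 `^ s * B).
  by move: (2 `^ s) => S; ring.
apply: (HC _ f _ (2 `^ s * B) (fun m => spectrum_block hchi m u) gb bB') => //.
- move=> J; rewrite -mulr_sumr mulrCA ler_pM2l//; exact: bsum.
- case: hyp => [?|[? ->]|?]; [by constructor 1|constructor 2|by constructor 3].
  by rewrite /conjugate_inv invr1 subrr.
Qed.

(** If [t < s] the weights are summable and bounded terms are enough; if [t = s] the
    weights are trivial and the terms are summable because [q = 1]. *)
Lemma weighted_besov_sum (t s : R) (q : \bar R) :
  (q = 1%E /\ t <= s) \/ ((1 < q)%E /\ t < s) ->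
  exists2 K : R, 0 < K & forall b B, (forall m, 0 <= b m <= B) ->
    (forall J, \sum_(m < J) b m <= J%:R `^ conjugate_inv q * B) ->
    forall J, \sum_(m < J) (2 `^ (t - s)) ^+ m * b m <= K * B.
Proof.
case=> [[-> ts]|[_ ts]].
  exists 1 => // b B bB bsum J; rewrite mul1r.
  have := bsum J; rewrite /conjugate_inv invr1 subrr powRr0 mul1r; apply: le_trans.
  apply: ler_sum => m _; have /andP[b0 _] := bB m.
  have Q1 : 2 `^ (t - s) <= 1 :> R.
    have [->|tns] := eqVneq t s; first by rewrite subrr powRr0.
    by apply/ltW/pow2_lt1; rewrite subr_lt0 lt_neqAle tns.
  by rewrite ler_piMl// exprn_ile1// powR_ge0.
have P1 : 2 `^ (t - s) < 1 :> R by rewrite pow2_lt1// subr_lt0.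
exists (1 - 2 `^ (t - s))^-1; first by rewrite invr_gt0 subr_gt0.
by move=> b B bB _ J; apply: psum_weighted; rewrite ?powR_gt0.
Qed.

(** The sup norm is at most the sum of the coefficients, to which [sum_fcoef_le]
    applies; a cube of size [2^(m+1)] has fewer than [2^((m+3)n)] frequencies. *)
Lemma bernstein (p : R) (g : 'rV[R]_n -> R[i]) m x : 1 < p -> p <= 2 ->
  spectrum_in (2 ^ m.+1) g ->
  nm (g x) <= 2 `^ (3 * (n%:R / p)) * (2 `^ (n%:R / p)) ^+ m * Lpn p g.
Proof.
move=> p1 p2 gs; have p0 : 0 < p by exact: lt_trans p1.
have cg := spectrum_cc gs.
rewrite [in leLHS]gs; apply: le_trans (nm_sum _ _ _) _.
under eq_bigr do rewrite Normc.normcM nm_mode mulr1.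
apply: le_trans (sum_fcoef_le cg (zcube_uniq _) p1 p2) _.
rewrite ler_wpM2r ?powR_ge0// zcube_size.
have -> : 2 `^ (3 * (n%:R / p)) * (2 `^ (n%:R / p)) ^+ m =
    ((2 ^ m.+3) ^ n)%:R `^ p^-1 :> R.
  rewrite -pow2_mul -powRD ?pnatr_eq0 ?implybT// !natrX.
  rewrite -[(2 ^+ m.+3) ^+ n]exprM -powR_mulrn// -powRrM; congr (_ `^ _).
  by rewrite natrM -addn3 natrD; field; rewrite gt_eqF.
apply: ge0_ler_powR; rewrite ?nnegrE ?invr_ge0 ?(ltW p0)// ler_nat.
by rewrite leq_exp2r// !expnS; have := expn_gt0 2 m; lia.
Qed.

(** Two weighted sums of the blocks are needed: with [n/p - s] for their uniform
    convergence, by [bernstein], and with [sigma - s] for their ergodic errors. *)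
Lemma besov_Lp_ergodic (sigma s p : R) (q : \bar R) :
  0 < sigma -> 1 < p -> p <= 2 -> (1 <= q)%E ->
  (q = 1%E /\ Num.max sigma (n%:R / p) <= s) \/
  ((1 < q)%E /\ Num.max sigma (n%:R / p) < s) ->
  exists C : R, 0 < C /\
  forall u, in_besov chi s p%:E q u ->
    (exists f, continuous_representative u f) /\
    forall f, continuous_representative u f ->
    forall (Comega : R) (omega x : 'rV[R]_n) (T : R),
      0 < Comega -> diophantine sigma Comega omega -> 0 < T ->
      ergodic_error f x omega T <=
        C / Comega * fine (besov_norm chi s p%:E q u) * T^-1.
Proof.
move=> s0 p1 p2 q1 hq.
have [K1 K10 HK1] : exists2 K : R, 0 < K & forall b B, (forall m, 0 <= b m <= B) ->
    (forall J, \sum_(m < J) b m <= J%:R `^ conjugate_inv q * B) ->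
    forall J, \sum_(m < J) (2 `^ (sigma - s)) ^+ m * b m <= K * B.
  apply: weighted_besov_sum; case: hq => -[h hs]; [left|right]; split=> //.
    by move: hs; rewrite ge_max => /andP[].
  by move: hs; rewrite gt_max => /andP[].
have [K2 K20 HK2] : exists2 K : R, 0 < K & forall b B, (forall m, 0 <= b m <= B) ->
    (forall J, \sum_(m < J) b m <= J%:R `^ conjugate_inv q * B) ->
    forall J, \sum_(m < J) (2 `^ (n%:R / p - s)) ^+ m * b m <= K * B.
  apply: weighted_besov_sum; case: hq => -[h hs]; [left|right]; split=> //.
    by move: hs; rewrite ge_max => /andP[].
  by move: hs; rewrite gt_max => /andP[].
have [C C0 HC] := @deviation_block R n p sigma n0 p1 p2 s0.
have S0 : 0 < 2 `^ s :> R by rewrite powR_gt0.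
exists (C * 2 `^ s * K1); split; first by rewrite !mulr_gt0.
move=> u ub; have [du _] := ub.
have [b [B0 bE bB bsum]] := besov_terms q1 ub.
set B := fine _ in B0 bB bsum *.
have gL m : Lpn p (dyadic_block chi m u) = (2 `^ (- s)) ^+ m * (2 `^ s * b m).
  by have [] := besov_block_norm (bE m).
pose a m := 2 `^ (3 * (n%:R / p)) * 2 `^ s * ((2 `^ (n%:R / p - s)) ^+ m * b m) : R.
have ga m x : nm (dyadic_block chi m u x) <= a m.
  apply: le_trans (bernstein x p1 p2 (spectrum_block hchi m u)) _.
  rewrite gL /a powRD ?pnatr_eq0 ?implybT// exprMn.
  rewrite le_eqVlt; apply/orP; left; apply/eqP.
  by move: (2 `^ s) (2 `^ (3 * _)) (_ ^+ m) (_ ^+ m) => *; ring.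
have aA J : \sum_(m < J) a m <= 2 `^ (3 * (n%:R / p)) * 2 `^ s * (K2 * B).
  by rewrite -mulr_sumr ler_wpM2l ?mulr_ge0 ?powR_ge0// HK2.
have [ex lim] := block_series du ga aA.
split=> // f /[dup] fu /lim fl Cw omega x T Cw0 D T0.
have cf : ccontinuous f by case: fu.
have cg m : ccontinuous (dyadic_block chi m u) := spectrum_cc (spectrum_block hchi m u).
rewrite ergodic_errorE; apply: (deviation_series_le T0 cg cf fl) => J.
have CT : 0 < C / Cw * T^-1 * 2 `^ s by rewrite !mulr_gt0 ?invr_gt0.
apply: (@le_trans _ _ (C / Cw * T^-1 * 2 `^ s *
    \sum_(m < J) (2 `^ (sigma - s)) ^+ m * b m)).
  rewrite mulr_sumr; apply: ler_sum => m _.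
  apply: le_trans (HC _ m (spectrum_block hchi m u) _ _ x _ Cw0 D T0) _.
  rewrite gL powRD ?pnatr_eq0 ?implybT// exprMn.
  rewrite le_eqVlt; apply/orP; left; apply/eqP.
  by move: (2 `^ s) (_ ^+ m) (_ ^+ m) => *; ring.
have -> : C * 2 `^ s * K1 / Cw * B / T = C / Cw * T^-1 * 2 `^ s * (K1 * B).
  by move: (2 `^ s) => *; ring.
by rewrite ler_pM2l// HK1.
Qed.

End BesovErgodic.

(** * Hoelder regularity *)

Section CoordinateAverage.
Context {R : realType} {n : nat} (i : 'I_n) (M : nat).
Hypothesis M0 : (0 < M)%N.
Local Notation I := torus_Rintegral.
Local Notation delta := (delta_mx ord0 i : 'rV[R]_n).
Local Notation K y := (kern M ((y : 'rV[R]_n) ord0 i)).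
Implicit Types (f g : 'rV[R]_n -> R[i]) (x y : 'rV[R]_n).

Definition good f := ccontinuous f /\ Zn_periodic f.

Lemma good_lin a f g : good f -> good g -> good (fun x => a * f x + g x).
Proof.
move=> [cf pf] [cg pg]; split; first exact: cc_lin.
by move=> x k; rewrite pf pg.
Qed.

Lemma good_shift f h : good f -> good (fun x => f (x + h)).
Proof.
move=> [cf pf]; split; first exact: cc_shift.
by move=> x k; rewrite addrAC pf.
Qed.

(** Convolution with the kernel in coordinate [i].  The integral runs over the whole
    torus, although only [y_i] occurs, so that [cI_swap] applies to it. *)
Definition average f x : R[i] := cI (fun y => f (x + y ord0 i *: delta) * (K y)%:C).

Lemma norm_delta (t : R) : `|t *: delta| <= `|t|.
Proof.
apply/rV_normP => // j; rewrite !mxE eqxx/=.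
by case: (j == i); rewrite ?mulr1 ?mulr0 ?normr0.
Qed.

Lemma cc_line f x : good f -> ccontinuous (fun y => f (x + y ord0 i *: delta)).
Proof.
move=> [cf pf]; apply: cuniform_cc => eps /(zper_cuniform cf pf)[d d0 H].
exists d => // y y' yy'; apply: H; rewrite opprD addrACA subrr add0r -scalerBl.
apply: le_trans (norm_delta _) _; rewrite -subrVE.
exact: le_trans (coord_le_norm _ _) yy'.
Qed.

Lemma cc_kern : ccontinuous (fun y => (K y)%:C).
Proof. by apply: cc_real; exact: cont_kern_coord. Qed.

Lemma nm_cI_kern h c : ccontinuous h -> (forall y, nm (h y) <= c) ->
  nm (cI (fun y => h y * (K y)%:C)) <= c.
Proof.
move=> ch hc; apply: le_trans (nm_cI _) _; first exact: (ccM ch cc_kern).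
rewrite -[leRHS]mulr1 -(@kern_coord_mean R n M i M0) -tIZ; last exact: cont_kern_coord.
apply: tI_le => [||y _].
- exact/cc_nm/(ccM ch cc_kern).
- by apply: contM; [exact: cont_cst|exact: cont_kern_coord].
by rewrite Normc.normcM nm_real ger0_norm ?kern_ge0// ler_wpM2r ?kern_ge0.
Qed.

Lemma average_lin a f g x : good f -> good g ->
  average (fun y => a * f y + g y) x = a * average f x + average g x.
Proof.
move=> gf gg; rewrite /average -cI_lin; try exact: (ccM (cc_line x _) cc_kern).
by congr cI; apply/funext => y; rewrite mulrDl mulrA.
Qed.

Lemma average_shift f h x : average (fun y => f (y + h)) x = average f (x + h).
Proof. by rewrite /average; congr cI; apply/funext => y; rewrite addrAC. Qed.

Lemma good_average f : good f -> good (average f).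
Proof.
move=> gf; have [cf pf] := gf; split.
  apply: cuniform_cc => eps /(zper_cuniform cf pf)[d d0 H].
  exists d => // x x' xx'.
  rewrite /average -cIB; try exact: (ccM (cc_line _ gf) cc_kern).
  have -> : (fun y => f (x + y ord0 i *: delta) * (K y)%:C -
                      f (x' + y ord0 i *: delta) * (K y)%:C) =
            (fun y => (f (x + y ord0 i *: delta) - f (x' + y ord0 i *: delta)) * (K y)%:C).
    by apply/funext => y; rewrite mulrBl.
  apply: nm_cI_kern; first by apply: ccB; exact: cc_line.
  by move=> y; apply: H; rewrite opprD addrACA subrr addr0.
by move=> x k; rewrite -average_shift; congr (average _ x); apply/funext => y; rewrite pf.
Qed.

Lemma nm_average f c x : good f -> (forall y, nm (f y) <= c) -> nm (average f x) <= c.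
Proof. by move=> gf fc; apply: nm_cI_kern => //; exact: cc_line. Qed.

Lemma nm_mulB (z z' w w' : R[i]) (A B ez ew : R) : nm z' <= A -> nm w <= B ->
  nm (z - z') <= ez -> nm (w - w') <= ew -> nm (z * w - z' * w') <= ez * B + A * ew.
Proof.
move=> zA wB zz ww.
have -> : z * w - z' * w' = (z - z') * w + z' * (w - w') by ring.
apply: le_trans (le_normcD _ _) _; rewrite !Normc.normcM.
by apply: lerD; apply: ler_pM; rewrite ?nm_ge0.
Qed.

(** By Fubini's theorem the integral in [x] can be taken first, where the shift by
    [y_i] along the coordinate axis only produces a phase. *)
Lemma fcoef_average f k : good f ->
  fcoef (average f) k =
    cI (fun y => e (kvec i (k ord0 i)) y * (K y)%:C) * fcoef f k.
Proof.
move=> gf; have [cf pf] := gf.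
pose G x y := f (x + y ord0 i *: delta) * e (- k) x * (K y)%:C.
have [A A0 fA] := zper_cbounded cf pf.
have cm := @cc_mode R n (- k); have pm := @mode_periodic R n (- k).
have pK : Zn_periodic (fun y => (K y)%:C).
  have [s Hs] := @is_trig_kern R n M i.
  by move=> x l; rewrite !Hs trig_periodic.
have [B B0 KB] := zper_cbounded cc_kern pK.
have m1 x : nm (e (- k) x : R[i]) <= 1 by rewrite nm_mode.
have AB : 0 < (A + 1) * B by rewrite mulr_gt0// addr_gt0.
have small eps : 0 < eps -> 0 < eps / ((A + 1) * B) by move=> ?; rewrite divr_gt0.
have AB1 : 0 < A + B by rewrite addr_gt0.
have Hx eps : 0 < eps -> exists2 d, 0 < d & forall x x' y,
    `|x - x'| <= d -> nm (G x y - G x' y) <= eps.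
  move=> e0; have e1 := small _ e0.
  have [d1 d10 H1] := zper_cuniform cf pf e1.
  have [d2 d20 H2] := zper_cuniform cm pm e1.
  exists (Num.min d1 d2) => [|x x' y]; first by rewrite lt_min d10.
  rewrite le_min => /andP[x1 x2]; rewrite /G -mulrBl Normc.normcM.
  have -> : eps = (eps / ((A + 1) * B) * 1 + A * (eps / ((A + 1) * B))) * B.
    by field; rewrite !gt_eqF// addr_gt0.
  apply: ler_pM; rewrite ?nm_ge0//.
  apply: nm_mulB => //; last exact: H2.
  by apply: H1; rewrite opprD addrACA subrr addr0.
have Hy eps : 0 < eps -> exists2 d, 0 < d & forall x y y',
    `|y - y'| <= d -> nm (G x y - G x y') <= eps.
  move=> e0; have e1 : 0 < eps / (A + B) by rewrite divr_gt0.
  have [d1 d10 H1] := zper_cuniform cf pf e1.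
  have [d2 d20 H2] := zper_cuniform cc_kern pK e1.
  exists (Num.min d1 d2) => [|x y y']; first by rewrite lt_min d10.
  rewrite le_min => /andP[y1 y2].
  have -> : G x y - G x y' = e (- k) x *
    (f (x + y ord0 i *: delta) * (K y)%:C - f (x + y' ord0 i *: delta) * (K y')%:C).
    by rewrite /G; ring.
  rewrite Normc.normcM nm_mode mul1r.
  have -> : eps = eps / (A + B) * B + A * (eps / (A + B)).
    by field; rewrite gt_eqF.
  apply: nm_mulB => //; last exact: H2.
  apply: H1; rewrite opprD addrACA subrr add0r -scalerBl -subrVE.
  exact: le_trans (norm_delta _) (le_trans (coord_le_norm _ _) y1).
have cGy x : ccontinuous (fun y => f (x + y ord0 i *: delta) * (K y)%:C).
  exact: (ccM (cc_line x gf) cc_kern).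
have -> : fcoef (average f) k = cI (fun x => cI (fun y => G x y)).
  congr cI; apply/funext => x; rewrite /average mulrC -cIZ//.
  by congr cI; apply/funext => y; rewrite /G mulrCA mulrA.
rewrite (cI_swap Hx Hy) mulrC -cIZ; last exact: (ccM (cc_mode _) cc_kern).
congr cI; apply/funext => y.
have -> : (fun x => G x y) =
   (fun x => (K y)%:C * (f (x + y ord0 i *: delta) * e (- k) x)).
  by apply/funext => x; rewrite /G mulrC.
rewrite cIZ; last by apply: ccM => //; exact: cc_shift.
rewrite -/(fcoef (fun x => f (x + y ord0 i *: delta)) k) fcoef_shift//.
rewrite mode_kvec modeE dotZr dot_delta mxE.
rewrite [(k ord0 i)%:~R * _]mulrC; ring.
Qed.

(** The modulus of continuity is weighed against the second moment of the kernel
    by [M^a d^a <= 1 + (M d)^2]; this is where the order [M^-2] of that moment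
    is needed, up to [a = 1]. *)
Lemma average_error (c : R) f (a H : R) : 0 < c ->
  (forall t, 0 <= t <= 1 / 2 -> c * t ^+ 2 <= wt t) ->
  good f -> 0 < a -> a <= 1 -> 0 <= H ->
  (forall x t, nm (f (x + t *: delta) - f x) <= H * `|t| `^ a) ->
  forall x, nm (f x - average f x) <= (1 + 3 / c) * (H * M%:R `^ (- a)).
Proof.
move=> c0 Hc gf a0 a1 H0 Hf x; have [cf pf] := gf.
have MR : 0 < M%:R :> R by rewrite ltr0n.
have cw : continuous (fun y : 'rV[R]_n => wt (y ord0 i)) := @cont_wt_coord R n i.
have cK := @cont_kern_coord R n M i.
have cwK : continuous (fun y : 'rV[R]_n => wt (y ord0 i) * K y) := contM cw cK.
have -> : f x = cI (fun y : 'rV[R]_n => f x * (K y)%:C).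
  rewrite cIZ; last exact: cc_kern.
  rewrite (_ : cI _ = 1) ?mulr1// /torus_integral/=.
  by rewrite kern_coord_mean// tI_cst.
rewrite /average -cIB; [|exact: (ccM (@cc_cst R n _) cc_kern)|exact: (ccM (cc_line x gf) cc_kern)].
pose T := H * M%:R `^ (- a); have T0 : 0 <= T by rewrite mulr_ge0// powR_ge0.
apply: le_trans (nm_cI _) _.
  by apply: ccB; [exact: (ccM (@cc_cst R n _) cc_kern)|exact: (ccM (cc_line x gf) cc_kern)].
apply: (@le_trans _ _ (I (fun y => T * (M%:R ^+ 2 / c) * (wt (y ord0 i) * K y) + T * K y))); last first.
  have cTK : continuous (fun y : 'rV[R]_n => T * K y) by apply: contM => //; exact: cont_cst.
  rewrite tI_lin// tIZ// kern_coord_mean// mulr1.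
  have m := @kern_coord_moment R n M i M0.
  have -> : (1 + 3 / c) * T = T * (M%:R ^+ 2 / c) * (3 / M%:R ^+ 2) + T.
    by field; rewrite !gt_eqF.
  by rewrite lerD2r ler_wpM2l// !mulr_ge0// ?invr_ge0 ?exprn_ge0 ?ltW.
apply: tI_le => [||y yc].
- by apply: cc_nm; apply: ccB; [exact: (ccM (@cc_cst R n _) cc_kern)|exact: (ccM (cc_line x gf) cc_kern)].
- apply: cont_lin => //; apply: contM => //; exact: cont_cst.
rewrite -mulrBl Normc.normcM nm_real ger0_norm ?kern_ge0//.
rewrite [leRHS](_ : _ = (T * (M%:R ^+ 2 / c * wt (y ord0 i)) + T) * K y); last by ring.
apply: ler_wpM2r; first exact: kern_ge0.
set t := y ord0 i; have /andP[t0 t1] : 0 <= t <= 1 := yc i.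
(* [d] is the distance from [y_i] to the nearest integer. *)
have [d [d0 dw df]] : exists d, [/\ 0 <= d, c * d ^+ 2 <= wt t &
    nm (f x - f (x + t *: delta)) <= H * d `^ a].
  have [th|th] := leP t (1 / 2).
    exists t; split=> //; first by apply: Hc; rewrite t0.
    by rewrite nmB; apply: le_trans (Hf x t) _; rewrite ger0_norm.
  exists (1 - t); split; first by rewrite subr_ge0.
    by rewrite -wt_sym; apply: Hc; apply/andP; split; lra.
  have := Hf x (t - 1); rewrite ler0_norm ?subr_le0// opprB nmB.
  have -> : x + (t - 1) *: delta = x + t *: delta + vec_of_int (- kvec i 1).
    rewrite scalerBl addrA vecN scale1r; congr (_ - _).
    by apply/rowP => j; rewrite !mxE eqxx/=; case: (j == i).
  by rewrite pf.
apply: le_trans df _; rewrite /T.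
have -> : H * M%:R `^ (- a) * (M%:R ^+ 2 / c * wt t) + H * M%:R `^ (- a) =
   H * (M%:R `^ (- a) * (M%:R ^+ 2 / c * wt t + 1)) by ring.
rewrite ler_wpM2l// (powRN _ a) ler_pdivlMl ?powR_gt0// -powRM//.
have X0 : 0 <= M%:R * d by rewrite mulr_ge0.
apply: (@le_trans _ _ ((M%:R * d) ^+ 2 + 1)); last first.
  rewrite lerD2r exprMn -mulrA ler_wpM2l ?exprn_ge0//.
  by rewrite ler_pdivlMl.
have [X1|X1] := leP (M%:R * d) 1.
  apply: (@le_trans _ _ 1); last by rewrite lerDr sqr_ge0.
  have := @ge0_ler_powR R a (ltW a0) (M%:R * d) 1; rewrite powR1.
  by apply; rewrite ?nnegrE.
apply: (@le_trans _ _ (M%:R * d)); first by apply: ler1_powR => //; exact: ltW.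
by apply: (@le_trans _ _ ((M%:R * d) ^+ 2)); [rewrite expr2 ler_peMl// ltW|rewrite lerDl].
Qed.

End CoordinateAverage.

Section HolderApproximation.
Context {R : realType} {n : nat}.
Local Notation delta i := (delta_mx ord0 i : 'rV[R]_n).
Local Notation K M i y := (kern M ((y : 'rV[R]_n) ord0 i)).
Implicit Types (f g : 'rV[R]_n -> R[i]) (x y : 'rV[R]_n) (i : 'I_n) (M : nat) (k : 'rV[int]_n).

Definition resid i M f x : R[i] := f x - average i M f x.

Lemma good_resid i M f : (0 < M)%N -> good f -> good (resid i M f).
Proof.
move=> M0 gf; have gA := good_average i M0 gf.
have := good_lin (-1) gA gf; congr good.
by apply/funext => x; rewrite mulN1r addrC.
Qed.

Lemma good_iter i M j f : (0 < M)%N -> good f -> good (iter j (resid i M) f).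
Proof. by move=> M0 gf; elim: j => //= j; exact: good_resid. Qed.

Lemma resid_lin i M a f g : good f -> good g ->
  resid i M (fun x => a * f x + g x) = (fun x => a * resid i M f x + resid i M g x).
Proof.
by move=> gf gg; apply/funext => x; rewrite /resid average_lin//; ring.
Qed.

Lemma iter_resid_lin i M j a f g : (0 < M)%N -> good f -> good g ->
  iter j (resid i M) (fun x => a * f x + g x) =
  (fun x => a * iter j (resid i M) f x + iter j (resid i M) g x).
Proof.
move=> M0 gf gg; elim: j => //= j ->.
by apply: resid_lin; exact: good_iter.
Qed.

Lemma nm_iter_resid i M j f c : (0 < M)%N -> good f -> (forall x, nm (f x) <= c) ->
  forall x, nm (iter j (resid i M) f x) <= 2 ^+ j * c.
Proof.
move=> M0 gf fc; elim: j => [|j IH] x /=; first by rewrite expr0 mul1r.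
apply: le_trans (le_normcD _ _) _; rewrite normcN exprS -mulrA mulr_natl mulr2n.
by apply: lerD => //; apply: nm_average => //; exact: good_iter.
Qed.

Definition diff i (h : R) f x : R[i] := f (x + h *: delta i) - f x.

Lemma good_diff i h f : good f -> good (diff i h f).
Proof.
move=> gf; have := good_lin (-1) gf (good_shift (h *: delta i) gf); congr good.
by apply/funext => x; rewrite mulN1r addrC.
Qed.

Lemma resid_diff i M h f : good f -> resid i M (diff i h f) = diff i h (resid i M f).
Proof.
move=> gf; have -> : diff i h f = (fun x => (-1) * f x + f (x + h *: delta i)).
  by apply/funext => x; rewrite mulN1r addrC.
rewrite resid_lin//; last exact: good_shift.
by apply/funext => x; rewrite /diff /resid average_shift; ring.
Qed.

(** Smoothness is encoded by iterated differences, with one Hoelder exponent for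
    each of them, because averages commute with differences by linearity and
    translation invariance. *)
Fixpoint diffs_le i (l : seq R) f (H : R) : Prop :=
  match l with
  | [::] => forall x, nm (f x) <= H
  | a :: l' => forall h : R, diffs_le i l' (diff i h f) (H * `|h| `^ a)
  end.

Section Uniform.
Variable c : R.
Hypothesis c0 : 0 < c.
Hypothesis Hc : forall t : R, 0 <= t <= 1 / 2 -> c * t ^+ 2 <= wt t.
Let C := 1 + 3 / c.

Let C0 : 0 < C. Proof. by rewrite addr_gt0// divr_gt0. Qed.

(** Each application of [resid] trades one difference for a power of [M]: it
    commutes with differences, so they can be peeled off one at a time. *)
Lemma diffs_resid i M l a f H : (0 < M)%N -> good f -> 0 < a -> a <= 1 -> 0 <= H ->
  diffs_le i (rcons l a) f H -> diffs_le i l (resid i M f) (C * (H * M%:R `^ (- a))).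
Proof.
move=> M0 gf a0 a1; elim: l f H gf => [|b l IH] f H gf H0 /=.
  by move=> Hf; apply: (average_error M0 c0 Hc gf a0 a1 H0) => x t; exact: Hf.
move=> Hf h; rewrite -resid_diff//.
have -> : C * (H * M%:R `^ (- a)) * `|h| `^ b = C * (H * `|h| `^ b * M%:R `^ (- a)).
  by move: (_ `^ _) (_ `^ _) => *; ring.
apply: IH; [exact: good_diff|by rewrite mulr_ge0// powR_ge0|exact: Hf].
Qed.

Lemma diffs_iter_resid i M j a f H : (0 < M)%N -> good f -> 0 < a -> a <= 1 -> 0 <= H ->
  diffs_le i (a :: nseq j 1) f H ->
  forall x, nm (iter j.+1 (resid i M) f x) <= C ^+ j.+1 * (H * M%:R `^ (- (j%:R + a))).
Proof.
move=> M0 gf a0 a1; elim: j f H gf => [|j IH] f H gf H0 Hf x.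
  rewrite expr1 add0r; exact: (@diffs_resid i M [::] a f H).
have MR : 0 < M%:R :> R by rewrite ltr0n.
have nseq_rcons m : nseq m.+1 (1 : R) = rcons (nseq m 1) 1 by elim: m => //= m <-.
rewrite nseq_rcons -rcons_cons in Hf.
have H1 := diffs_resid M0 gf ltr01 (lexx 1) H0 Hf.
have H2 : 0 <= C * (H * M%:R `^ (- 1)) by rewrite !mulr_ge0 ?powR_ge0// ltW.
rewrite iterSr; apply: le_trans (IH _ _ (good_resid i M0 gf) H2 H1 x) _.
rewrite -natr1 (_ : - (j%:R + 1 + a) = -1 + - (j%:R + a)); last by ring.
rewrite (powRD (x := M%:R)) ?(gt_eqF MR) ?implybT//.
rewrite [in leRHS]exprS le_eqVlt; apply/orP; left; apply/eqP.
by move: (_ ^+ _) (_ `^ _) (_ `^ _) => *; ring.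
Qed.

End Uniform.

Lemma cderivable_shift i v f : cderivable i f -> cderivable i (fun x => f (x + v)) /\
  cpartial i (fun x => f (x + v)) = (fun x => cpartial i f (x + v)).
Proof.
move=> df.
have Q (F : 'rV[R]_n -> R) x :
    (fun h : R => h^-1 *: (((fun y => F (y + v)) \o shift x) (h *: delta i) - F (x + v))) =
    (fun h : R => h^-1 *: ((F \o shift (x + v)) (h *: delta i) - F (x + v))).
  by apply/funext => h; rewrite /= addrA.
split=> [x|].
  have [d1 d2] := df (x + v).
  by rewrite /derivable (Q (fun y => complex.Re (f y))) (Q (fun y => complex.Im (f y))).
apply/funext => x; rewrite /cpartial /derive.
by rewrite (Q (fun y => complex.Re (f y))) (Q (fun y => complex.Im (f y))).
Qed.

Lemma cpartials_diff i h j f : (forall l, (l < j)%N -> cderivable i (cpartials (nseq l i) f)) ->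
  forall l, (l <= j)%N -> cpartials (nseq l i) (diff i h f) = diff i h (cpartials (nseq l i) f).
Proof.
move=> df; elim=> [//|l IH lj]; have E := IH (ltnW lj).
rewrite /cpartials /= -!/(cpartials _ _) E.
have [ds Ds] := cderivable_shift (h *: delta i) (df l lj).
have -> : diff i h (cpartials (nseq l i) f) =
  (fun x => (-1) * cpartials (nseq l i) f x + cpartials (nseq l i) f (x + h *: delta i)).
  by apply/funext => x; rewrite mulN1r addrC.
rewrite (cderivable_lin (-1) (df l lj) ds).2 Ds.
by apply/funext => x; rewrite mulN1r addrC.
Qed.

Lemma cderivable_diff i h j f : (forall l, (l < j)%N -> cderivable i (cpartials (nseq l i) f)) ->
  forall l, (l < j)%N -> cderivable i (cpartials (nseq l i) (diff i h f)).
Proof.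
move=> df l lj; rewrite (cpartials_diff h df (ltnW lj)).
have [ds _] := cderivable_shift (h *: delta i) (df l lj).
have -> : diff i h (cpartials (nseq l i) f) =
  (fun x => (-1) * cpartials (nseq l i) f x + cpartials (nseq l i) f (x + h *: delta i)).
  by apply/funext => x; rewrite mulN1r addrC.
exact: (cderivable_lin (-1) (df l lj) ds).1.
Qed.

Lemma nm_diff_le i h f H : cderivable i f -> (forall x, nm (cpartial i f x) <= H) ->
  forall x, nm (diff i h f x) <= 2 * (H * `|h|).
Proof.
move=> df fH x; apply: le_trans (nm_le _) _; rewrite cReB cImB mulr_natl mulr2n.
have H0 : 0 <= H := le_trans (nm_ge0 _) (fH x).
have [s _ ->] := mean_value_line x h (fun y => (df y).1).
have [t _ ->] := mean_value_line x h (fun y => (df y).2).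
rewrite !normrM [H * _]mulrC; apply: lerD; apply: (ler_wpM2l (normr_ge0 h)).
  exact: le_trans (nm_Re (cpartial i f (x + s *: delta i))) (fH _).
exact: le_trans (nm_Im (cpartial i f (x + t *: delta i))) (fH _).
Qed.

(** The factor [2] for each difference comes from applying the mean value theorem to
    the real and imaginary parts. *)
Lemma diffs_of_derivatives i j f H :
  (forall l, (l < j)%N -> cderivable i (cpartials (nseq l i) f)) ->
  (forall x, nm (cpartials (nseq j i) f x) <= H) ->
  diffs_le i (nseq j 1) f (2 ^+ j * H).
Proof.
elim: j f H => [|j IH] f H df fH /=; first by rewrite expr0 mul1r.
move=> h; have -> : 2 ^+ j.+1 * H * `|h| `^ 1 = 2 ^+ j * (2 * (H * `|h|)).
  by rewrite powRr1// exprS; ring.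
apply: IH => [l lj|x].
  by apply: (cderivable_diff h (j := j.+1)) => //; exact: ltnW.
rewrite (cpartials_diff h df (leqnSn j)).
by apply: nm_diff_le; [exact: df|exact: fH].
Qed.

Lemma diffs_of_holder i j a f H :
  (forall l, (l < j)%N -> cderivable i (cpartials (nseq l i) f)) ->
  (forall h x, nm (diff i h (cpartials (nseq j i) f) x) <= H * `|h| `^ a) ->
  diffs_le i (a :: nseq j 1) f (2 ^+ j * H).
Proof.
move=> df fH h; rewrite -mulrA; apply: diffs_of_derivatives.
  exact: cderivable_diff.
by move=> x; rewrite (cpartials_diff h df (leqnn j)).
Qed.

Section Approximant.
Variable j : nat.

(** With [A] the average, this is [1 - (1 - A)^(j+1)]: it still kills the frequencies
    killed by [A], but its error is an iterated residual, of order [j + a] instead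
    of [a <= 1]. *)
Definition smooth1 i M f x : R[i] := f x - iter j.+1 (resid i M) f x.

Definition smooth (l : seq 'I_n) M f := foldr (fun i => smooth1 i M) f l.

Lemma good_smooth1 i M f : (0 < M)%N -> good f -> good (smooth1 i M f).
Proof.
move=> M0 gf; have := good_lin (-1) (good_iter i j.+1 M0 gf) gf; congr good.
by apply/funext => x; rewrite mulN1r addrC.
Qed.

Lemma good_smooth l M f : (0 < M)%N -> good f -> good (smooth l M f).
Proof. by move=> M0 gf; elim: l => //= i l; exact: good_smooth1. Qed.

(** Smoothing in one more coordinate [i] adds the error of [f] in that coordinate and
    multiplies the previous error by at most [1 + 2^(j+1)], since the residuals are
    linear. *)
Lemma smooth_error l M f E : (0 < M)%N -> good f ->
  (forall i x, nm (iter j.+1 (resid i M) f x) <= E) ->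
  forall x, nm (f x - smooth l M f x) <= (1 + 2 ^+ j.+1) ^+ size l * (size l)%:R * E.
Proof.
move=> M0 gf fE; elim: l => [|i l IH] x.
  by rewrite subrr nm0 mulr0 mul0r.
have E0 : 0 <= E := le_trans (nm_ge0 _) (fE i x).
set q := 1 + 2 ^+ j.+1 in IH *; have q1 : 1 <= q by rewrite lerDl exprn_ge0.
have gs := good_smooth l M0 gf.
pose w x := (-1) * smooth l M f x + f x.
have gw : good w := good_lin (-1) gs gf.
have wE y : nm (w y) <= q ^+ size l * (size l)%:R * E.
  by have := IH y; rewrite /w mulN1r addrC.
have E1 : f x - smooth (i :: l) M f x =
    iter j.+1 (resid i M) f x + (w x - iter j.+1 (resid i M) w x).
  rewrite /w iter_resid_lin// [smooth (i :: l) M f]/(smooth1 i M (smooth l M f)) /smooth1.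
  by move: (iter _ _ _ _) (iter _ _ _ _) (smooth l M f x) => *; ring.
rewrite E1; apply: le_trans (le_normcD _ _) _.
have -> : q ^+ size (i :: l) * (size (i :: l))%:R * E =
    q ^+ (size l).+1 * E + q * (q ^+ size l * (size l)%:R * E).
  by rewrite -[(size (i :: l))%:R]natr1 exprS; ring.
apply: lerD.
  by apply: le_trans (fE i x) _; rewrite ler_peMl// exprn_ege1.
apply: le_trans (le_normcD _ _) _; rewrite normcN [in leRHS]/q [leRHS]mulrDl mul1r -/q.
by apply: lerD; [exact: wE|exact: nm_iter_resid].
Qed.

Definition kcoef M i k : R[i] := cI (fun y => e (kvec i (k ord0 i)) y * (K M i y)%:C).

Lemma fcoefB f g k : ccontinuous f -> ccontinuous g ->
  fcoef (fun x => f x - g x) k = fcoef f k - fcoef g k.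
Proof.
move=> cf cg; have := fcoef_lin (-1) k cg cf.
by under [X in fcoef X _ = _ -> _]eq_fun do rewrite mulN1r addrC; rewrite mulN1r addrC.
Qed.

Lemma fcoef_iter_resid i M m f k : (0 < M)%N -> good f ->
  fcoef (iter m (resid i M) f) k = (1 - kcoef M i k) ^+ m * fcoef f k.
Proof.
move=> M0 gf; elim: m => [|m IH] /=; first by rewrite expr0 mul1r.
have gi := good_iter i m M0 gf.
rewrite fcoefB; [|by case: gi|by case: (good_average i M0 gi)].
by rewrite fcoef_average// -/(kcoef M i k) IH exprS; ring.
Qed.

Lemma fcoef_smooth l M f k i : (0 < M)%N -> good f -> i \in l ->
  (M.*2 <= absz (k ord0 i))%N -> fcoef (smooth l M f) k = 0.
Proof.
move=> M0 gf il ki; elim: l il => //= i' l IH.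
have gs := good_smooth l M0 gf.
have E : fcoef (smooth1 i' M (smooth l M f)) k =
    (1 - (1 - kcoef M i' k) ^+ j.+1) * fcoef (smooth l M f) k.
  rewrite fcoefB; [|by case: gs|by case: (good_iter i' j.+1 M0 gs)].
  by rewrite fcoef_iter_resid//; ring.
rewrite E inE => /orP[/eqP <-|/IH ->]; last by rewrite mulr0.
by rewrite /kcoef cI_mode_kern_high// subr0 expr1n subrr mul0r.
Qed.

Lemma fcoef_smooth_zcube M f k : (0 < M)%N -> good f -> k \notin zcube M.*2 ->
  fcoef (smooth (enum 'I_n) M f) k = 0.
Proof.
move=> M0 gf; rewrite mem_zcube negb_forall; case/existsP => i.
by rewrite -ltnNge => ki; apply: (fcoef_smooth M0 gf (mem_enum _ i) (ltnW ki)).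
Qed.

Lemma spectrum_smooth M f : (0 < M)%N -> good f ->
  spectrum_in M.*2 (smooth (enum 'I_n) M f).
Proof.
move=> M0 gf; have [cs ps] := good_smooth (enum 'I_n) M0 gf.
by apply: spectrum_inP => // k; exact: fcoef_smooth_zcube.
Qed.

End Approximant.
End HolderApproximation.

Section HolderErgodic.
Context {R : realType} {n : nat}.
Local Notation delta i := (delta_mx ord0 i : 'rV[R]_n).
Implicit Types (f g : 'rV[R]_n -> R[i]) (x y : 'rV[R]_n) (i : 'I_n).

Definition pure_degree m i : {ffun 'I_n -> 'I_m.+1} :=
  [ffun j => if j == i then ord_max else ord0].

Lemma degree_pure m i : degree (pure_degree m i) = m.
Proof.
rewrite /degree (bigD1 i)//= ffunE eqxx big1 ?addn0// => j /negbTE ji.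
by rewrite ffunE ji.
Qed.

Lemma multi_derive_pure m i f : multi_derive (pure_degree m i) f = cpartials (nseq m i) f.
Proof.
rewrite /multi_derive; congr cpartials.
have -> : [seq nseq (pure_degree m i j) j | j <- enum 'I_n] =
    [seq if j == i then nseq m i else [::] | j <- enum 'I_n].
  by apply: eq_map => j; rewrite ffunE; have [->|] := eqVneq j i.
have : count_mem i (enum 'I_n) = 1%N by rewrite count_uniq_mem ?enum_uniq// mem_enum.
elim: (enum 'I_n) => //= j s IH.
have [_|_] := eqVneq j i; last by rewrite add0n => /IH.
rewrite add1n => -[s0]; rewrite -[RHS]cats0; congr (_ ++ _).
elim: s s0 {IH} => //= j' s IH; case: eqP => //= _; rewrite add0n; exact: IH.
Qed.

Lemma multi_derive0 m f :
  multi_derive [ffun _ => ord0 : 'I_m.+1] f = f.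
Proof.
rewrite /multi_derive (_ : flatten _ = [::])//.
by elim: (enum 'I_n) => //= j s ->; rewrite ffunE.
Qed.

Lemma le_sume (J : finType) (P : pred J) (F : J -> \bar R) j : P j ->
  (forall l, (0 <= F l)%E) -> (F j <= \sum_(l | P l) F l)%E.
Proof. by move=> Pj F0; rewrite (bigD1 j)//= leeDl// sume_ge0. Qed.

Lemma holder_seminorm_ge0 a g : (0 < n)%N -> (0 <= holder_seminorm a g)%E.
Proof.
move=> n0; pose h : 'rV[R]_n := const_mx 1.
have h0 : h != 0.
  by apply/eqP => /rowP/(_ (Ordinal n0)); rewrite !mxE; apply/eqP; rewrite oner_eq0.
pose v := nm (g (0 + h) - g 0) / enorm h `^ a.
apply: (@le_trans _ _ v%:E).
  by rewrite lee_fin divr_ge0 ?nm_ge0// powR_ge0.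
by apply: ereal_sup_ubound; exists 0 => //; exists h.
Qed.

Lemma enorm_delta i (t : R) : enorm (t *: delta i) = `|t|.
Proof.
rewrite /enorm /dot (bigD1 i)//= !mxE !eqxx !mulr1 big1 ?addr0.
  by rewrite -expr2 sqrtr_sqr.
by move=> j /negbTE ji; rewrite !mxE ji mulr0 mul0r.
Qed.

Lemma holder_le m a f : (0 < n)%N -> in_holder m a f ->
  (forall x, nm (f x) <= fine (holder_norm m a f)) /\
  (forall i h x, nm (diff i h (cpartials (nseq m i) f) x) <=
     fine (holder_norm m a f) * `|h| `^ a).
Proof.
move=> n0 [_ _ foo].
have S0 : (0 <= Ck_norm m f)%E by apply: sume_ge0 => b _; exact: sup_norm_ge0.
have Q0 : (0 <= \sum_(b : {ffun 'I_n -> 'I_m.+1} | degree b == m)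
     holder_seminorm a (multi_derive b f))%E.
  by apply: sume_ge0 => b _; exact: holder_seminorm_ge0.
have N0 : (0 <= holder_norm m a f)%E by rewrite adde_ge0.
have NE : holder_norm m a f = (fine (holder_norm m a f))%:E.
  by rewrite fineK// ge0_fin_numE.
split=> [x|i h x]; rewrite -lee_fin.
  rewrite -NE; apply: le_trans (leeDl _ Q0); apply: (@le_trans _ _ (sup_norm f)).
    by apply: ereal_sup_ubound; exists x.
  rewrite -{1}(multi_derive0 m f) /Ck_norm.
  apply: (le_sume (P := fun b : {ffun 'I_n -> 'I_m.+1} => (degree b <= m)%N)
    (F := fun b => sup_norm (multi_derive b f))) => [|b]; last exact: sup_norm_ge0.
  by rewrite /degree big1// => j _; rewrite ffunE.
have [->|h0] := eqVneq h 0.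
  by rewrite /diff scale0r addr0 subrr nm0 lee_fin mulr_ge0 ?powR_ge0// fine_ge0.
have hp : 0 < `|h| `^ a by rewrite powR_gt0// normr_gt0.
rewrite lee_fin -ler_pdivrMr// -lee_fin -NE.
apply: le_trans (leeDr _ S0).
apply: (@le_trans _ _ (holder_seminorm a (multi_derive (pure_degree m i) f))).
  apply: ereal_sup_ubound; exists x => //; exists (h *: delta i).
    rewrite /= -normr_gt0 in h0 *.
    apply: contraTneq h0 => E; rewrite -(enorm_delta i h) E.
    by rewrite -(scale0r (delta i)) enorm_delta normr0 ltxx.
  by rewrite enorm_delta multi_derive_pure.
apply: (le_sume (P := fun b : {ffun 'I_n -> 'I_m.+1} => degree b == m)
  (F := fun b => holder_seminorm a (multi_derive b f))) => [|b].
  by rewrite degree_pure.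
exact: holder_seminorm_ge0.
Qed.

(** Differentiating [m] times in one coordinate provides the iterated differences
    that [diffs_iter_resid] asks for, and [smooth_error] adds up the coordinates. *)
Lemma holder_approximation m a : (0 < n)%N -> 0 < a -> a <= 1 ->
  exists2 C : R, 0 < C & forall f, in_holder m a f -> forall M, (0 < M)%N ->
    forall x, nm (f x - smooth m (enum 'I_n) M f x) <=
      C * (fine (holder_norm m a f) * M%:R `^ (- (m%:R + a))).
Proof.
move=> n0 a0 a1; have [c c0 Hc] := @sqr_le_wt R.
pose q : R := 1 + 2 ^+ m.+1; pose C := 1 + 3 / c.
have q0 : 0 < q by rewrite ltr_wpDr ?exprn_ge0.
have C0 : 0 < C by rewrite addr_gt0// divr_gt0.
exists (q ^+ n * n%:R * (C ^+ m.+1 * 2 ^+ m)).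
  by rewrite !mulr_gt0 ?exprn_gt0// ltr0n.
move=> f fH M M0 x; have [Nf Nd] := holder_le n0 fH.
set N := fine _ in Nf Nd *; have N0 : 0 <= N := le_trans (nm_ge0 _) (Nf 0).
have [pf [cf df] _] := fH.
have gf : good f by split=> //; exact: (cf [::]).
have dl i l : (l < m)%N -> cderivable i (cpartials (nseq l i) f).
  by move=> lm; apply: df; rewrite size_nseq.
have E i := diffs_iter_resid c0 Hc M0 gf a0 a1 (mulr_ge0 (exprn_ge0 m (ler0n _ 2)) N0)
   (diffs_of_holder (dl i) (Nd i)).
apply: le_trans (smooth_error (enum 'I_n) M0 gf E x) _.
rewrite -/q size_enum_ord le_eqVlt; apply/orP; left; apply/eqP.
by rewrite /C; move: (_ `^ _) (_ ^+ m.+1) (q ^+ n) (N) => *; ring.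
Qed.

(** Smoothings at consecutive scales [2^m] and [2^(m+1)] differ by a block of size
    [2^(-ms)].  So [deviation_rate] applies with constant weights, whose partial
    sums grow linearly: this is the case [ee = 1] and explains the logarithm. *)
Lemma holder_ergodic (sigma : R) (k : nat) (alpha M : R) : (0 < n)%N ->
  0 < sigma -> 0 < alpha -> alpha <= 1 ->
  exists C : R, 0 < C /\
  forall f, in_holder k alpha f ->
    forall (Comega : R) (omega x : 'rV[R]_n) (T : R),
      0 < Comega -> diophantine sigma Comega omega ->
      sigma < k%:R + alpha \/ Comega <= M ->
      admissible_time sigma (k%:R + alpha) T ->
      ergodic_error f x omega T <=
        C / Comega * fine (holder_norm k alpha f) * rate sigma (k%:R + alpha) 1 T.
Proof.
move=> n0 s0 a0 a1; have [D D0 HD] := holder_approximation k n0 a0 a1.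
set s := k%:R + alpha in HD *; have sp : 0 < s by rewrite ltr_wpDl.
have [C C0 HC] := deviation_rate M n0 s0 sp (@ler01 R).
pose P : R := 2 `^ (- s); have P0 : 0 < P by rewrite powR_gt0.
(* [P^-1] since a block of index [m + 1] contains the error at the scale [2^m]. *)
pose W := D * (1 + P^-1) + 1.
have DP0 : 0 <= D * (1 + P^-1) by rewrite mulr_ge0 ?addr_ge0 ?invr_ge0// ltW.
have W0 : 0 < W by rewrite ltr_wpDl.
exists (C * W); split=> [|f fH Cw omega x T Cw0 Dio hyp adm]; first exact: mulr_gt0.
have [Nf _] := holder_le n0 fH; have {HD} HD := HD f fH.
set N := fine _ in Nf HD *; have N0 : 0 <= N := le_trans (nm_ge0 _) (Nf 0).
have [pf [cf _] _] := fH.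
have gf : good f by split=> //; exact: (cf [::]).
pose S m := smooth k (enum 'I_n) (2 ^ m) f.
have M20 m : (0 < 2 ^ m)%N by rewrite expn_gt0.
have S_err m y : nm (f y - S m y) <= P ^+ m * (D * N).
  apply: le_trans (HD _ (M20 m) y) _; rewrite natrX -powR_mulrn// -powRrM.
  by rewrite (pow2_mul (- s)) -/P le_eqVlt; apply/orP; left; apply/eqP; ring.
have gS m : good (S m) by exact: good_smooth.
have sS m : spectrum_in (2 ^ m.+1) (S m).
  by rewrite expnS mul2n; exact: spectrum_smooth.
pose g m := if m is m'.+1 then (fun y => S m y - S m' y) else S 0%N.
have sg m : spectrum_in (2 ^ m.+1) (g m).
  case: m => [|m]; first exact: sS.
  have [c1 p1] := gS m.+1; have [c2 p2] := gS m.
  apply: spectrum_inP => [||l lm]; first exact: ccB.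
    by move=> y l; rewrite /g p1 p2.
  rewrite fcoefB// !fcoef_smooth_zcube ?subrr// -?mul2n -?expnS//.
  by apply: contraNN lm; apply: zcube_sub; rewrite leq_exp2l.
have psumS m : psum g m.+1 = S m.
  apply/funext => y; rewrite /psum; elim: m => [|m IH]; first by rewrite big_ord1.
  by rewrite big_ord_recr/= IH addrC subrK.
have gb m y : nm (g m y) <= P ^+ m * (W * N).
  case: m => [|m].
    rewrite expr0 mul1r /g (_ : S 0%N y = (-1) * (f y - S 0%N y) + f y); last by ring.
    apply: le_trans (le_normcD _ _) _; rewrite mulN1r normcN /W mulrDl mul1r lerD//.
    apply: le_trans (S_err 0%N y) _; rewrite expr0 mul1r ler_wpM2r// ler_peMr ?(ltW D0)//.
    by rewrite lerDl invr_ge0 ltW.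
  rewrite /g (_ : S m.+1 y - S m y = (f y - S m y) - (f y - S m.+1 y)); last by ring.
  apply: le_trans (le_normcD _ _) _; rewrite normcN.
  apply: (@le_trans _ _ (P ^+ m * (D * N) + P ^+ m.+1 * (D * N))).
    by apply: lerD; exact: S_err.
  have -> : P ^+ m = P ^+ m.+1 * P^-1 by rewrite exprSr mulfK ?gt_eqF.
  rewrite -!mulrA -mulrDr ler_pM2l ?exprn_gt0// /W [leRHS]mulrDl mul1r.
  rewrite (_ : D * (1 + P^-1) * N = P^-1 * (D * N) + D * N); last by ring.
  by rewrite lerDl.
have lim : unif_limit (psum g) f.
  move=> eps e0; have P1 : P < 1 by rewrite pow2_lt1// oppr_lt0.
  have DN : 0 < D * N + 1 by rewrite ltr_wpDl// mulr_ge0// ltW.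
  have := cvg_expr; have : `|P| < 1 by rewrite gtr0_norm.
  move=> /cvg_expr /cvgrPdist_le /(_ (eps / (D * N + 1))) [|m0 _ H].
    by rewrite divr_gt0.
  exists m0.+1 => -[//|m] mm y; rewrite psumS.
  apply: le_trans (S_err m y) _; have := H m mm.
  rewrite sub0r normrN ger0_norm ?exprn_ge0 ?(ltW P0)// ler_pdivlMr// => H1; apply: le_trans H1.
  by rewrite ler_wpM2l ?exprn_ge0 ?(ltW P0)// lerDl.
rewrite ergodic_errorE.
apply: le_trans (HC g f (fun _ => W * N) (W * N) sg gb _ _ lim Cw omega x T Cw0 Dio _ adm) _.
- by move=> m; rewrite lexx mulr_ge0// ltW.
- by move=> J; rewrite powRr1// sumr_const card_ord mulr_natl.
- by case: hyp => ?; [apply: Or31|apply: Or33].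
by rewrite le_eqVlt; apply/orP; left; apply/eqP; move: (rate _ _ _ _) => r; ring.
Qed.

End HolderErgodic.

End ErgodicAverages.

Import Order.TTheory GRing.Theory Num.Theory.

Local Open Scope ring_scope.

Theorem theorem1p1 (R : realType) (n : nat) (hn : (2 <= n)%N)
    (chi : R -> R) (hchi : besov_cutoff chi) :
  [/\
   (forall (sigma s p : R) (q : \bar R),
      0 < sigma -> 1 < p -> p <= 2 -> (1 <= q)%E ->
      (q = 1%E /\ Num.max sigma (n%:R / p) <= s) \/
      ((1 < q)%E /\ Num.max sigma (n%:R / p) < s) ->
      exists C : R, 0 < C /\
      forall u : ('rV[R]_n -> R[i]) -> R[i], in_besov chi s p%:E q u ->
        (exists f : 'rV[R]_n -> R[i], continuous_representative u f) /\
        forall f : 'rV[R]_n -> R[i], continuous_representative u f ->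
        forall (Comega : R) (omega x : 'rV[R]_n) (T : R),
          0 < Comega -> diophantine sigma Comega omega -> 0 < T ->
          ergodic_error f x omega T <=
            C / Comega * fine (besov_norm chi s p%:E q u) * T^-1),
   (forall (sigma s : R) (q : \bar R) (M : R),
      0 < sigma -> 0 < s -> (1 <= q)%E ->
      exists C : R, 0 < C /\
      forall u : ('rV[R]_n -> R[i]) -> R[i], in_besov chi s +oo%E q u ->
        (exists f : 'rV[R]_n -> R[i], continuous_representative u f) /\
        forall f : 'rV[R]_n -> R[i], continuous_representative u f ->
        forall (Comega : R) (omega x : 'rV[R]_n) (T : R),
          0 < Comega -> diophantine sigma Comega omega ->
          [\/ sigma < s, s = sigma /\ q = 1%E | Comega <= M] ->
          admissible_time sigma s T ->
          ergodic_error f x omega T <=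
            C / Comega * fine (besov_norm chi s +oo%E q u) *
            rate sigma s (conjugate_inv q) T) &
   (forall (sigma : R) (k : nat) (alpha M : R),
      0 < sigma -> 0 < alpha -> alpha <= 1 ->
      exists C : R, 0 < C /\
      forall f : 'rV[R]_n -> R[i], in_holder k alpha f ->
        forall (Comega : R) (omega x : 'rV[R]_n) (T : R),
          0 < Comega -> diophantine sigma Comega omega ->
          sigma < k%:R + alpha \/ Comega <= M ->
          admissible_time sigma (k%:R + alpha) T ->
          ergodic_error f x omega T <=
            C / Comega * fine (holder_norm k alpha f) *
            rate sigma (k%:R + alpha) 1 T)].
Proof.
have n0 : (0 < n)%N by exact: ltn_trans hn.
split.
- by move=> sigma s p q; exact: (besov_Lp_ergodic n0 hchi).
- by move=> sigma s q M; exact: (besov_sup_ergodic n0 hchi).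
- by move=> sigma k alpha M; exact: holder_ergodic.
Qed.
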